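(* Let $\mathbf{T}\equiv(T_1,T_2)$ be a commuting $2$-variable weighted shift such that $T_1$ and $T_2$ are both subnormal operators (i.e. $\mathbf{T}\in\mathfrak{H}_0$), and suppose $\mathbf{T}$ is flat with weights $$\alpha_{(k_1,0)}=x_{k_1}\ (k_1\ge 0),\quad \beta_{(0,k_2)}=y_{k_2}\ (k_2\ge 0),\quad \alpha_{(0,1)}=a,\quad \alpha_{(k_1,k_2)}=1,\ \ \beta_{(k_1,k_2)}=b\ (k_1,k_2\ge 1),$$ where $\{x_n\}_{n\ge0},\{y_n\}_{n\ge0}$ are bounded sequences of positive numbers and $a,b>0$. Let $\xi_x$ and $\eta_y$ be the Berger measures of the subnormal unilateral weighted shifts $\mathrm{shift}(x_0,x_1,\dots)$ and $\mathrm{shift}(y_0,y_1,\dots)$, let $(\eta_y)_1$ be the Berger measure of $\mathrm{shift}(y_1,y_2,\dots)$, and let $m:=\eta_y(\{b^2\})$. Define the (signed) measures on $[0,\infty)$ $$\psi:=(\eta_y)_1-a^2\delta_{b^2},\qquad \varphi:=\xi_x-y_0^2\left\|\tfrac1t\right\|_{L^1(\psi)}\delta_0-\frac{a^2y_0^2}{b^2}\,\delta_1,$$ where $\left\|\frac1t\right\|_{L^1(\psi)}:=\int\frac1t\,d\psi(t)$. Then the following are equivalent: (i) $\mathbf{T}$ is (jointly) subnormal; (ii) $\psi$ and $\varphi$ are positive measures; (iii) $\frac{b}{a}\sqrt{m}\ge y_0$ and $$\xi_x\ge y_0^2\left\{\left(\left\|\tfrac1t\right\|_{L^1((\eta_y)_1)}-\frac{a^2}{b^2}\right)\delta_0+\frac{a^2}{b^2}\,\delta_1\right\}.$$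 Moreover, when $\mathbf{T}$ is subnormal, its Berger measure is $$\mu=\varphi\times(\delta_0-\delta_{b^2})+y_0^2\left\|\tfrac1t\right\|_{L^1(\psi)}\delta_0\times(\widetilde{\psi}-\delta_{b^2})+\xi_x\times\delta_{b^2},$$ where $d\widetilde{\psi}(t):=\frac{1}{t\left\|\frac1t\right\|_{L^1(\psi)}}\,d\psi(t)$ (the term containing $\widetilde{\psi}$ being read as $0$ when $\psi=0$).
   Context: A unilateral weighted shift $\mathrm{shift}(\omega_0,\omega_1,\dots)$, with $\{\omega_n\}$ a bounded sequence of positive numbers, acts on $\ell^2(\mathbb{Z}_+)$ by $e_n\mapsto\omega_n e_{n+1}$. It is subnormal if and only if there is a (unique, compactly supported) probability measure $\zeta$ on $[0,\infty)$, called its Berger measure, with $\omega_0^2\cdots\omega_{k-1}^2=\int s^k\,d\zeta(s)$ for all $k\ge0$ (the empty product being $1$). Given bounded families of positive numbers $\alpha_{\mathbf{k}},\beta_{\mathbf{k}}$, $\mathbf{k}=(k_1,k_2)\in\mathbb{Z}_+^2$, the $2$-variable weighted shift $\mathbf{T}=(T_1,T_2)$ acts on $\ell^2(\mathbb{Z}_+^2)$ by $T_1e_{\mathbf{k}}=\alpha_{\mathbf{k}}e_{\mathbf{k}+(1,0)}$ and $T_2e_{\mathbf{k}}=\beta_{\mathbf{k}}e_{\mathbf{k}+(0,1)}$. The pair commutes if and only if $\beta_{\mathbf{k}+(1,0)}\alpha_{\mathbf{k}}=\alpha_{\mathbf{k}+(0,1)}\beta_{\mathbf{k}}$ for all $\mathbf{k}$;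 in the situation of the claim, commutativity determines all remaining weights ($\alpha_{(0,k_2)}$ for $k_2\ge2$ and $\beta_{(k_1,0)}$ for $k_1\ge1$) from the listed ones. $\mathbf{T}$ is called flat if $\alpha_{(k_1,k_2)}=\alpha_{(1,1)}$ and $\beta_{(k_1,k_2)}=\beta_{(1,1)}$ for all $k_1,k_2\ge1$. A pair is (jointly) subnormal if it is the restriction of a commuting pair of normal operators to a common invariant subspace. $\mathfrak{H}_0$ denotes the class of commuting pairs of subnormal operators. The moments of a commuting $\mathbf{T}$ are $\gamma_{(k_1,k_2)}(\mathbf{T})=\|T_1^{k_1}T_2^{k_2}e_{(0,0)}\|^2$. A commuting $2$-variable weighted shift $\mathbf{T}$ is subnormal if and only if there is a probability measure $\mu$ (its Berger measure) on $[0,\|T_1\|^2]\times[0,\|T_2\|^2]$ with $\gamma_{\mathbf{k}}(\mathbf{T})=\int s^{k_1}t^{k_2}\,d\mu(s,t)$ for all $\mathbf{k}\in\mathbb{Z}_+^2$. $\delta_p$ denotes the point mass at $p$; for (signed) measures, $\nu_1\ge\nu_2$ means that $\nu_1-\nu_2$ is a positive measure; $\nu\times\nu'$ is the product measure, with the first factor in the variable $s$ and the second in $t$. One has $d(\eta_y)_1(t)=\frac{t}{y_0^2}\,d\eta_y(t)$, so $\frac1t\in L^1((\eta_y)_1)$ and $\int\frac1t\,d\psi=\|\frac1t\|_{L^1((\eta_y)_1)}-\frac{a^2}{b^2}$. *)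

(* Defs.v *)
From HB Require Import structures.
From mathcomp Require Import all_boot all_order all_algebra.
From mathcomp Require Import complex ring lra.
From mathcomp Require Import all_classical all_reals all_analysis.

Set Implicit Arguments.
Unset Strict Implicit.
Unset Printing Implicit Defensive.

Import Order.TTheory GRing.Theory Num.Theory.
Import numFieldNormedType.Exports.
Import Normc.

Local Open Scope classical_set_scope.
Local Open Scope ring_scope.

Section Hilbert.
Variable R : realType.

(* [{dot U for Num.conj}] is linear in the first argument and conjugate-linear
   in the second; [d x x] has zero imaginary part. *)
Definition dnorm (U : lmodType R[i]) (d : {dot U for Num.conj}) (x : U) : R :=
  Num.sqrt (complex.Re (d x x)).

Record hilbert := Hilbert {
  hilbert_sort :> lmodType R[i];
  hdot : {dot hilbert_sort for Num.conj};
  hilbert_complete : forall u : nat -> hilbert_sort,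
    (forall eps : R, 0 < eps -> exists N, forall m n, (N <= m)%N -> (N <= n)%N ->
       dnorm hdot (u m - u n) < eps) ->
    exists l, forall eps : R, 0 < eps -> exists N, forall n, (N <= n)%N ->
       dnorm hdot (u n - l) < eps
}.

Definition hnorm (H : hilbert) (x : H) : R := dnorm (hdot H) x.

End Hilbert.

Section sums.
Variables (R : realType) (T : choiceType).
Local Open Scope ereal_scope.
Implicit Types (a b p q : T -> R).

(* Meaningful for absolutely summable families only: the positive and negative
   parts are summed separately. *)
Definition rsum a : R :=
  fine (\esum_(k in [set: T]) (EFin \o a)^\+ k -
        \esum_(k in [set: T]) (EFin \o a)^\- k).

Definition csum (f : T -> R[i]) : R[i] :=
  Complex (rsum (fun k => complex.Re (f k))) (rsum (fun k => complex.Im (f k))).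

Definition nsum a : \bar R := \esum_(k in [set: T]) (a k)%:E.

Lemma nsum_ge0 a : (forall k, (0 <= a k)%R) -> 0 <= nsum a.
Proof. by move=> a0; apply: esum_ge0 => k _; rewrite lee_fin. Qed.

Lemma nsum_fin a : (forall k, (0 <= a k)%R) -> nsum a < +oo ->
  nsum a \is a fin_num.
Proof. by move=> a0 aoo; rewrite ge0_fin_numE// nsum_ge0. Qed.

Lemma le_nsum a b : (forall k, (a k <= b k)%R) -> nsum a <= nsum b.
Proof. by move=> ab; apply: le_esum => k _; rewrite lee_fin. Qed.

Lemma nsumD a b : (forall k, (0 <= a k)%R) -> (forall k, (0 <= b k)%R) ->
  nsum (fun k => a k + b k)%R = nsum a + nsum b.
Proof.
move=> a0 b0; rewrite /nsum -esumD; last 2 first.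
- by move=> k _; rewrite lee_fin.
- by move=> k _; rewrite lee_fin.
by apply: eq_esum => k _; rewrite EFinD.
Qed.

Lemma le_nsumZ (c : R) a : (0 <= c)%R -> (forall k, (0 <= a k)%R) ->
  nsum (fun k => c * a k)%R <= c%:E * nsum a.
Proof.
move=> c0 a0; apply: ge_ereal_sup => _ [X [finX _] <-].
have -> : \sum_(k \in X) (c * a k)%:E = c%:E * \sum_(k \in X) (a k)%:E.
  by rewrite ge0_mule_fsumr// => k; rewrite lee_fin.
apply: lee_wpmul2l; first by rewrite lee_fin.
by apply: ereal_sup_ubound; exists X.
Qed.

Lemma nsumZ (c : R) a : (0 <= c)%R -> (forall k, (0 <= a k)%R) ->
  nsum (fun k => c * a k)%R = c%:E * nsum a.
Proof.
move=> c0 a0; apply/eqP; rewrite eq_le le_nsumZ//=.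
have [->|cN0] := eqVneq c 0%R.
  by rewrite mul0e nsum_ge0// => k; rewrite mul0r.
have {cN0}c0 : (0 < c)%R by rewrite lt0r cN0.
rewrite -lee_pdivlMl//.
have -> : a = (fun k => c^-1 * (c * a k))%R.
  by apply/funext => k; rewrite mulrA mulVf ?gt_eqF// mul1r.
have := @le_nsumZ c^-1 (fun k => c * a k)%R.
rewrite invr_ge0 (ltW c0) => /(_ isT) H.
rewrite (_ : (fun k => c * (c^-1 * (c * a k))) = (fun k => c * a k))%R.
  by apply: H => k; rewrite mulr_ge0// ltW.
by apply/funext => k; rewrite mulVKf// gt_eqF.
Qed.

Definition smb a := nsum (fun k => `|a k|%R) < +oo.

Lemma smb_le a b : (forall k, (`|a k| <= `|b k|)%R) -> smb b -> smb a.
Proof. by move=> ab; apply: le_lt_trans; exact: le_nsum. Qed.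

Lemma smbN a : smb a -> smb (fun k => - a k)%R.
Proof. by apply: smb_le => k; rewrite normrN. Qed.

Lemma smbZ c a : smb a -> smb (fun k => c * a k)%R.
Proof.
rewrite /smb => sa.
rewrite (_ : (fun k => `|c * a k|) = (fun k => `|c| * `|a k|))%R; last first.
  by apply/funext => k; rewrite normrM.
by rewrite nsumZ// -(fineK (nsum_fin _ sa))// -EFinM ltry.
Qed.

Lemma smbD a b : smb a -> smb b -> smb (fun k => a k + b k)%R.
Proof.
rewrite /smb => sa sb.
apply: (@le_lt_trans _ _ (nsum (fun k => `|a k| + `|b k|)%R)).
  by apply: le_nsum => k; exact: ler_normD.
by rewrite nsumD// lte_add_pinfty.
Qed.

Lemma rsumE p q a : (forall k, (0 <= p k)%R) -> (forall k, (0 <= q k)%R) ->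
  nsum p < +oo -> nsum q < +oo -> (forall k, a k = p k - q k)%R ->
  (rsum a = fine (nsum p) - fine (nsum q))%R.
Proof.
move=> p0 q0 sp sq aE; rewrite /rsum.
rewrite (_ : EFin \o a = (EFin \o p) \- (EFin \o q)); last first.
  by apply/funext => k /=; rewrite aE EFinB.
have sumE r : (forall k, (0 <= r k)%R) -> nsum r < +oo ->
    summable [set: T] (EFin \o r).
  move=> r0; apply: le_lt_trans; apply: le_esum => k _ /=.
  by rewrite ger0_norm.
rewrite esumB; [|exact: sumE|exact: sumE|by move=> k _; rewrite /= lee_fin..].
by rewrite fineB// nsum_fin.
Qed.

Let pos a k := Num.max (a k) 0%R.
Let neg a k := Num.max (- a k)%R 0%R.

Let pos_ge0 a k : (0 <= pos a k)%R. Proof. by rewrite le_max lexx orbT. Qed.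
Let neg_ge0 a k : (0 <= neg a k)%R. Proof. by rewrite le_max lexx orbT. Qed.

Let posneg a k : (a k = pos a k - neg a k)%R.
Proof.
rewrite /pos /neg; have [ak|ak] : (0 <= a k)%R \/ (a k < 0)%R by case: (leP 0%R (a k)); [left|right].
  by rewrite max_l// max_r ?subr0// oppr_le0.
by rewrite max_r ?(ltW ak)// max_l ?sub0r ?opprK// oppr_ge0 ltW.
Qed.

Let pos_sum a : smb a -> nsum (pos a) < +oo.
Proof.
apply: le_lt_trans; apply: le_nsum => k.
by rewrite ge_max normr_ge0 andbT ler_norm.
Qed.

Let neg_sum a : smb a -> nsum (neg a) < +oo.
Proof.
apply: le_lt_trans; apply: le_nsum => k.
by rewrite ge_max normr_ge0 andbT -[leRHS]normrN ler_norm.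
Qed.

Let pos_fin a : smb a -> nsum (pos a) \is a fin_num.
Proof. by move=> sa; rewrite nsum_fin// pos_sum. Qed.

Let neg_fin a : smb a -> nsum (neg a) \is a fin_num.
Proof. by move=> sa; rewrite nsum_fin// neg_sum. Qed.

Let rsum_posneg a : smb a ->
  (rsum a = fine (nsum (pos a)) - fine (nsum (neg a)))%R.
Proof.
by move=> sa; apply: rsumE => //; [exact: pos_sum|exact: neg_sum].
Qed.

Lemma rsum_ge0E a : (forall k, (0 <= a k)%R) -> nsum a < +oo ->
  rsum a = fine (nsum a).
Proof.
move=> a0 sa.
have nsum0 : nsum (fun=> 0%R) = 0 by apply: esum1.
rewrite (@rsumE a (fun=> 0%R))// ?nsum0 ?ltry ?subr0//.
by move=> k; rewrite subr0.
Qed.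

Lemma rsumD a b : smb a -> smb b ->
  rsum (fun k => a k + b k)%R = (rsum a + rsum b)%R.
Proof.
move=> sa sb.
rewrite (@rsumE (fun k => pos a k + pos b k)%R (fun k => neg a k + neg b k)%R).
- rewrite !nsumD// !fineD ?(pos_fin sa) ?(pos_fin sb) ?(neg_fin sa) ?(neg_fin sb)//.
  by rewrite !rsum_posneg// opprD addrACA.
- by move=> k; rewrite addr_ge0.
- by move=> k; rewrite addr_ge0.
- by rewrite nsumD// lte_add_pinfty//; exact: pos_sum.
- by rewrite nsumD// lte_add_pinfty//; exact: neg_sum.
- by move=> k; rewrite opprD addrACA -!posneg.
Qed.

Lemma rsumN a : smb a -> rsum (fun k => - a k)%R = (- rsum a)%R.
Proof.
move=> sa; rewrite (@rsumE (neg a) (pos a))//.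
- by rewrite rsum_posneg// opprB.
- exact: neg_sum.
- exact: pos_sum.
- by move=> k; rewrite {1}(posneg a k) opprB.
Qed.

Lemma rsumZ c a : smb a -> rsum (fun k => c * a k)%R = (c * rsum a)%R.
Proof.
have H d : smb a -> (0 <= d)%R -> rsum (fun k => d * a k)%R = (d * rsum a)%R.
  move=> sa d0.
  rewrite (@rsumE (fun k => d * pos a k)%R (fun k => d * neg a k)%R).
  - rewrite !nsumZ// !fineM ?(pos_fin sa) ?(neg_fin sa)//.
    by rewrite rsum_posneg// mulrBr.
  - by move=> k; rewrite mulr_ge0.
  - by move=> k; rewrite mulr_ge0.
  - by rewrite nsumZ// -(fineK (pos_fin sa))// -EFinM ltry.
  - by rewrite nsumZ// -(fineK (neg_fin sa))// -EFinM ltry.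
  - by move=> k; rewrite -mulrBr -posneg.
move=> sa; have [c0|c0] := leP 0%R c; first exact: H.
rewrite -[c]opprK mulNr -H ?oppr_ge0 ?(ltW c0)// -rsumN; last exact: smbZ.
by congr rsum; apply/funext => k; rewrite mulNr.
Qed.

End sums.

Section l2.
Variables (R : realType) (T : choiceType).
Implicit Types (z : R[i]) (f g h : T -> R[i]).

Lemma sqr_normcE z : normc z ^+ 2 = complex.Re z ^+ 2 + complex.Im z ^+ 2.
Proof. by case: z => u v /=; rewrite sqr_sqrtr// addr_ge0// sqr_ge0. Qed.

Definition l2_pred : {pred T -> R[i]} :=
  [pred f : T -> R[i] |
    (\esum_(k in [set: T]) (normc (f k) ^+ 2)%R%:E < +oo)%E].

Lemma l2_predE f : (f \in l2_pred) = (nsum (fun k => normc (f k) ^+ 2)%R < +oo)%E.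
Proof. by []. Qed.

Lemma ReD z w : complex.Re (z + w) = complex.Re z + complex.Re w.
Proof. by case: z w => u v [u' v']. Qed.

Lemma ImD z w : complex.Im (z + w) = complex.Im z + complex.Im w.
Proof. by case: z w => u v [u' v']. Qed.

Lemma sqr_normcD z w : normc (z + w) ^+ 2 <= 2 * normc z ^+ 2 + 2 * normc w ^+ 2.
Proof.
rewrite !sqr_normcE ReD ImD.
have := sqr_ge0 (complex.Re z - complex.Re w).
have := sqr_ge0 (complex.Im z - complex.Im w).
nra.
Qed.

Lemma l2_submod : submod_closed l2_pred.
Proof.
split=> [|c f g].
  rewrite l2_predE (_ : (fun k => _) = (fun=> 0)).
    by rewrite /nsum esum1.
  by apply/funext => k; rewrite normc0 expr0n.
rewrite !l2_predE => lf lg.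
apply: (@le_lt_trans _ _ (nsum (fun k => (2 * normc c ^+ 2) * normc (f k) ^+ 2 +
    2 * normc (g k) ^+ 2))).
  apply: le_nsum => k; rewrite -mulrA -exprMn -normcM; exact: sqr_normcD.
have c0 : 0 <= 2 * normc c ^+ 2 by rewrite mulr_ge0// sqr_ge0.
rewrite nsumD; [|by move=> k; rewrite mulr_ge0// sqr_ge0..].
rewrite !nsumZ//; [|by move=> k; rewrite sqr_ge0..].
rewrite -(fineK (nsum_fin _ lf)); last by move=> k; rewrite sqr_ge0.
rewrite -(fineK (nsum_fin _ lg)); last by move=> k; rewrite sqr_ge0.
by rewrite -!EFinM -EFinD ltry.
Qed.

HB.instance Definition _ := GRing.isSubmodClosed.Build R[i] (T -> R[i]) l2_pred
  l2_submod.

Record l2 := L2 { l2fun :> T -> R[i]; l2funP : l2fun \in l2_pred }.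

HB.instance Definition _ := [isSub for l2fun].
HB.instance Definition _ := [Choice of l2 by <:].
HB.instance Definition _ := [SubChoice_isSubLmodule of l2 by <:].

Definition l2_dot (f g : l2) : R[i] := csum (fun k => f k * (g k)^*).

Implicit Types (F G H : l2).

Lemma l2D F G k : (F + G) k = F k + G k. Proof. by []. Qed.
Lemma l2Z c F k : (c *: F) k = c * F k. Proof. by []. Qed.
Lemma l2N F k : (- F) k = - F k. Proof. by []. Qed.
Lemma l2B F G k : (F - G) k = F k - G k. Proof. by []. Qed.

Lemma l2_eq F G : F =1 G -> F = G.
Proof. by move=> FG; apply: val_inj; apply/funext. Qed.

Lemma l2_sum F : (nsum (fun k => normc (F k) ^+ 2)%R < +oo)%E.
Proof. by have := l2funP F; rewrite l2_predE. Qed.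

Lemma conjE z : z^* = Complex (complex.Re z) (- complex.Im z) :> R[i].
Proof. by case: z. Qed.

Lemma ReM z w : complex.Re (z * w) =
  complex.Re z * complex.Re w - complex.Im z * complex.Im w.
Proof. by case: z w => u v [u' v']. Qed.

Lemma ImM z w : complex.Im (z * w) =
  complex.Re z * complex.Im w + complex.Im z * complex.Re w.
Proof. by case: z w => u v [u' v']. Qed.

Lemma smb_prod F G (r : R -> R -> R -> R -> R) :
  (forall x y z w : R, `|r x y z w| <= (x ^+ 2 + y ^+ 2) + (z ^+ 2 + w ^+ 2)) ->
  smb (fun k => r (complex.Re (F k)) (complex.Im (F k))
                  (complex.Re (G k)) (complex.Im (G k))).
Proof.
move=> rle.
apply: (@le_lt_trans _ _
  (nsum (fun k => normc (F k) ^+ 2 + normc (G k) ^+ 2))).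
  by apply: le_nsum => k; rewrite !sqr_normcE.
by rewrite nsumD ?lte_add_pinfty ?l2_sum// => k; rewrite sqr_ge0.
Qed.

Lemma smb_Re F G : smb (fun k => complex.Re (F k * (G k)^*)).
Proof.
have -> : (fun k => complex.Re (F k * (G k)^*)) = (fun k =>
    complex.Re (F k) * complex.Re (G k) + complex.Im (F k) * complex.Im (G k)).
  by apply/funext => k; rewrite conjE ReM/= mulrN opprK.
refine (@smb_prod F G (fun x y u v => x * u + y * v) _) => x y u v.
have := (sqr_ge0 (x - u), sqr_ge0 (x + u), sqr_ge0 (y - v), sqr_ge0 (y + v)).
move=> [[[h1 h2] h3] h4]; have := (sqr_ge0 x, sqr_ge0 y, sqr_ge0 u, sqr_ge0 v).
move=> [[[h5 h6] h7] h8]; rewrite ler_norml; apply/andP; split; nra.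
Qed.

Lemma smb_Im F G : smb (fun k => complex.Im (F k * (G k)^*)).
Proof.
have -> : (fun k => complex.Im (F k * (G k)^*)) = (fun k =>
    complex.Im (F k) * complex.Re (G k) - complex.Re (F k) * complex.Im (G k)).
  by apply/funext => k; rewrite conjE ImM/= mulrN addrC.
refine (@smb_prod F G (fun x y u v => y * u - x * v) _) => x y u v.
have := (sqr_ge0 (y - u), sqr_ge0 (y + u), sqr_ge0 (x - v), sqr_ge0 (x + v)).
move=> [[[h1 h2] h3] h4]; have := (sqr_ge0 x, sqr_ge0 y, sqr_ge0 u, sqr_ge0 v).
move=> [[[h5 h6] h7] h8]; rewrite ler_norml; apply/andP; split; nra.
Qed.

Lemma csumD f g :
  smb (fun k => complex.Re (f k)) -> smb (fun k => complex.Im (f k)) ->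
  smb (fun k => complex.Re (g k)) -> smb (fun k => complex.Im (g k)) ->
  csum (fun k => f k + g k) = csum f + csum g.
Proof.
move=> rf jf rg jg; rewrite /csum.
have -> : (fun k => complex.Re (f k + g k)) =
    (fun k => complex.Re (f k) + complex.Re (g k)).
  by apply/funext => k; rewrite ReD.
have -> : (fun k => complex.Im (f k + g k)) =
    (fun k => complex.Im (f k) + complex.Im (g k)).
  by apply/funext => k; rewrite ImD.
by rewrite !rsumD.
Qed.

Lemma csumZ c f :
  smb (fun k => complex.Re (f k)) -> smb (fun k => complex.Im (f k)) ->
  csum (fun k => c * f k) = c * csum f.
Proof.
move=> rf jf; rewrite /csum.
have NZ d a : smb a -> smb (fun k : T => - (d * a k) : R).
  by move=> ?; apply/smbN/smbZ.
have -> : (fun k => complex.Re (c * f k)) = (fun k =>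
    complex.Re c * complex.Re (f k) + - (complex.Im c * complex.Im (f k))).
  by apply/funext => k; rewrite ReM.
have -> : (fun k => complex.Im (c * f k)) = (fun k =>
    complex.Re c * complex.Im (f k) + complex.Im c * complex.Re (f k)).
  by apply/funext => k; rewrite ImM.
rewrite (rsumD (smbZ (complex.Re c) rf) (NZ (complex.Im c) _ jf)).
rewrite (rsumD (smbZ (complex.Re c) jf) (smbZ (complex.Im c) rf)).
rewrite (rsumN (smbZ (complex.Im c) jf)) (rsumZ _ rf) (rsumZ _ jf).
rewrite (rsumZ _ jf) (rsumZ _ rf).
by case: c.
Qed.

Lemma l2_dot_lin H c F G : l2_dot (c *: F + G) H = c * l2_dot F H + l2_dot G H.
Proof.
rewrite /l2_dot.
have -> : (fun k => (c *: F + G) k * (H k)^*) =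
    (fun k => c * (F k * (H k)^*) + G k * (H k)^*).
  by apply/funext => k; rewrite l2D l2Z mulrDl mulrA.
rewrite csumD ?csumZ//; [exact: smb_Re|exact: smb_Im| | |exact: smb_Re|exact: smb_Im].
  have /(smbZ (complex.Re c)) A := smb_Re F H.
  have /(smbZ (complex.Im c))/smbN B := smb_Im F H.
  have := smbD A B; rewrite (_ : (fun k => _) = (fun k => complex.Re (c * (F k * (H k)^*))))//.
  by apply/funext => k; rewrite [RHS]ReM.
have /(smbZ (complex.Re c)) A := smb_Im F H.
have /(smbZ (complex.Im c)) B := smb_Re F H.
have := smbD A B; rewrite (_ : (fun k => _) = (fun k => complex.Im (c * (F k * (H k)^*))))//.
by apply/funext => k; rewrite [RHS]ImM.
Qed.

Lemma l2_dot_herm F G : l2_dot F G = (-1) ^+ false * (l2_dot G F)^*.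
Proof.
rewrite expr0 mul1r conjE {1}/l2_dot /csum.
have -> : (fun k => complex.Re (F k * (G k)^*)) =
    (fun k => complex.Re (G k * (F k)^*)).
  by apply/funext => k; rewrite !conjE !ReM/=; ring.
have -> : (fun k => complex.Im (F k * (G k)^*)) =
    (fun k => - complex.Im (G k * (F k)^*)).
  by apply/funext => k; rewrite !conjE !ImM/=; ring.
by rewrite rsumN//; exact: smb_Im.
Qed.

Lemma l2_dotE F : l2_dot F F =
  Complex (fine (nsum (fun k => normc (F k) ^+ 2))) 0.
Proof.
rewrite /l2_dot /csum; congr Complex.
  rewrite (_ : (fun k => _) = (fun k => normc (F k) ^+ 2)); last first.
    by apply/funext => k; rewrite sqr_normcE conjE ReM/= mulrN opprK.
  by rewrite rsum_ge0E ?l2_sum// => k; rewrite sqr_ge0.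
rewrite (_ : (fun k => _) = (fun=> 0)); last first.
  by apply/funext => k; rewrite conjE ImM/= mulrN mulrC addNr.
by rewrite rsum_ge0E// /nsum esum1.
Qed.

Lemma normc_le_nsum F k :
  normc (F k) ^+ 2 <= fine (nsum (fun k => normc (F k) ^+ 2)).
Proof.
have F0 i : 0 <= normc (F i) ^+ 2 by rewrite sqr_ge0.
rewrite -lee_fin fineK; last by rewrite nsum_fin// l2_sum.
apply: esum_ge; exists [set k]; first by split.
by rewrite fsbig_set1.
Qed.

Lemma l2_dot_gt0 F : F != 0 -> 0 < l2_dot F F.
Proof.
move=> F0; rewrite l2_dotE ltcE/= eqxx/= lt_neqAle eq_sym.
rewrite fine_ge0 ?andbT; last by apply: nsum_ge0 => k; rewrite sqr_ge0.
apply: contra F0 => /eqP s0; apply/eqP/l2_eq => k.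
apply/eq0_normc/eqP; rewrite -sqrf_eq0 eq_le sqr_ge0 andbT -s0.
exact: normc_le_nsum.
Qed.

Fact l2_dot_is_bilinear : bilinear_for
  (GRing.Scale.Law.clone _ _ *%R _) (GRing.Scale.Law.clone _ _ (Num.conj \; *%R) _)
  l2_dot.
Proof.
split=> [G|F] c A B /=; first exact: l2_dot_lin.
rewrite l2_dot_herm [in RHS]l2_dot_herm [l2_dot F B]l2_dot_herm.
by rewrite !expr0 !mul1r l2_dot_lin rmorphD rmorphM.
Qed.
HB.instance Definition _ := bilinear_isBilinear.Build R[i] l2 l2 R[i] _ _ l2_dot
  l2_dot_is_bilinear.
HB.instance Definition _ := isHermitianSesquilinear.Build R[i] l2 false Num.conj
  l2_dot l2_dot_herm.
HB.instance Definition _ := isDotProduct.Build R[i] l2 l2_dot l2_dot_gt0.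

End l2.

Section l2_hilbert.
Variables (R : realType) (T : choiceType).
Implicit Types (F G : l2 R T).

Lemma dnorm_l2E F :
  dnorm (@l2_dot R T) F = Num.sqrt (fine (nsum (fun k => normc (F k) ^+ 2))).
Proof.
exact: (congr1 (fun z => Num.sqrt (complex.Re z)) (l2_dotE F)).
Qed.

Lemma dnorm_l2_le (eps : R) F : 0 <= eps ->
  (dnorm (@l2_dot R T) F <= eps) =
  (nsum (fun k => (normc (F k) ^+ 2)%R) <= (eps ^+ 2)%:E)%E.
Proof.
move=> e0; rewrite dnorm_l2E.
have F0 k : 0 <= normc (F k) ^+ 2 by rewrite sqr_ge0.
rewrite -[X in (_ <= X)%R = _]ger0_norm// -sqrtr_sqr ler_sqrt ?sqr_ge0//.
by rewrite -lee_fin fineK// nsum_fin// l2_sum.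
Qed.

Lemma nsum_le_finite (a : T -> R) (c : R) :
  (forall s : seq T, uniq s -> \sum_(k <- s) a k <= c) -> (nsum a <= c%:E)%E.
Proof.
move=> ac; apply: ge_ereal_sup => _ [X [finX _] <-].
by rewrite fsbig_finite//= sumEFin lee_fin ac// fset_uniq.
Qed.

Lemma le_finite_nsum (a : T -> R) (s : seq T) : uniq s ->
  ((\sum_(k <- s) a k)%:E <= nsum a)%E.
Proof.
move=> us; apply: esum_ge; exists [set` s]; first by split => //; exact: finite_seq.
by rewrite -fsbig_seq// sumEFin.
Qed.

Lemma normc_ge_ReIm (z : R[i]) :
  (`|complex.Re z| <= normc z) /\ (`|complex.Im z| <= normc z).
Proof.
case: z => u v /=; rewrite -!sqrtr_sqr !ler_sqrt ?addr_ge0 ?sqr_ge0//.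
by rewrite lerDl lerDr !sqr_ge0.
Qed.

Lemma real_cauchy_cvg (v : nat -> R) :
  (forall eps : R, 0 < eps -> exists N, forall m n, (N <= m)%N -> (N <= n)%N ->
     `|v m - v n| < eps) -> cvg (v n @[n --> \oo]).
Proof.
move=> cv; apply/cauchy_cvgP/cauchy_exP => eps /cv[N vN].
by exists (v N); exists N => // n /= Nn; exact: vN.
Qed.

Lemma l2_complete (u : nat -> l2 R T) :
  (forall eps : R, 0 < eps -> exists N, forall m n, (N <= m)%N -> (N <= n)%N ->
     dnorm (@l2_dot R T) (u m - u n) < eps) ->
  exists l, forall eps : R, 0 < eps -> exists N, forall n, (N <= n)%N ->
     dnorm (@l2_dot R T) (u n - l) < eps.
Proof.
move=> cu.
have cuk k (eps : R) : 0 < eps -> exists N, forall m n, (N <= m)%N -> (N <= n)%N ->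
    normc (u m k - u n k) < eps.
  move=> /[dup] eps0 /cu[N uN]; exists N => p n Nm Nn.
  apply: le_lt_trans (uN _ _ Nm Nn).
  rewrite dnorm_l2E -[leLHS]ger0_norm; last by case: (_ - _) => ? ? /=.
  rewrite -sqrtr_sqr ler_sqrt ?(le_trans _ (normc_le_nsum _ k))// ?sqr_ge0//.
pose re k n := complex.Re (u n k); pose im k n := complex.Im (u n k).
have cre k : cvg (re k n @[n --> \oo]).
  apply: real_cauchy_cvg => eps /(cuk k)[N uN]; exists N => p n Nm Nn.
  apply: le_lt_trans (uN _ _ Nm Nn).
  have [+ _] := normc_ge_ReIm (u p k - u n k).
  by rewrite ReD /re; case: (u n k).
have cim k : cvg (im k n @[n --> \oo]).
  apply: real_cauchy_cvg => eps /(cuk k)[N uN]; exists N => p n Nm Nn.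
  apply: le_lt_trans (uN _ _ Nm Nn).
  have [_ +] := normc_ge_ReIm (u p k - u n k).
  by rewrite ImD /im; case: (u n k).
pose l k : R[i] := Complex (lim (re k n @[n --> \oo])) (lim (im k n @[n --> \oo])).
have cl m k : normc (u m k - u n k) ^+ 2 @[n --> \oo] --> normc (u m k - l k) ^+ 2.
  rewrite sqr_normcE.
  have -> : (fun n => normc (u m k - u n k) ^+ 2) =
      (fun n => (re k m - re k n) ^+ 2 + (im k m - im k n) ^+ 2).
    apply/funext => n; rewrite sqr_normcE ReD ImD /re /im.
    by case: (u n k).
  have -> : complex.Re (u m k - l k) = re k m - lim (re k n @[n --> \oo]).
    by rewrite ReD.
  have -> : complex.Im (u m k - l k) = im k m - lim (im k n @[n --> \oo]).
    by rewrite ImD.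
  by apply: cvgD; rewrite expr2; under eq_fun do rewrite expr2;
    apply: cvgM; apply: cvgB => //; exact: cvg_cst.
have bound (eps : R) : 0 < eps -> exists N, forall m, (N <= m)%N ->
    (nsum (fun k => (normc (u m k - l k) ^+ 2)%R) <= (eps ^+ 2)%:E)%E.
  move=> /[dup] eps0 /cu[N uN]; exists N => m Nm; apply: nsum_le_finite => s us.
  have cs : \sum_(k <- s) normc (u m k - u n k) ^+ 2 @[n --> \oo] -->
      \sum_(k <- s) normc (u m k - l k) ^+ 2.
    by apply: cvg_big => [|k _]; [exact: add_continuous|exact: cl].
  apply: (cvgr_to_le cs); exists N => // n /= Nn.
  rewrite -lee_fin (le_trans (le_finite_nsum _ us))//.
  have /ltW := uN _ _ Nm Nn; rewrite dnorm_l2_le//; exact: ltW.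
have ll2 : l \in @l2_pred R T.
  have [N /(_ _ (leqnn N)) uN] := bound 1 ltr01.
  have dl : (fun k => u N k - l k) \in @l2_pred R T.
    by rewrite l2_predE (le_lt_trans uN)// ltry.
  rewrite (_ : l = (u N : T -> R[i]) - (fun k => u N k - l k)); last first.
    by apply/funext => k; rewrite -[RHS]/(u N k - (u N k - l k)) opprB addrC subrK.
  by rewrite rpredB// l2funP.
exists (L2 ll2) => eps eps0.
have /bound[N uN] : 0 < eps / 2 by rewrite divr_gt0.
exists N => n Nn; apply: (@le_lt_trans _ _ (eps / 2)); last first.
  by rewrite ltr_pdivrMr// ltr_pMr// ltr1n.
by rewrite dnorm_l2_le ?uN// ltW// divr_gt0.
Qed.

Definition ell2 : hilbert R := Hilbert l2_complete.

End l2_hilbert.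

Section operators.
Variable R : realType.

Definition bounded_op (H : hilbert R) (T : {linear H -> H}) : Prop :=
  exists M : R, forall x, hnorm (T x) <= M * hnorm x.

Definition opnorm (H : hilbert R) (T : {linear H -> H}) : R :=
  sup [set hnorm (T x) | x in [set x : H | hnorm x <= 1]].

Definition adjoint_op (H : hilbert R) (T S : {linear H -> H}) : Prop :=
  forall x y, hdot H (T x) y = hdot H x (S y).

Definition commute_op (H : hilbert R) (S T : {linear H -> H}) : Prop :=
  forall x, S (T x) = T (S x).

(* The adjoint of a bounded operator is unique, so [S] below is N^*. *)
Definition normal_op (H : hilbert R) (N : {linear H -> H}) : Prop :=
  bounded_op N /\ exists2 S : {linear H -> H}, adjoint_op N S & commute_op N S.

Definition isometric (H K : hilbert R) (V : {linear H -> K}) : Prop :=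
  forall x y, hdot K (V x) (V y) = hdot H x y.

(* The space is identified with its image under the isometry [V]; this image
   is then a closed subspace of [K], invariant under the normal operators. *)
Definition subnormal (H : hilbert R) (T : {linear H -> H}) : Prop :=
  exists (K : hilbert R) (N : {linear K -> K}) (V : {linear H -> K}),
    [/\ normal_op N, isometric V & forall x, N (V x) = V (T x)].

Definition subnormal_pair (H : hilbert R) (T1 T2 : {linear H -> H}) : Prop :=
  exists (K : hilbert R) (N1 N2 : {linear K -> K}) (V : {linear H -> K}),
    [/\ normal_op N1, normal_op N2, commute_op N1 N2, isometric V &
        forall x, N1 (V x) = V (T1 x) /\ N2 (V x) = V (T2 x)].

Definition class_H0 (H : hilbert R) (T1 T2 : {linear H -> H}) : Prop :=
  [/\ commute_op T1 T2, subnormal T1 & subnormal T2].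

End operators.

Section shifts.
Variable R : realType.

Record weights (I : Type) := Weights {
  weight :> I -> R;
  weight_gt0 : forall i, 0 < weight i;
  weight_bounded : exists M, forall i, weight i <= M
}.

Local Notation Z2 := (nat * nat)%type.

Definition wshift1_fun (w : weights Z2) (f : Z2 -> R[i]) (k : Z2) : R[i] :=
  if k is (k1.+1, k2) then (w (k1, k2))%:C%C * f (k1, k2) else 0.

Definition wshift2_fun (w : weights Z2) (f : Z2 -> R[i]) (k : Z2) : R[i] :=
  if k is (k1, k2.+1) then (w (k1, k2))%:C%C * f (k1, k2) else 0.

Lemma l2_shift (T : choiceType) (e : T -> T) (w : weights T) (f g : T -> R[i]) :
  injective e -> (forall k, g (e k) = (w k)%:C%C * f k) ->
  (forall k, (forall j, e j <> k) -> g k = 0) ->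
  f \in @l2_pred R T -> g \in @l2_pred R T.
Proof.
move=> inje ge g0; rewrite !l2_predE => lf.
have [M wM] := weight_bounded w.
have -> : nsum (fun k => normc (g k) ^+ 2) =
    nsum (fun k => normc (g (e k)) ^+ 2).
  rewrite /nsum -(@esum_image _ _ _ [set: T] e (fun k => (normc (g k) ^+ 2)%:E)).
    rewrite [RHS]esum_mkcond; apply: eq_esum => k _.
    case: ifPn => // /negP; rewrite inE => kN.
    rewrite g0 ?normc0 ?expr0n// => j ejk; apply: kN; by exists j.
  by move=> i j _ _; exact: inje.
apply: (@le_lt_trans _ _ (nsum (fun k => M ^+ 2 * normc (f k) ^+ 2))).
  apply: le_nsum => k; rewrite ge normcM exprMn ler_wpM2r ?sqr_ge0//.
  have -> : normc ((w k)%:C%C : R[i]) = w k.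
    by rewrite /= expr0n/= addr0 sqrtr_sqr gtr0_norm// weight_gt0.
  by rewrite lerXn2r// nnegrE ltW ?weight_gt0// (lt_le_trans (weight_gt0 w k)).
rewrite nsumZ ?sqr_ge0//; last by move=> k; rewrite sqr_ge0.
rewrite -(fineK (nsum_fin _ lf)) -?EFinM ?ltry// => k.
by rewrite sqr_ge0.
Qed.

Lemma wshift1_l2 (w : weights Z2) (F : l2 R Z2) :
  wshift1_fun w F \in @l2_pred R Z2.
Proof.
apply: (@l2_shift _ (fun k => (k.1.+1, k.2)) w F) (l2funP F) => //.
- by move=> [a b] [c d] [-> ->].
- by move=> [a b].
- by move=> [[|a] b] //= /(_ (a, b)).
Qed.

Lemma wshift2_l2 (w : weights Z2) (F : l2 R Z2) :
  wshift2_fun w F \in @l2_pred R Z2.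
Proof.
apply: (@l2_shift _ (fun k => (k.1, k.2.+1)) w F) (l2funP F) => //.
- by move=> [a b] [c d] [-> ->].
- by move=> [a b].
- by move=> [a [|b]] //= /(_ (a, b)).
Qed.

Definition wshift1_op w (F : l2 R Z2) : l2 R Z2 := L2 (wshift1_l2 w F).
Definition wshift2_op w (F : l2 R Z2) : l2 R Z2 := L2 (wshift2_l2 w F).

Lemma wshift1_linear w : linear (wshift1_op w).
Proof.
move=> c F G; apply: l2_eq => -[[|k1] k2].
  by change (0 = c * 0 + 0 :> R[i]); rewrite mulr0 addr0.
set W := (w (k1, k2))%:C%C.
change (W * (c * F (k1, k2) + G (k1, k2)) =
        c * (W * F (k1, k2)) + W * G (k1, k2)).
by rewrite mulrDr mulrCA.
Qed.

Lemma wshift2_linear w : linear (wshift2_op w).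
Proof.
move=> c F G; apply: l2_eq => -[k1 [|k2]].
  by change (0 = c * 0 + 0 :> R[i]); rewrite mulr0 addr0.
set W := (w (k1, k2))%:C%C.
change (W * (c * F (k1, k2) + G (k1, k2)) =
        c * (W * F (k1, k2)) + W * G (k1, k2)).
by rewrite mulrDr mulrCA.
Qed.

HB.instance Definition _ w := GRing.isLinear.Build R[i] (l2 R Z2) (l2 R Z2) _
  (wshift1_op w) (wshift1_linear w).
HB.instance Definition _ w := GRing.isLinear.Build R[i] (l2 R Z2) (l2 R Z2) _
  (wshift2_op w) (wshift2_linear w).

Definition ell2Z : hilbert R := ell2 R Z2.

Definition wshift1 w : {linear ell2Z -> ell2Z} := wshift1_op w.
Definition wshift2 w : {linear ell2Z -> ell2Z} := wshift2_op w.

Lemma basis_l2 (k : Z2) : (fun j : Z2 => ((j == k)%:R : R[i])) \in @l2_pred R Z2.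
Proof.
rewrite l2_predE (_ : nsum _ = 1%E) ?ltry//.
rewrite /nsum (esumID [set k]); last by move=> j _; rewrite lee_fin sqr_ge0.
rewrite setTI esum_set1 ?lee_fin ?sqr_ge0// eqxx normc1 expr1n esum1 ?adde0//.
by move=> j [_ /= /eqP/negPf ->]; rewrite normc0 expr0n.
Qed.

Definition ebasis (k : Z2) : ell2Z := L2 (basis_l2 k).

Lemma wshift1E w k1 k2 :
  wshift1 w (ebasis (k1, k2)) = (w (k1, k2))%:C%C *: ebasis (k1.+1, k2).
Proof.
apply: l2_eq => -[[|j1] j2]; rewrite [RHS]l2Z /=; first by rewrite mulr0.
by rewrite !xpair_eqE eqSS; case: eqP => [->|]; case: eqP => [->|]; rewrite ?mulr0.
Qed.

Lemma wshift2E w k1 k2 :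
  wshift2 w (ebasis (k1, k2)) = (w (k1, k2))%:C%C *: ebasis (k1, k2.+1).
Proof.
apply: l2_eq => -[j1 [|j2]]; rewrite [RHS]l2Z /=.
  by rewrite xpair_eqE andbF mulr0.
by rewrite !xpair_eqE eqSS; case: eqP => [->|]; case: eqP => [->|]; rewrite ?mulr0.
Qed.

Definition flat (alpha beta : Z2 -> R) : Prop := forall k1 k2 : nat,
  (1 <= k1)%N -> (1 <= k2)%N ->
  alpha (k1, k2) = alpha (1%N, 1%N) /\ beta (k1, k2) = beta (1%N, 1%N).

Definition moment (T1 T2 : {linear ell2Z -> ell2Z}) (k1 k2 : nat) : R :=
  hnorm (iter k1 T1 (iter k2 T2 (ebasis (0%N, 0%N)))) ^+ 2.

(* Measures on [0, +oo[ are encoded as measures on R vanishing outside. *)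
Definition is_berger (w : nat -> R) (zeta : probability R R) : Prop :=
  (exists M : R, zeta (~` `[0, M]%classic) = 0%E) /\
  forall k, (\int[zeta]_s (s ^+ k)%:E = (\prod_(i < k) w i ^+ 2)%R%:E)%E.

Definition is_berger2 (T1 T2 : {linear ell2Z -> ell2Z})
    (mu : probability (R * R)%type R) : Prop :=
  mu (~` (`[0, opnorm T1 ^+ 2]%classic `*` `[0, opnorm T2 ^+ 2]%classic)) = 0%E /\
  forall k1 k2,
    (\int[mu]_p (p.1 ^+ k1 * p.2 ^+ k2)%R%:E = (moment T1 T2 k1 k2)%:E)%E.

End shifts.

Section signed_measures.
Variables (d : measure_display) (T : measurableType d) (R : realType).
Local Open Scope ereal_scope.
Local Open Scope charge_scope.
Implicit Types nu : {charge set T -> \bar R}.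

Definition positive_charge nu : Prop := nu.-positive_set [set: T].

Definition csub nu1 nu2 : {charge set T -> \bar R} := cadd nu1 (cscale (-1) nu2).

Definition charge_ge nu1 nu2 : Prop := positive_charge (csub nu1 nu2).

Lemma hahn_ex nu : exists PN : set T * set T, hahn_decomposition nu PN.1 PN.2.
Proof. by have [P [N PN]] := Hahn_decomposition nu; exists (P, N). Qed.

Definition hahn nu := cid (hahn_ex nu).

(* The Jordan components do not depend on the chosen Hahn decomposition. *)
Definition cintegral nu (f : T -> \bar R) : \bar R :=
  \int[jordan_pos (projT2 (hahn nu))]_x f x -
  \int[jordan_neg (projT2 (hahn nu))]_x f x.

(* The set function dnu' = f dnu. *)
Definition cdensity nu (f : T -> R) (A : set T) : \bar R :=
  cintegral nu (fun x => (f x * \1_A x)%R%:E).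

End signed_measures.

Section product.
Variables (d d' : measure_display) (T : measurableType d) (T' : measurableType d').
Variable R : realType.

(* As for the library's [product_measure1]; only set functions [nu'] that are
   signed measures are of interest. *)
Definition cprod (nu : {charge set T -> \bar R}) (nu' : set T' -> \bar R)
    (A : set (T * T')) : \bar R :=
  cintegral nu (fun x => nu' (xsection A x)).

End product.

(* Main.v *)
(* All three conditions say the same thing about atoms. Put [c = a^2 y0^2 / b^2],
   the value of the moments [gamma_(k,j) / b^(2j)] for [k, j >= 1]; they all
   amount to [c <= eta {b^2}], [c <= xi {1}] and [1 <= xi {0} + eta {0} + c].

   The Berger measure of [(y1, y2, ...)] is [y0^-2 t deta], so the integrals of
   [1/t] in (ii) and (iii) are values of [eta], and subtracting point masses from
   a measure leaves it positive exactly when the atoms are large enough.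

   Given commuting normal [N1, N2] extending [T1, T2] and [h] the image of
   [e_(0,0)], the moments of [N2 h] under [A1 = N1^* N1] are constant from the first
   on, so [g = A1 (N2 h)] is an eigenvector of [A1] for the eigenvalue 1. By an
   argument of Fuglede's kind [N2^*] preserves that eigenspace, and [w = N2^* g] is
   a joint eigenvector of [A1] and [A2 = N2^* N2] for 1 and [b^2]. Testing [h] against
   [w] gives the two bounds on atoms, and testing it against vectors of
   the kernel of [N1] gives the third; no spectral theorem is needed.

   Conversely, the atom conditions make the plane measure
   [xi x delta_0 + delta_0 x eta + c delta_(1,b^2)
    - (1 - c) delta_(0,0) - c delta_(1,0) - c delta_(0,b^2)] positive; its moments
   are those of the shift, compactly supported measures are determined by their
   moments, and it equals the measure of the claim. The normal extension is
   assembled from those of [T1], [T2] and a pair of bilateral shifts. *)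

Require Import Defs.
From HB Require Import structures.
From mathcomp Require Import all_boot all_order all_algebra.
From mathcomp Require Import complex ring lra.
From mathcomp Require Import all_classical all_reals all_analysis.
From mathcomp Require Import measurable_realfun.

Set Implicit Arguments.
Unset Strict Implicit.
Unset Printing Implicit Defensive.

Import Order.TTheory GRing.Theory Num.Theory.
Import numFieldNormedType.Exports.
Import Normc.

Local Open Scope classical_set_scope.
Local Open Scope ring_scope.

(** No joint spectral measure of the normal pair is constructed. What is known about each extension
    is a list of inner products of polynomials in [A = S \o N] applied to one vector, and these are
    integrals against the Berger measures. Point masses are read off as limits along polynomials
    tending to the indicator of a point, and Cauchy-Schwarz does the work of spectral projections.

    For the converse, matching moments only matches norms. An isometry must also send the mutually
    orthogonal vectors [T1^k T2^j e_(0,0)] to orthogonal ones, so multiplication by positive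
    functions would not do. This is why the given extensions of [T1] and [T2] are reused, where the
    powers of one operator on the image of [e_(0,0)] are already orthogonal, and why the mass [c]
    sits on bilateral shifts and not on a one-dimensional space. Atoms are lowered by applying a
    function of the modulus to the vector, which keeps that orthogonality. *)

(** * Inner products and polynomial actions *)

Section real_inner_product.
Variables (R : realType) (H : hilbert R).
Implicit Types (x y z : H) (c : R).

(** Estimates use the real part alone: the operators [S \o N] are symmetric for it and the
    polynomials have real coefficients. [hdotE] recovers the complex value. *)
Definition ip x y : R := complex.Re (hdot H x y).

Lemma hdotC x y : hdot H x y = (hdot H y x)^*.
Proof. by have := @hermC _ _ _ _ (hdot H) x y; rewrite expr0 mul1r. Qed.

Lemma hdotZl (t : R[i]) x y : hdot H (t *: x) y = t * hdot H x y.
Proof. by rewrite linearZl_LR. Qed.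

Lemma hdotZr (t : R[i]) x y : hdot H x (t *: y) = t^* * hdot H x y.
Proof. by rewrite linearZr_LR. Qed.

Lemma ipC x y : ip x y = ip y x.
Proof. by rewrite /ip hdotC; case: (hdot H y x). Qed.

Lemma ipDl x y z : ip (x + y) z = ip x z + ip y z.
Proof. by rewrite /ip linearDl/= Defs.ReD. Qed.

Lemma ipZl c x y : ip (c%:C%C *: x) y = c * ip x y.
Proof. by rewrite /ip linearZl_LR/= Defs.ReM/= mul0r subr0. Qed.

Lemma ipNl x y : ip (- x) y = - ip x y.
Proof. by rewrite /ip linearNl/=; case: (hdot H x y). Qed.

Lemma ip0l x : ip 0 x = 0. Proof. by rewrite /ip linear0l. Qed.

Lemma ipBl x y z : ip (x - y) z = ip x z - ip y z.
Proof. by rewrite ipDl ipNl. Qed.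

Lemma ipDr x y z : ip z (x + y) = ip z x + ip z y.
Proof. by rewrite ipC ipDl !(ipC z). Qed.

Lemma ipBr x y z : ip z (x - y) = ip z x - ip z y.
Proof. by rewrite ipC ipBl !(ipC z). Qed.

Lemma ipZr c x y : ip x (c%:C%C *: y) = c * ip x y.
Proof. by rewrite ipC ipZl ipC. Qed.

Lemma ip0r x : ip x 0 = 0. Proof. by rewrite ipC ip0l. Qed.

Lemma ip_suml I (r : seq I) (F : I -> H) y :
  ip (\sum_(i <- r) F i) y = \sum_(i <- r) ip (F i) y.
Proof. by elim/big_rec2: _ => [|i u v _ <-]; rewrite ?ip0l ?ipDl. Qed.

Lemma hdot_ge0 x : 0 <= hdot H x x.
Proof.
have [->|x0] := eqVneq x 0; first by rewrite linear0l.
by rewrite ltW// dnorm_gt0.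
Qed.

Lemma hdot_self x : hdot H x x = (ip x x)%:C%C.
Proof.
by have := hdot_ge0 x; rewrite /ip lecE; case: (hdot H x x) => u v /= /andP[/eqP-> _].
Qed.

Lemma ip_ge0 x : 0 <= ip x x.
Proof. by have := hdot_ge0 x; rewrite hdot_self lecR. Qed.

Lemma ip_eq0 x : ip x x = 0 -> x = 0.
Proof.
move=> x0; apply/eqP; apply: contraT; rewrite -(dnorm_gt0 (hdot H)).
by rewrite hdot_self x0 ltxx.
Qed.

Lemma hnormE x : hnorm x ^+ 2 = ip x x.
Proof. by rewrite sqr_sqrtr// ip_ge0. Qed.

Lemma hnorm_ge0 x : 0 <= hnorm x. Proof. exact: sqrtr_ge0. Qed.

Lemma cauchy_schwarz x y : ip x y ^+ 2 <= ip x x * ip y y.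
Proof.
have [y0|y0] := eqVneq (ip y y) 0.
  by rewrite (ip_eq0 y0) !ip0r expr0n mulr0.
have yy : 0 < ip y y by rewrite lt_neqAle eq_sym y0 ip_ge0.
have := ip_ge0 ((ip y y)%:C%C *: x - (ip x y)%:C%C *: y).
rewrite ipBl !ipBr !ipZl !ipZr (ipC y x).
set u := ip x x; set v := ip y y in yy *; set w := ip x y.
rewrite (_ : _ - _ = v * (u * v - w ^+ 2)); last by ring.
by rewrite pmulr_rge0// subr_ge0.
Qed.

Lemma ip_le_hnorm x y : ip x y <= hnorm x * hnorm y.
Proof.
have [xy|/ltW xy] := leP (ip x y) 0; first by rewrite (le_trans xy)// mulr_ge0 ?hnorm_ge0.
rewrite -(@ler_pXn2r _ 2) ?nnegrE ?mulr_ge0 ?hnorm_ge0//.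
by rewrite exprMn !hnormE cauchy_schwarz.
Qed.

Lemma hnormD x y : hnorm (x + y) <= hnorm x + hnorm y.
Proof.
rewrite -(@ler_pXn2r _ 2) ?nnegrE ?addr_ge0 ?hnorm_ge0//.
rewrite hnormE ipDl !ipDr (ipC y x) sqrrD !hnormE.
have := ip_le_hnorm x y; lra.
Qed.

Lemma hnormN x : hnorm (- x) = hnorm x.
Proof. by rewrite /hnorm/dnorm linearNl/= linearNr/= opprK. Qed.

Lemma hnormZ (c : R[i]) x : hnorm (c *: x) = normc c * hnorm x.
Proof.
apply/eqP; rewrite -(@eqrXn2 _ 2) ?mulr_ge0 ?hnorm_ge0//; last by case: c => ? ?/=; exact: sqrtr_ge0.
rewrite exprMn !hnormE {1}/ip linearZl_LR/= linearZr_LR/= hdot_self.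
rewrite sqr_normcE Defs.conjE; case: c => u v; apply/eqP => /=; ring.
Qed.

Lemma hnorm_eq0 x : hnorm x = 0 -> x = 0.
Proof. by move=> x0; apply: ip_eq0; rewrite -hnormE x0 expr0n. Qed.

Lemma hnorm0 : hnorm (0 : H) = 0.
Proof. by apply/eqP; rewrite -sqrf_eq0 hnormE ip0l. Qed.

End real_inner_product.

Section adjoint.
Variables (R : realType) (H : hilbert R) (N S : {linear H -> H}).
Hypothesis NS : adjoint_op N S.

Lemma adjoint_ip x y : ip (N x) y = ip x (S y).
Proof. by rewrite /ip NS. Qed.

Lemma adjoint_sym : adjoint_op S N.
Proof. by move=> x y; rewrite hdotC -NS -hdotC. Qed.

Lemma adjoint_ip' x y : ip (S x) y = ip x (N y).
Proof. by rewrite /ip adjoint_sym. Qed.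

Hypothesis NSc : commute_op N S.

Lemma adjoint_norm x : ip (S x) (S x) = ip (N x) (N x).
Proof. by rewrite adjoint_ip' NSc adjoint_ip. Qed.

End adjoint.

Lemma iter_comm (T : Type) (f g : T -> T) n x :
  (forall z, f (g z) = g (f z)) -> f (iter n g x) = iter n g (f x).
Proof. by move=> fg; elim: n => //= n <-. Qed.

Section polynomial_action.
Variables (R : realType) (H : hilbert R) (A : {linear H -> H}).
Implicit Types (p q : {poly R}) (v w : H).

(** Polynomial functional calculus evaluated on a vector; it takes the place of a Borel calculus
    throughout. *)
Definition pact p v : H := \sum_(i < size p) (p`_i)%:C%C *: iter i A v.

Lemma pact_widen p n v : (size p <= n)%N ->
  pact p v = \sum_(i < n) (p`_i)%:C%C *: iter i A v.
Proof.
move=> pn; rewrite /pact (big_ord_widen _ (fun i => (p`_i)%:C%C *: iter i A v) pn).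
rewrite big_mkcond; apply: eq_bigr => i _; case: ifPn => //.
by rewrite -leqNgt => /leq_sizeP ->//; rewrite scale0r.
Qed.

Lemma pactD p q v : pact (p + q) v = pact p v + pact q v.
Proof.
rewrite (@pact_widen (p + q) (maxn (size p) (size q))) ?size_polyD//.
rewrite (@pact_widen p (maxn (size p) (size q))) ?leq_maxl//.
rewrite (@pact_widen q (maxn (size p) (size q))) ?leq_maxr//.
by rewrite -big_split; apply: eq_bigr => i _; rewrite coefD rmorphD scalerDl.
Qed.

Lemma pactZ c p v : pact (c *: p) v = c%:C%C *: pact p v.
Proof.
rewrite (@pact_widen (c *: p) (size p)) ?size_scale_leq// scaler_sumr.
by apply: eq_bigr => i _; rewrite coefZ rmorphM scalerA.
Qed.

Lemma pactC c v : pact c%:P v = c%:C%C *: v.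
Proof.
by rewrite (@pact_widen _ 1) ?size_polyC_leq1// big_ord1 coefC eqxx.
Qed.

Lemma pact1 v : pact 1 v = v.
Proof. by rewrite pactC scale1r. Qed.

Lemma iter_linD i v w : iter i A (v + w) = iter i A v + iter i A w.
Proof. by elim: i => //= i ->; rewrite linearD. Qed.

Lemma iter_linZ i c v : iter i A (c *: v) = c *: iter i A v.
Proof. by elim: i => //= i ->; rewrite linearZ. Qed.

Lemma pact_add p v w : pact p (v + w) = pact p v + pact p w.
Proof. by rewrite -big_split; apply: eq_bigr => i _; rewrite iter_linD scalerDr. Qed.

Lemma pact_scale p (c : R[i]) v : pact p (c *: v) = c *: pact p v.
Proof.
by rewrite scaler_sumr; apply: eq_bigr => i _; rewrite iter_linZ !scalerA mulrC.
Qed.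

Lemma pact_sub p v w : pact p (v - w) = pact p v - pact p w.
Proof. by rewrite pact_add -scaleN1r pact_scale scaleN1r. Qed.

Lemma pact0l v : pact 0 v = 0.
Proof. by rewrite /pact size_poly0 big_ord0. Qed.

Lemma pact0r p : pact p 0 = 0.
Proof. by rewrite -[in LHS](scale0r (0 : H)) pact_scale scale0r. Qed.

Lemma pactB p q v : pact (p - q) v = pact p v - pact q v.
Proof. by rewrite pactD -(scaleN1r q) pactZ rmorphN rmorph1 scaleN1r. Qed.

Lemma pactMX p v : pact (p * 'X) v = pact p (A v).
Proof.
rewrite (@pact_widen _ (size p).+1); last by rewrite (leq_trans (size_polyMleq _ _))// size_polyX addn2.
rewrite big_ord_recl coefMX eqxx scale0r add0r.
by apply: eq_bigr => i _; rewrite coefMX/= -iterSr.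
Qed.

Lemma pact_comm p v : A (pact p v) = pact p (A v).
Proof.
rewrite linear_sum; apply: eq_bigr => i _.
by rewrite linearZ -iterS iterSr.
Qed.

Lemma pactM p q v : pact (p * q) v = pact p (pact q v).
Proof.
elim/poly_ind: q => [|q c IH] in v *.
  by rewrite mulr0 !pact0l pact0r.
rewrite mulrDr mulrA !pactD pactMX IH pactMX pact_add; congr (_ + _).
by rewrite mulrC mul_polyC pactZ pactC pact_scale.
Qed.

Lemma pact_eigen p (l : R) v : A v = l%:C%C *: v ->
  pact p v = (p.[l])%:C%C *: v.
Proof.
move=> Av; elim/poly_ind: p => [|p c IH].
  by rewrite pact0l horner0 scale0r.
rewrite pactD pactMX Av pact_scale IH pactC hornerMXaddC rmorphD rmorphM.
by rewrite scalerDl scalerA mulrC.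
Qed.

Hypothesis Asym : forall x y, ip (A x) y = ip x (A y).

Lemma ip_iter i x y : ip (iter i A x) y = ip x (iter i A y).
Proof. by elim: i => [|i IH] in x y * => //=; rewrite Asym IH -iterS iterSr. Qed.

Lemma pact_sym p x y : ip (pact p x) y = ip x (pact p y).
Proof.
rewrite ip_suml ipC ip_suml; apply: eq_bigr => i _.
by rewrite !ipZl ip_iter ipC.
Qed.

Lemma ip_pact p q x y : ip (pact p x) (pact q y) = ip (pact (q * p) x) y.
Proof. by rewrite pactM [RHS]pact_sym. Qed.

End polynomial_action.

(** * Polynomial approximation of step functions and point evaluations *)

Section bounded_measurable.
Variables (d : measure_display) (T : measurableType d) (R : realType).
Variables (D : set T).
Hypothesis mD : measurable D.
Implicit Types (f g : T -> R) (p q : {poly R}).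

(** A class of integrands closed under the ring operations and integrable for every finite measure;
    integrability conditions are reduced to it. *)
Definition bdm f : Prop :=
  measurable_fun D f /\ exists B, forall x, D x -> `|f x| <= B.

Lemma bdm_integrable (mu : {finite_measure set T -> \bar R}) f :
  bdm f -> mu.-integrable D (EFin \o f).
Proof.
move=> [mf [B fB]].
apply: (@le_integrable _ _ _ _ _ mD _ (EFin \o cst B)).
- exact/measurable_EFinP.
- move=> x Dx /=; rewrite lee_fin (le_trans (fB _ Dx))// ler_norm//.
- exact: finite_measure_integrable_cst.
Qed.

Lemma bdm_cst c : bdm (cst c).
Proof. by split=> //; exists `|c|. Qed.

Lemma bdmD f g : bdm f -> bdm g -> bdm (fun x => f x + g x).
Proof.
move=> [mf [B fB]] [mg [C gC]]; split; first exact: measurable_funD.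
exists (B + C) => x Dx; rewrite (le_trans (ler_normD _ _))// lerD ?fB ?gC//.
Qed.

Lemma bdmM f g : bdm f -> bdm g -> bdm (fun x => f x * g x).
Proof.
move=> [mf [B fB]] [mg [C gC]]; split; first exact: measurable_funM.
by exists (B * C) => x Dx; rewrite normrM ler_pM ?fB ?gC.
Qed.

Lemma bdmB f g : bdm f -> bdm g -> bdm (fun x => f x - g x).
Proof.
move=> bf bg.
rewrite (_ : (fun _ => _) = (fun x => f x + cst (-1) x * g x)).
  by apply: bdmD => //; apply: bdmM => //; exact: bdm_cst.
by apply/funext => x; rewrite mulN1r.
Qed.

Lemma bdmX f k : bdm f -> bdm (fun x => f x ^+ k).
Proof.
move=> bf; elim: k => [|k IH]; first exact: bdm_cst.
rewrite (_ : (fun _ => _) = (fun x => f x * f x ^+ k)); first exact: bdmM.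
by apply/funext => x; rewrite exprS.
Qed.

Lemma bdm_poly p f : bdm f -> bdm (fun x => p.[f x]).
Proof.
move=> bf; elim/poly_ind: p => [|p c IH].
  rewrite (_ : (fun _ => _) = cst 0); first exact: bdm_cst.
  by apply/funext => x; rewrite horner0.
rewrite (_ : (fun _ => _) = (fun x => p.[f x] * f x + cst c x)).
  by apply: bdmD; [exact: bdmM|exact: bdm_cst].
by apply/funext => x; rewrite hornerMXaddC.
Qed.

Lemma bdm_indic A : measurable A -> bdm \1_A.
Proof.
move=> mA; split; first exact: measurable_indic.
exists 1 => x _; rewrite indicE; case: (_ \in _) => /=; rewrite ?normr1 ?normr0//.
Qed.

Lemma bounded_cvg_Rintegral (mu : {finite_measure set T -> \bar R})
    (f_ : nat -> T -> R) f (B : R) :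
  (forall n, measurable_fun D (f_ n)) -> measurable_fun D f ->
  (forall n x, D x -> `|f_ n x| <= B) ->
  (forall x, D x -> f_ n x @[n --> \oo] --> f x) ->
  (\int[mu]_(x in D) f_ n x)%R @[n --> \oo] --> (\int[mu]_(x in D) f x)%R.
Proof.
move=> mf_ mf fB ff.
have [|||||? _ H] := @dominated_convergence _ _ _ mu D mD
  (fun n => EFin \o f_ n) (EFin \o f) (EFin \o cst B).
- by move=> n; exact/measurable_EFinP.
- exact/measurable_EFinP.
- by apply: aeW => x Dx; apply: cvg_EFin; [exact: nearW|exact: ff].
- exact: finite_measure_integrable_cst.
- by apply: aeW => x n Dx; rewrite lee_fin fB.
apply: fine_cvg; rewrite fineK; last exact: integrable_fin_num.
exact: H.
Qed.

Lemma bdm_sum I (r : seq I) (F : I -> T -> R) : (forall i, bdm (F i)) ->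
  bdm (fun x => \sum_(i <- r) F i x).
Proof.
move=> bF; elim: r => [|i r IH].
  by under eq_fun do rewrite big_nil; exact: bdm_cst.
by under eq_fun do rewrite big_cons; exact: bdmD.
Qed.

Lemma Rintegral_sum (mu : {finite_measure set T -> \bar R}) I (r : seq I)
    (F : I -> T -> R) : (forall i, bdm (F i)) ->
  (\int[mu]_(x in D) (\sum_(i <- r) F i x))%R =
  \sum_(i <- r) (\int[mu]_(x in D) F i x)%R.
Proof.
move=> bF; elim: r => [|i r IH].
  by under eq_Rintegral do rewrite big_nil; rewrite big_nil Rintegral_cst// mul0r.
rewrite big_cons; under eq_Rintegral do rewrite big_cons.
rewrite RintegralD ?IH//; apply: bdm_integrable => //; exact: bdm_sum.
Qed.

End bounded_measurable.

Section real_sequences.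
Variable R : realType.

Lemma bernoulli_ge (u : R) n : -1 <= u -> 1 + n%:R * u <= (1 + u) ^+ n.
Proof.
move=> u0; elim: n => [|n IH]; first by rewrite expr0 mul0r addr0.
rewrite exprS (@le_trans _ _ ((1 + u) * (1 + n%:R * u)))//; last first.
  by rewrite ler_wpM2l//; lra.
rewrite -natr1; have : 0 <= n%:R * u ^+ 2 by rewrite mulr_ge0 ?sqr_ge0.
by nra.
Qed.

Lemma pow_one_minus_le (u : R) n : 0 <= u <= 1 ->
  (1 - u) ^+ n <= (1 + n%:R * u)^-1.
Proof.
move=> /andP[u0 u1].
have p0 : 0 < 1 + n%:R * u by rewrite ltr_pwDl// mulr_ge0.
rewrite -[leRHS]mul1r ler_pdivlMr//.
apply: (@le_trans _ _ ((1 - u) ^+ n * (1 + u) ^+ n)).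
  apply: ler_wpM2l; first by rewrite exprn_ge0// subr_ge0.
  by apply: bernoulli_ge; rewrite (le_trans _ u0).
by rewrite -exprMn exprn_ile1//; nra.
Qed.

Lemma cvg_inv_lin (c : R) : 0 < c -> (1 + n%:R * c)^-1 @[n --> \oo] --> (0 : R).
Proof.
move=> c0; apply: (@squeeze_cvgr _ _ _ _ (cst 0) (fun n => c^-1 * n.+1%:R^-1 * (1 + c))); last 2 first.
- exact: cvg_cst.
- rewrite -[X in _ --> X](mul0r (1 + c)).
  apply: cvgMr_tmp; rewrite -[X in _ --> X](mulr0 c^-1).
  by apply: cvgMl_tmp; exact: cvg_harmonic.
apply: nearW => n /=.
have n0 : (0 : R) <= n%:R by [].
have h1 : 0 < 1 + n%:R * c by rewrite ltr_pwDl// mulr_ge0// ltW.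
have h2 : (0 : R) < n.+1%:R by [].
rewrite invr_ge0 ltW//= -invfM -[leLHS]mul1r.
rewrite [leRHS]mulrC ler_pdivlMr ?mulr_gt0// mulrAC ler_pdivrMr//.
rewrite mul1r -natr1; nra.
Qed.

(** With [r = (1 + q) / 2] one has [q <= r * r], so [q ^+ n] is at most two factors [r ^+ n]. By
    Bernoulli one of them absorbs [n], and the other tends to 0. *)
Lemma cvg_muln_expr (q : R) : 0 <= q -> q < 1 ->
  n%:R * q ^+ n @[n --> \oo] --> (0 : R).
Proof.
move=> q0 q1; pose r := (1 + q) / 2.
have r01 : 0 < r < 1 by rewrite /r; lra.
have [r0 r1] := andP r01.
pose h := r^-1 - 1.
have h0 : 0 < h by rewrite subr_gt0 invf_gt1.
have rh : r = (1 + h)^-1 by rewrite /h addrC subrK invrK.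
apply: (@squeeze_cvgr _ _ _ _ (cst 0) (fun n => h^-1 * r ^+ n)); last 2 first.
- exact: cvg_cst.
- rewrite -[X in _ --> X](mulr0 h^-1); apply: cvgMl_tmp.
  by apply: cvg_expr; rewrite ger0_norm ?ltW.
apply: nearW => n /=; rewrite mulr_ge0 ?exprn_ge0//=.
have qr : q <= r * r by rewrite /r; nra.
apply: (@le_trans _ _ (n%:R * (r ^+ n * r ^+ n))).
  rewrite -exprMn; apply: ler_wpM2l => //; apply: lerXn2r => //.
  by rewrite nnegrE; nra.
rewrite mulrA; apply: ler_wpM2r; first by rewrite exprn_ge0// ltW.
have h1 : 0 < (1 + h) ^+ n by rewrite exprn_gt0//; lra.
rewrite {1}rh exprVn ler_pdivrMr//.
rewrite mulrC ler_pdivlMr// (le_trans _ (bernoulli_ge _ _))//; last by lra.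
by rewrite lerDr.
Qed.

(** Equal to 1 at [a] and tending to 0 at the other points within distance [M]: an indicator of a
    point that can be applied to an operator. *)
Definition bump_at (a M : R) (n : nat) : {poly R} :=
  (1 - (M ^- 2) *: ('X - a%:P) ^+ 2) ^+ n.

Implicit Types (a M s x : R) (k n : nat).

Lemma bump_atE a M n s : (bump_at a M n).[s] = (1 - ((s - a) / M) ^+ 2) ^+ n.
Proof. by rewrite /bump_at !hornerE /= -mulrA -expr2 [_ ^- 2 * _]mulrC -expr_div_n. Qed.

Lemma bump_at_center a M n : (bump_at a M n).[a] = 1.
Proof. by rewrite bump_atE subrr mul0r expr0n subr0 expr1n. Qed.

Lemma bump_at_01 a M n s : 0 < M -> `|s - a| <= M ->
  0 <= (bump_at a M n).[s] <= 1.
Proof.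
move=> M0 sM; rewrite bump_atE.
have h : 0 <= ((s - a) / M) ^+ 2 <= 1.
  rewrite sqr_ge0 /= -real_normK ?num_real// normrM normfV (gtr0_norm M0).
  by rewrite exprn_ile1 ?ler_pdivrMr ?mul1r// divr_ge0// ltW.
by rewrite exprn_ge0 ?exprn_ile1//; lra.
Qed.

Lemma bump_at_cvg a M s : 0 < M -> `|s - a| <= M ->
  (bump_at a M n).[s] @[n --> \oo] --> ((s == a)%:R : R).
Proof.
move=> M0 sM; under eq_fun do rewrite bump_atE.
have [->|sa] := eqVneq s a.
  under eq_fun do rewrite subrr mul0r expr0n subr0 expr1n.
  exact: cvg_cst.
apply: cvg_expr.
have : 0 < ((s - a) / M) ^+ 2 <= 1.
  have d0 : (s - a) / M != 0.
    by rewrite mulf_neq0 ?subr_eq0// invr_eq0 gt_eqF.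
  rewrite exprn_even_gt0//= d0 /=.
  rewrite -real_normK ?num_real// normrM normfV (gtr0_norm M0).
  by rewrite exprn_ile1 ?ler_pdivrMr ?mul1r// divr_ge0// ltW.
by rewrite ltr_norml; lra.
Qed.

(** The polynomial of elementary proofs of the Stone-Weierstrass theorem, tending to the indicator
    of [s < x] on [[0, k x]]. The product of the exponent and the small term is [n * (s / x) ^+ n]:
    it tends to 0 for [s < x] and is at least [n] for [s >= x]. *)
Definition step_below (x : R) (k n : nat) : {poly R} :=
  (1 - ((k%:R * x)^-1 *: 'X) ^+ n) ^+ (n * k ^ n).

Lemma step_belowE x k n s :
  (step_below x k n).[s] = (1 - (s / (k%:R * x)) ^+ n) ^+ (n * k ^ n).
Proof. by rewrite !hornerE mulrC. Qed.

Lemma step_below_01 x k n s : 0 <= s <= k%:R * x ->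
  0 <= (step_below x k n).[s] <= 1.
Proof.
move=> /andP[s0 sk]; rewrite step_belowE.
have h : 0 <= (s / (k%:R * x)) ^+ n <= 1.
  rewrite exprn_ge0 ?exprn_ile1 ?divr_ge0 ?(le_trans s0 sk)//.
  have [->|kx] := eqVneq (k%:R * x) 0; first by rewrite invr0 mulr0.
  by rewrite ler_pdivrMr ?mul1r// lt_neqAle eq_sym kx (le_trans s0 sk).
by rewrite exprn_ge0 ?exprn_ile1//; lra.
Qed.

Lemma step_below_cvg x k s : 0 < x -> (0 < k)%N -> 0 <= s <= k%:R * x ->
  (step_below x k n).[s] @[n --> \oo] --> ((s < x)%R%:R : R).
Proof.
move=> x0 k0 s01; under eq_fun do rewrite step_belowE.
have k0' : (0 : R) < k%:R by rewrite ltr0n.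
set u := s / _; have u01 : 0 <= u <= 1.
  move: s01 => /andP[s0 sk].
  by rewrite divr_ge0 ?ler_pdivrMr ?mul1r ?mulr_gt0// mulr_ge0 ?ltW.
have sE : k%:R * u = s / x by rewrite /u; field; rewrite !gt_eqF.
have un01 n : 0 <= u ^+ n <= 1.
  by move: u01 => /andP[u0 u1]; rewrite exprn_ge0// exprn_ile1.
have [sx|xs] := ltP s x.
  set q := k%:R * u; have q0 : 0 <= q by rewrite mulr_ge0//; lra.
  have q1 : q < 1 by rewrite /q sE ltr_pdivrMr// mul1r.
  apply: (@squeeze_cvgr _ _ _ _ (fun n => 1 - n%:R * q ^+ n) (cst 1)); last 2 first.
  - rewrite -[X in _ --> X]subr0; apply: cvgB; first exact: cvg_cst.
    exact: cvg_muln_expr.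
  - exact: cvg_cst.
  apply: nearW => n /=; move: (un01 n) => /andP[u0 u1]; apply/andP; split; last first.
    by rewrite exprn_ile1//; lra.
  have := @bernoulli_ge (- u ^+ n) (n * k ^ n)%N _; rewrite mulrN.
  by rewrite natrM natrX -mulrA -exprMn -/q; apply; lra.
apply: (@squeeze_cvgr _ _ _ _ (cst 0) (fun n => (1 + n%:R * 1)^-1)); last 2 first.
- exact: cvg_cst.
- exact: cvg_inv_lin.
apply: nearW => n /=; apply/andP; split.
  by rewrite exprn_ge0//; have := un01 n; lra.
apply: le_trans (pow_one_minus_le _ (un01 n)) _.
rewrite lef_pV2 ?posrE ?ltr_pwDl ?mulr_ge0//; last by have := un01 n; lra.
rewrite lerD2l natrM natrX -mulrA -exprMn ler_wpM2l// exprn_ege1//.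
by rewrite sE ler_pdivlMr// mul1r.
Qed.

End real_sequences.

(** * Moment determinacy *)

Section determinacy.
Variable R : realType.

Lemma cdf_determined (d : measure_display) (T : measurableType d)
    (m1 m2 : {finite_measure set T -> \bar R}) (D : set T) (f g : T -> R) (M : R) :
  measurable D -> measurable_fun D f -> measurable_fun D g ->
  (forall t, D t -> 0 <= f t <= M) -> (forall t, D t -> 0 <= g t <= M) ->
  (forall k j, \int[m1]_(t in D) (f t ^+ k * g t ^+ j) =
               \int[m2]_(t in D) (f t ^+ k * g t ^+ j)) ->
  forall x y, m1 (D `&` [set t | f t < x /\ g t < y]) =
              m2 (D `&` [set t | f t < x /\ g t < y]).
Proof.
move=> mD mf mg fM gM m12 x y.
have [x0|x0] := leP x 0.
  rewrite (_ : _ `&` _ = set0) ?measure0//; apply/seteqP; split=> // t [Dt [fx _]].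
  by have /andP[f0 _] := fM _ Dt; move: (lt_le_trans fx x0); rewrite ltNge f0.
have [y0|y0] := leP y 0.
  rewrite (_ : _ `&` _ = set0) ?measure0//; apply/seteqP; split=> // t [Dt [_ gy]].
  by have /andP[g0 _] := gM _ Dt; move: (lt_le_trans gy y0); rewrite ltNge g0.
(* A common scale: both [k x] and [k y] are at least [M], so the step polynomials converge on the
   whole range of [f] and of [g]. *)
pose k := (Num.truncn (M / x) + Num.truncn (M / y)).+1.
have [Mx My] : M <= k%:R * x /\ M <= k%:R * y.
  rewrite -!ler_pdivrMr//; split; apply/ltW/(lt_le_trans (truncnS_gt _));
  by rewrite ler_nat ltnS ?leq_addr ?leq_addl.
have fk t : D t -> 0 <= f t <= k%:R * x.
  by move=> /fM /andP[-> /le_trans]; exact.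
have gk t : D t -> 0 <= g t <= k%:R * y.
  by move=> /gM /andP[-> /le_trans]; exact.
have bf : bdm D f.
  by split=> //; exists M => t /fM /andP[f0 ?]; rewrite ger0_norm.
have bg : bdm D g.
  by split=> //; exists M => t /gM /andP[g0 ?]; rewrite ger0_norm.
pose h n t := (step_below x k n).[f t] * (step_below y k n).[g t].
have bh n : bdm D (h n) by apply: bdmM; exact: bdm_poly.
have poly_eq (p q : {poly R}) : \int[m1]_(t in D) (p.[f t] * q.[g t]) =
    \int[m2]_(t in D) (p.[f t] * q.[g t]).
  have E t : p.[f t] * q.[g t] =
      \sum_(i < size p) \sum_(j < size q) p`_i * q`_j * (f t ^+ i * g t ^+ j).
    rewrite !horner_coef mulr_suml; apply: eq_bigr => i _.
    by rewrite mulr_sumr; apply: eq_bigr => j _; rewrite mulrACA.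
  under eq_Rintegral do rewrite E.
  under [RHS]eq_Rintegral do rewrite E.
  have bij i j : bdm D (fun t => p`_i * q`_j * (f t ^+ i * g t ^+ j)).
    by apply: bdmM; [exact: bdm_cst|apply: bdmM; exact: bdmX].
  have bi (i : 'I_(size p)) : bdm D (fun t => \sum_(j < size q) p`_i * q`_j * (f t ^+ i * g t ^+ j)). exact: bdm_sum.
  rewrite !Rintegral_sum//; apply: eq_bigr => i _.
  rewrite !Rintegral_sum//; apply: eq_bigr => j _.
  by rewrite !RintegralZl ?m12//; apply: bdm_integrable => //; apply: bdmM; exact: bdmX.
pose E := [set t | f t < x /\ g t < y].
have h_cvg t : D t -> h n t @[n --> \oo] --> (\1_E t : R).
  move=> Dt; rewrite (_ : \1_E t = (f t < x)%R%:R * (g t < y)%R%:R); last first.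
    rewrite indicE; have [ltx|lex] := ltP (f t) x; have [lty|ley] := ltP (g t) y;
      rewrite ?mul1r ?mulr1 ?mul0r.
    + by rewrite mem_set.
    + by rewrite memNset// => -[_]; rewrite ltNge ley.
    + by rewrite memNset// => -[]; rewrite ltNge lex.
    + by rewrite memNset// => -[]; rewrite ltNge lex.
  by apply: cvgM; apply: step_below_cvg => //; [exact: fk|exact: gk].
have mDE : measurable (D `&` E).
  rewrite (_ : D `&` E = (D `&` f @^-1` `]-oo, x[) `&` (D `&` g @^-1` `]-oo, y[)).
    by apply: measurableI; [apply: mf|apply: mg] => //; exact: measurable_itv.
  apply/seteqP; split=> t /=; rewrite !in_itv/=; first by move=> [? [? ?]].
  by move=> [[? ?] [_ ?]].
have int1E (m : {finite_measure set T -> \bar R}) :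
    \int[m]_(t in D) \1_E t = fine (m (D `&` E)).
  rewrite /Rintegral (eq_integral (fun t => (\1_(D `&` E) t)%:E)).
    by rewrite integral_indic// setIAC setIid.
  by move=> t; rewrite inE => Dt; rewrite !indicE in_setI (mem_set Dt).
have m1E : measurable_fun D (\1_E : T -> R).
  apply: (@eq_measurable_fun _ _ _ _ _ (\1_(D `&` E) : T -> R)); last exact: measurable_indic.
  by move=> t tD; rewrite !indicE in_setI tD.
have lim (m : {finite_measure set T -> \bar R}) :
    \int[m]_(t in D) h n t @[n --> \oo] --> fine (m (D `&` E)).
  rewrite -int1E; apply: (@bounded_cvg_Rintegral _ _ _ D mD m h _ 1) => //.
  - by move=> n; have [] := bh n.
  - move=> n t Dt; have := @step_below_01 _ x k n (f t) (fk _ Dt).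
    have := @step_below_01 _ y k n (g t) (gk _ Dt).
    move=> /andP[a0 a1] /andP[b0 b1].
    by rewrite ger0_norm ?mulr_ge0// mulr_ile1.
have : fine (m1 (D `&` E)) = fine (m2 (D `&` E)).
  rewrite -(cvg_lim (@Rhausdorff R) (lim m1)) -(cvg_lim (@Rhausdorff R) (lim m2)).
  by congr (limn _); apply/funext => n; exact: poly_eq.
by move=> e; rewrite -[LHS]fineK ?fin_num_measure// e fineK ?fin_num_measure.
Qed.

(** Open rays are stable under intersection and exhaust the line. Finiteness is asked on rays only,
    since the lemma also serves in [inverse_density] for a measure given by an unbounded density. *)
Lemma measure_eq_ray (m1 m2 : {measure set R -> \bar R}) :
  (forall x, m1 `]-oo, x[%classic = m2 `]-oo, x[%classic) ->
  (forall x, (m1 `]-oo, x[%classic < +oo)%E) ->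
  forall A, measurable A -> m1 A = m2 A.
Proof.
move=> m12 m1oo; apply: (measure_unique (@RGenInftyO.G R) (fun n => `]-oo, (n%:R : R)[%classic)).
- exact: RGenInftyO.measurableE.
- move=> _ _ [x ->] [y ->]; exists (Num.min x y).
  apply/seteqP; split=> t /=; rewrite !in_itv/= lt_min; first by move=> [-> ->].
  by move=> /andP[-> ->].
- by move=> n; exists n%:R.
- apply/seteqP; split=> // t _; exists (Num.truncn t).+1 => //=.
  by rewrite in_itv/= truncnS_gt.
- by move=> _ [x ->]; exact: m12.
- by move=> n; exact: m1oo.
Qed.

(** Restricting to a strip and projecting to an axis reduces to [measure_eq_ray]; doing it for one
    factor and then the other passes from quadrants to rectangles. *)
Lemma measure_eq_quadrant (m1 m2 : {finite_measure set (R * R)%type -> \bar R}) :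
  (forall x y, m1 (`]-oo, x[ `*` `]-oo, y[) = m2 (`]-oo, x[ `*` `]-oo, y[)) ->
  forall A, measurable A -> m1 A = m2 A.
Proof.
move=> m12.
have pfst (m : {finite_measure set (R * R)%type -> \bar R}) B A (mB : measurable B) :
    pushforward (mrestr m (measurableX measurableT mB)) fst A = m (A `*` B).
  rewrite /pushforward /mrestr; congr (m _).
  by apply/seteqP; split=> -[u v] /=; tauto.
have psnd (m : {finite_measure set (R * R)%type -> \bar R}) B A (mA : measurable A) :
    pushforward (mrestr m (measurableX mA measurableT)) snd B = m (A `*` B).
  rewrite /pushforward /mrestr; congr (m _).
  by apply/seteqP; split=> -[u v] /=; tauto.
have step1 A y : measurable A -> m1 (A `*` `]-oo, y[) = m2 (A `*` `]-oo, y[).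
  have my : measurable (`]-oo, y[%classic : set R) by [].
  move=> mA; rewrite -!(pfst _ _ _ my); apply: measure_eq_ray => // x.
    by rewrite /= !pfst m12.
  rewrite /= pfst -ge0_fin_numE ?fin_num_measure//; exact: measurableX.
have step2 A B : measurable A -> measurable B -> m1 (A `*` B) = m2 (A `*` B).
  move=> mA mB; rewrite -!(psnd _ _ _ mA); apply: measure_eq_ray => // y.
    by rewrite /= !psnd step1.
  rewrite /= psnd -ge0_fin_numE ?fin_num_measure//; exact: measurableX.
apply: (measure_unique [set A `*` B | A in measurable & B in measurable] (fun=> setT)).
- exact: measurable_prod_measurableType.
- move=> _ _ [A1 mA1 [B1 mB1 <-]] [A2 mA2 [B2 mB2 <-]].
  exists (A1 `&` A2); first exact: measurableI.
  by exists (B1 `&` B2); [exact: measurableI|rewrite setXI].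
- by move=> _; exists setT => //; exists setT => //; rewrite setXTT.
- by apply/seteqP; split=> // t _; exists 0%N.
- by move=> _ [A mA [B mB <-]]; exact: step2.
- by move=> _; rewrite -ge0_fin_numE ?fin_num_measure.
Qed.


End determinacy.

(** * From a normal pair to atoms *)

Section normal_operators.
Variable R : realType.

(** If all second differences were at least [e], the increments would grow linearly and eventually
    exceed [B]. *)
Lemma bounded_second_difference (a : nat -> R) (B : R) :
  (forall n, 0 <= a n <= B) ->
  forall e, 0 < e -> exists n, a n - 2 * a n.+1 + a n.+2 < e.
Proof.
move=> aB e e0; apply: contrapT => /forallNP aN.
have {}aN n : e <= a n - 2 * a n.+1 + a n.+2 by rewrite leNgt; apply/negP.
have inc n : n%:R * e + (a 1%N - a 0%N) <= a n.+1 - a n.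
  elim: n => [|n IH]; first by rewrite mul0r add0r.
  by rewrite -natr1; have := aN n; lra.
have B0 : 0 <= B by case/andP: (aB 0%N) => /le_trans; exact.
have := inc (Num.truncn ((2 * B + 1) / e)).+1.
set k := _.+1; have : 2 * B + 1 < k%:R * e.
  by rewrite -ltr_pdivrMr// truncnS_gt.
have := (aB k, aB k.+1, aB 0%N, aB 1%N).
move=> [[[/andP[? ?] /andP[? ?]] /andP[? ?]] /andP[? ?]]; lra.
Qed.

Lemma second_difference_eq0 (a : nat -> R) (B C t : R) :
  (forall n, 0 <= a n <= B) -> 0 <= C ->
  (forall n, t ^+ 2 <= C * (a n - 2 * a n.+1 + a n.+2)) -> t = 0.
Proof.
move=> aB C0 tC; apply/eqP; apply: contraT => t0.
have t2 : 0 < t ^+ 2 by rewrite exprn_even_gt0.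
have C1 : 0 < C + 1 by lra.
have [n] := @bounded_second_difference a B aB (t ^+ 2 / (C + 1)) (divr_gt0 t2 C1).
rewrite ltr_pdivlMr// => an; have := tC n.
set D := _ + a n.+2 in an *; have [D0|D0] := leP 0 D; nra.
Qed.

Variable H : hilbert R.
Implicit Types (u v w h g : H).

Lemma ip_ext u v : (forall z, ip u z = ip v z) -> u = v.
Proof.
by move=> uv; apply/eqP; rewrite -subr_eq0; apply/eqP/ip_eq0; rewrite ipBl uv subrr.
Qed.

Section one_normal.
Variables (N S : {linear H -> H}).
Hypotheses (NS : adjoint_op N S) (NSc : commute_op N S).

Let A : {linear H -> H} := S \o N.

Lemma ip_modulus u v : ip (A u) v = ip (N u) (N v).
Proof. by rewrite (adjoint_ip' NS). Qed.

Lemma modulus_sym u v : ip (A u) v = ip u (A v).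
Proof. by rewrite ip_modulus (adjoint_ip NS). Qed.

Lemma modulus_comm z : N (A z) = A (N z).
Proof. by rewrite /= NSc. Qed.

Lemma modulus_ker z : A z = 0 -> N z = 0.
Proof. by move=> Az; apply: ip_eq0; rewrite -ip_modulus Az ip0l. Qed.

Lemma iter_adjoint n u v : ip (iter n S u) v = ip u (iter n N v).
Proof.
by elim: n => [|n IH] in u v * => //=; rewrite (adjoint_ip' NS) IH -iterS iterSr.
Qed.

Lemma iter_modulus n u : iter n A u = iter n S (iter n N u).
Proof.
elim: n => //= n ->; congr (S _).
by rewrite iter_comm// => z; rewrite NSc.
Qed.

Lemma ip_iter_modulus n u v : ip (iter n A u) v = ip (iter n N u) (iter n N v).
Proof. by rewrite iter_modulus iter_adjoint. Qed.

Lemma iter_adjoint_norm n u :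
  ip (iter n S u) (iter n S u) = ip (iter n N u) (iter n N u).
Proof.
rewrite iter_adjoint ipC -iter_adjoint; congr (ip _ _).
have NSn z : iter n N (S z) = S (iter n N z) by rewrite -iter_comm// => t; rewrite NSc.
by rewrite iter_comm.
Qed.

(* A form of Fuglede's theorem for the spectral subspace of the unit circle:
   vectors of it are those whose orbits under [N] and under its inverse stay
   bounded, and both properties are inherited by [X g]. *)
Lemma commutant_unit_modulus (X : {linear H -> H}) (C : R) (g : H) :
  (forall z, X (S z) = S (X z)) -> 0 <= C ->
  (forall z, ip (X z) (X z) <= C * ip z z) ->
  A g = g -> A (X g) = X g.
Proof.
move=> XS C0 XC Ag; set w := X g.
have itg n : iter n A g = g by elim: n => //= n ->.
have XSn n z : X (iter n S z) = iter n S (X z) by elim: n => //= n <-.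
(* For every [n], [w] is [S^n X N^n g], because [A^n g = g] and [X] commutes with [S]. The free
   parameter [n] is what makes the estimate below arbitrarily sharp. *)
have wS n v : ip w v = ip (X (iter n N g)) (iter n N v).
  by rewrite /w -{1}(itg n) iter_modulus XSn iter_adjoint.
have Ng n : ip (iter n N g) (iter n N g) = ip g g.
  by rewrite -ip_iter_modulus itg.
pose a n := ip (iter n N w) (iter n N w).
(* Normality replaces [N^n w] by [S^n w], which is [X (S^n g)], and [S^n g] has the norm of [g]. *)
have aB n : 0 <= a n <= C * ip g g.
  by rewrite ip_ge0 /= /a -iter_adjoint_norm -XSn (le_trans (XC _))// iter_adjoint_norm Ng.
have aE i j : ip (iter i A w) (iter j A w) = a (i + j)%N.
  by rewrite ip_iter//; [rewrite -iterD ipC ip_iter_modulus|exact: modulus_sym].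
have NA n i : iter n N (iter i A w) = iter i A (iter n N w).
  elim: n => //= n ->; rewrite iter_comm//; exact: modulus_comm.
have dE n i : ip (iter n N (iter i A w - iter i.+1 A w))
    (iter n N (iter i A w - iter i.+1 A w)) =
    a (n + i + i)%N - 2 * a (n + i + i).+1 + a (n + i + i).+2.
  rewrite -ip_iter_modulus iter_linD -scaleN1r iter_linZ !scaleN1r.
  rewrite -!iterD ipBl !ipBr !aE !addnS !addSn.
  by ring.
(* This difference is the inner product of [w] with [A^i w - A^(i+1) w]. By [wS], [dE] and
   Cauchy-Schwarz its square is at most a constant times a second difference of the bounded sequence
   [a], taken arbitrarily far out. *)
have d0 i : a (i + 0)%N - a i.+1 = 0.
  pose a' n := a (n + i + i)%N.
  have tE : a (i + 0)%N - a i.+1 = ip w (iter i A w - iter i.+1 A w).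
    by rewrite ipBr !(ipC w) -[in a i.+1](addn0 i) -addSn -!aE.
  apply: (@second_difference_eq0 a' (C * ip g g) (C * ip g g)).
  - by move=> n; exact: aB.
  - by rewrite mulr_ge0 ?ip_ge0.
  - move=> n; rewrite /a' !addSn -dE.
    rewrite tE (wS n).
    apply: le_trans (cauchy_schwarz _ _) _.
    by rewrite ler_wpM2r ?ip_ge0// (le_trans (XC _))// Ng.
(* The squared norm of [A w - w] is [a 2 - 2 a 1 + a 0], and these three values now coincide. *)
have a01 := d0 0%N; have a12 := d0 1%N.
apply/eqP; rewrite -subr_eq0; apply/eqP/ip_eq0.
rewrite -[A w]/(iter 1 A w) -{2 4}[w]/(iter 0 A w) ipBl !ipBr !aE /=.
by move: a01 a12; rewrite !addn0; lra.
Qed.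

End one_normal.

Section two_normals.
Variables (N1 S1 N2 S2 : {linear H -> H}).
Hypotheses (NS1 : adjoint_op N1 S1) (NSc1 : commute_op N1 S1).
Hypotheses (NS2 : adjoint_op N2 S2) (NSc2 : commute_op N2 S2).
Hypothesis N12 : commute_op N1 N2.
Variable C : R.
Hypotheses (C0 : 0 <= C) (NC : forall z, ip (N2 z) (N2 z) <= C * ip z z).

Let A1 : {linear H -> H} := S1 \o N1.
Let A2 : {linear H -> H} := S2 \o N2.

Lemma adjoint_commute z : S2 (S1 z) = S1 (S2 z).
Proof.
apply: ip_ext => u.
by rewrite (adjoint_ip' NS2) (adjoint_ip' NS1) N12 -(adjoint_ip' NS2) -(adjoint_ip' NS1).
Qed.

Lemma joint_eigenvector (h : H) (b c : R) : 0 < b ->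
  (forall k j, (0 < k)%N -> (0 < j)%N ->
     ip (iter k N1 (iter j N2 h)) (iter k N1 (iter j N2 h)) = c * b ^+ (2 * j)) ->
  exists w, [/\ A1 w = w, A2 w = (b ^+ 2)%:C%C *: w, ip h w = c * b ^+ 2,
    ip w w = c * b ^+ 4 & N1 (N2 (h - (b ^- 2)%:C%C *: w)) = 0].
Proof.
move=> b0 mom.
have momA k j : (0 < k)%N -> (0 < j)%N ->
    ip (iter k A1 (iter j N2 h)) (iter j N2 h) = c * b ^+ (2 * j).
  by move=> k0 j0; rewrite (ip_iter_modulus NS1 NSc1) mom.
have A1sym := modulus_sym NS1.
have A1ip i k u : ip (iter i A1 u) (iter k A1 u) = ip (iter (i + k) A1 u) u.
  by rewrite addnC iterD [RHS]ip_iter.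
pose g := N2 h; pose g1 := A1 g; pose g0 := g - g1.
have A1g1 : A1 g1 = g1.
  apply/eqP; rewrite -subr_eq0; apply/eqP/ip_eq0.
  rewrite -[A1 g1]/(iter 2 A1 g) -[g1]/(iter 1 A1 g) ipBl !ipBr !A1ip.
  by rewrite !(momA _ 1%N)//; ring.
have N1g0 : N1 g0 = 0.
  apply: (modulus_ker NS1); rewrite -[_ g0]/(A1 g0) linearB A1g1; exact: subrr.
(* [commutant_unit_modulus] wants an operator commuting with the adjoint. As [N2] is known to
   commute with [N1], it is used with [N1] and [S1] exchanged; both orders have the same modulus
   [A1]. *)
have A1N2 u : A1 u = u -> A1 (N2 u) = N2 u.
  move=> Au; rewrite -[A1 _]NSc1.
  apply: (@commutant_unit_modulus S1 N1 (adjoint_sym NS1) (fun z => esym (NSc1 z)) N2 C u) => //.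
  by rewrite -[LHS]/(N1 (S1 u)) NSc1.
have A1N2' u : N1 u = 0 -> A1 (N2 u) = 0 by move=> Nu; rewrite /= N12 Nu !linear0.
have gE : g = g1 + g0 by rewrite /g0 addrC subrK.
have N2g1 : N2 g1 = A1 (N2 g).
  by rewrite [in RHS]gE (linearD N2) (linearD A1) (A1N2' _ N1g0) addr0 A1N2.
have N2N2g1 : N2 (N2 g1) = A1 (N2 (N2 g)).
  rewrite [in RHS]gE (linearD N2 g1 g0) (linearD N2 (N2 g1) (N2 g0)).
  rewrite (linearD A1) [X in _ + X]A1N2'.
    by rewrite addr0 !A1N2.
  by rewrite N12 N1g0 linear0.
have sq j : (0 < j)%N -> ip (A1 (iter j N2 h)) (A1 (iter j N2 h)) = c * b ^+ (2 * j).
  by move=> j0; rewrite -[A1 _]/(iter 1 A1 _) A1ip momA.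
have g1g1 : ip g1 g1 = c * b ^+ 2 by rewrite (sq 1%N).
have n2g1 : ip (N2 g1) (N2 g1) = c * b ^+ 4 by rewrite N2g1 (sq 2%N).
have nn2g1 : ip (N2 (N2 g1)) (N2 (N2 g1)) = c * b ^+ 6 by rewrite N2N2g1 (sq 3%N).
(* The squared norms of [g1], [N2 g1], [N2 (N2 g1)] form a geometric progression of ratio [b ^+ 2]:
   the equality case of Cauchy-Schwarz for [g1] and [A2 g1]. *)
have A2g1 : A2 g1 = (b ^+ 2)%:C%C *: g1.
  have h1 : ip (A2 g1) g1 = c * b ^+ 4 by rewrite (ip_modulus NS2).
  have h2 : ip (A2 g1) (A2 g1) = c * b ^+ 6 by rewrite (adjoint_norm NS2 NSc2).
  apply/eqP; rewrite -subr_eq0; apply/eqP/ip_eq0.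
  rewrite ipBl !ipBr !ipZl !ipZr (ipC g1 (A2 g1)) h1 h2 g1g1; ring.
(* [g1] is a component of [N2 h]; applying [S2] gives a vector to test [h] itself against. Since
   [N2 w] is [b ^+ 2] times [g1], the vector [h - b^-2 w] is sent by [N2] to [g0], which [N1]
   kills. *)
pose w := S2 g1; exists w; split.
- apply: (commutant_unit_modulus NS1 NSc1 (C := C)) => //; first exact: adjoint_commute.
  by move=> z; rewrite (adjoint_norm NS2 NSc2).
- by rewrite /w [LHS]/= NSc2 -[S2 (N2 g1)]/(A2 g1) A2g1 linearZ.
- by rewrite /w ipC (adjoint_ip' NS2) -/g /g1 -[A1 g]/(iter 1 A1 g) (momA _ 1%N).
- by rewrite /w (adjoint_norm NS2 NSc2).
- rewrite linearB linearZ /= NSc2 -[S2 (N2 g1)]/(A2 g1) A2g1 scalerA -rmorphM.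
  by rewrite mulVf ?scale1r ?N1g0// expf_neq0// gt_eqF.
Qed.

End two_normals.

End normal_operators.

(** * Point masses read off from moments *)

Section atoms.
Variable R : realType.
Implicit Types (m : {finite_measure set R -> \bar R}) (M a : R) (p q : {poly R}).

Lemma bdm_id M : bdm `[0, M] (@id R).
Proof.
split; first exact: measurable_id.
by exists M => s /=; rewrite in_itv/= => /andP[s0 sM]; rewrite ger0_norm.
Qed.

Lemma bdm_horner M p : bdm `[0, M] (horner p).
Proof. exact: bdm_poly (bdm_id M). Qed.

Lemma horner_1sub p s : (1 - p).[s] = 1 - p.[s].
Proof. by rewrite !hornerE. Qed.

Lemma Rintegral_horner_cvg m M (P : nat -> {poly R}) (G : R -> R) (B : R) :
  measurable_fun `[0, M]%classic G ->
  (forall n s, 0 <= s <= M -> `|(P n).[s]| <= B) ->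
  (forall s, 0 <= s <= M -> (P n).[s] @[n --> \oo] --> G s) ->
  \int[m]_(s in `[0, M]) (P n).[s] @[n --> \oo] --> \int[m]_(s in `[0, M]) G s.
Proof.
move=> mG PB PG; apply: (@bounded_cvg_Rintegral _ _ _ _ _ _ _ _ B) => //.
by move=> n; have [] := bdm_horner M (P n).
Qed.

Lemma Rintegral_atom m M a : 0 <= a <= M ->
  \int[m]_(s in `[0, M]) (s == a)%:R = fine (m [set a]).
Proof.
move=> aM; rewrite /Rintegral (eq_integral (fun s => (\1_[set a] s)%:E)).
  rewrite integral_indic//; congr (fine (m _)).
  by apply/seteqP; split=> s /= => [[]//|->]; rewrite in_itv/= aM.
by move=> s _; rewrite indicE in_set1.
Qed.

Lemma measurable_eq_fun (D : set R) a : measurable D -> measurable_fun D (fun s : R => (s == a)%:R : R).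
Proof.
move=> mD; rewrite (_ : (fun _ => _) = \1_[set a]); first exact: measurable_indic.
by apply/funext => s; rewrite indicE in_set1.
Qed.

Lemma itv_dist M a s : 0 <= a <= M -> 0 <= s <= M -> `|s - a| <= M.
Proof. by move=> /andP[? ?] /andP[? ?]; rewrite ler_norml; lra. Qed.

Lemma Rintegral_bump_sqr_cvg m M a : 0 < M -> 0 <= a <= M ->
  \int[m]_(s in `[0, M]) (bump_at a M n * bump_at a M n).[s] @[n --> \oo] -->
  fine (m [set a]).
Proof.
move=> M0 aM; rewrite -(@Rintegral_atom m M a aM).
apply: (@Rintegral_horner_cvg _ _ _ _ 1); first exact: measurable_eq_fun.
  move=> n s sM; have := @bump_at_01 _ a M n s M0 (itv_dist aM sM).
  by move=> /andP[p0 p1]; rewrite hornerM ger0_norm ?mulr_ge0// mulr_ile1.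
move=> s sM; under eq_fun do rewrite hornerM.
have -> : (s == a)%:R = (s == a)%:R * (s == a)%:R :> R.
  by case: eqP; rewrite ?mulr1 ?mulr0.
by apply: cvgM; apply: bump_at_cvg => //; exact: itv_dist.
Qed.

Lemma Rintegral_bump_cvg m M a : 0 < M -> 0 <= a <= M ->
  \int[m]_(s in `[0, M]) (bump_at a M n).[s] @[n --> \oo] --> fine (m [set a]).
Proof.
move=> M0 aM; rewrite -(@Rintegral_atom m M a aM).
apply: (@Rintegral_horner_cvg _ _ _ _ 1); first exact: measurable_eq_fun.
  move=> n s sM; have := @bump_at_01 _ a M n s M0 (itv_dist aM sM).
  by move=> /andP[p0 p1]; rewrite ger0_norm.
by move=> s sM; apply: bump_at_cvg => //; exact: itv_dist.
Qed.

Section spectral_measure.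
Variables (H : hilbert R) (A : {linear H -> H}) (h : H).
Hypothesis Asym : forall u v, ip (A u) v = ip u (A v).
Variables (m : {finite_measure set R -> \bar R}) (M : R).
Hypothesis Am : forall k, ip (iter k A h) h = \int[m]_(s in `[0, M]) s ^+ k.

(** As far as polynomials can see, equality of moments makes [m] the spectral measure of [A] at
    [h]. *)
Lemma ip_pact_integral p : ip (pact A p h) h = \int[m]_(s in `[0, M]) p.[s].
Proof.
rewrite /pact ip_suml; under eq_Rintegral do rewrite horner_coef.
rewrite Rintegral_sum//; last first.
  by move=> i; apply: bdmM; [exact: bdm_cst|apply: bdmX; exact: bdm_id].
apply: eq_bigr => i _; rewrite ipZl Am RintegralZl//.
by apply: bdm_integrable => //; apply: bdmX; exact: bdm_id.
Qed.

Lemma ip_pact2_integral p q :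
  ip (pact A p h) (pact A q h) = \int[m]_(s in `[0, M]) (p * q).[s].
Proof. by rewrite ip_pact// ip_pact_integral mulrC. Qed.

(** Testing [p(A) h] against the eigenvector gives [p(a)] times [ip h w]. For bumps at [a] the
    factor is 1, while the squared norm of [p(A) h] tends to the mass of [a]. *)
Lemma eigenvector_atom w a : 0 < M -> 0 <= a <= M -> A w = a%:C%C *: w ->
  ip h w ^+ 2 <= fine (m [set a]) * ip w w.
Proof.
move=> M0 aM Aw.
have lim := @Rintegral_bump_sqr_cvg m M a M0 aM.
have limw : \int[m]_(s in `[0, M]) (bump_at a M n * bump_at a M n).[s] * ip w w
    @[n --> \oo] --> fine (m [set a]) * ip w w by apply: cvgMr_tmp.
apply: (cvgr_to_ge limw); apply: nearW => n.
rewrite -ip_pact2_integral; apply: le_trans (cauchy_schwarz _ _).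
rewrite (pact_sym Asym) (pact_eigen _ Aw) bump_at_center.
by rewrite scale1r.
Qed.

End spectral_measure.

Section joint_atoms.
Variables (H : hilbert R) (N1 S1 N2 S2 : {linear H -> H}).
Hypotheses (NS1 : adjoint_op N1 S1) (NSc1 : commute_op N1 S1).
Hypotheses (NS2 : adjoint_op N2 S2) (NSc2 : commute_op N2 S2).
Hypothesis N12 : commute_op N1 N2.
Variable C : R.
Hypotheses (C0 : 0 <= C) (NC : forall z, ip (N2 z) (N2 z) <= C * ip z z).
Variables (h : H) (xi eta : {finite_measure set R -> \bar R}) (b c M : R).
Hypotheses (b0 : 0 < b) (c0 : 0 < c) (M1 : 1 <= M) (bM : b ^+ 2 <= M).
Hypothesis h1 : ip h h = 1.
Hypothesis momx : forall k,
  ip (iter k N1 h) (iter k N1 h) = \int[xi]_(s in `[0, M]) s ^+ k.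
Hypothesis momy : forall j,
  ip (iter j N2 h) (iter j N2 h) = \int[eta]_(s in `[0, M]) s ^+ j.
Hypothesis momxy : forall k j, (0 < k)%N -> (0 < j)%N ->
  ip (iter k N1 (iter j N2 h)) (iter k N1 (iter j N2 h)) = c * b ^+ (2 * j).

(* With [w] the joint eigenvector of eigenvalues 1 and [b ^+ 2], the vector
   [h - b^-2 w] is killed by [N1 N2]; the vectors [z n] obtained from it by
   cutting off the kernel of [N2] lie in the kernel of [N1], and Cauchy-Schwarz
   for [<h, z n>] gives the last inequality. *)
Lemma joint_atoms : [/\ c <= fine (eta [set b ^+ 2]), c <= fine (xi [set 1]) &
  1 <= fine (xi [set 0]) + fine (eta [set 0]) + c].
Proof.
have M0 : 0 < M by apply: lt_le_trans M1.
have [w [A1w A2w hw ww N12w]] := joint_eigenvector NS1 NSc1 NS2 NSc2 N12 C0 NC b0 momxy.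
have Am1 k : ip (iter k (S1 \o N1 : {linear _ -> _}) h) h = \int[xi]_(s in `[0, M]) s ^+ k.
  by rewrite (ip_iter_modulus NS1 NSc1) momx.
have Am2 k : ip (iter k (S2 \o N2 : {linear _ -> _}) h) h = \int[eta]_(s in `[0, M]) s ^+ k.
  by rewrite (ip_iter_modulus NS2 NSc2) momy.
have b2 : 0 < b ^+ 2 by rewrite exprn_gt0.
have b4 : 0 < b ^+ 4 by rewrite exprn_gt0.
(* By the values found for [w], the square of [ip h w] is [c * ip w w], so the estimate of
   [eigenvector_atom] bounds the mass below by [c]. *)
have cancel x : (c * b ^+ 2) ^+ 2 <= x * (c * b ^+ 4) -> c <= x.
  rewrite (_ : (c * b ^+ 2) ^+ 2 = c * (c * b ^+ 4)); last by ring.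
  by rewrite ler_pM2r// mulr_gt0.
split.
- apply: cancel; rewrite -ww -hw.
  by apply: (eigenvector_atom (modulus_sym NS2) Am2) => //; rewrite ltW.
- apply: cancel; rewrite -ww -hw.
  by apply: (eigenvector_atom (modulus_sym NS1) Am1) => //; rewrite ?ler01// scale1r.
pose A2 : {linear H -> H} := S2 \o N2; pose A1 : {linear H -> H} := S1 \o N1.
have A2sym : forall u v, ip (A2 u) v = ip u (A2 v) := modulus_sym NS2.
pose h' := h - (b ^- 2)%:C%C *: w.
pose q n := bump_at 0 M n; pose z n := pact A2 (1 - q n) h'.
have kerA2 u : N1 u = 0 -> N1 (A2 u) = 0.
  move=> u0; have S1u : S1 (N2 u) = 0.
    apply: ip_eq0; rewrite (adjoint_norm NS1 NSc1) N12 u0 linear0 ip0l//.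
  apply: ip_eq0; rewrite -(adjoint_norm NS1 NSc1) -[A2 u]/(S2 (N2 u)).
  by rewrite -(adjoint_commute NS1 NS2 N12) S1u linear0 ip0l.
have kerpact p u : N1 u = 0 -> N1 (pact A2 p u) = 0.
  move=> u0; rewrite linear_sum big1// => i _; rewrite linearZ /=.
  rewrite (_ : N1 _ = 0) ?scaler0//.
  by elim: (i : nat) => //= k /kerA2.
have A1z n : A1 (z n) = 0.
  suff : N1 (z n) = 0 by move=> Nz; rewrite -[LHS]/(S1 (N1 (z n))) Nz linear0.
  (* [1 - q n] is divisible by ['X], so [z n] is a polynomial in [A2] applied to [A2 h']. The latter
     is [S2 (N2 h')], in the kernel of [N1] because [N2 h'] is, and [kerpact] keeps it there. *)
  have : root (1 - q n) 0 by rewrite rootE horner_1sub bump_at_center subrr.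
  rewrite /z => /factor_theorem[r ->]; rewrite subr0 pactMX; apply: kerpact.
  apply: ip_eq0; rewrite -(adjoint_norm NS1 NSc1) -[A2 _]/(S2 (N2 h')).
  rewrite -(adjoint_commute NS1 NS2 N12) (_ : S1 (N2 h') = 0) ?linear0 ?ip0l//.
  by apply: ip_eq0; rewrite (adjoint_norm NS1 NSc1) N12w ip0l.
pose l n := 1 - (q n).[b ^+ 2].
have zE n : z n = pact A2 (1 - q n) h - (l n / b ^+ 2)%:C%C *: w.
  rewrite /z pact_sub pact_scale (pact_eigen _ A2w) scalerA -rmorphM.
  by rewrite horner_1sub mulrC.
have pw n : ip (pact A2 (1 - q n) h) w = l n * (c * b ^+ 2).
  by rewrite (pact_sym A2sym) (pact_eigen _ A2w) ipZr hw horner_1sub.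
have hz n : ip h (z n) = \int[eta]_(s in `[0, M]) (1 - q n).[s] - l n * c.
  rewrite zE ipBr ipZr hw -(ip_pact_integral Am2) ipC; congr (_ - _).
  by field; rewrite gt_eqF.
have zz n : ip (z n) (z n) =
    \int[eta]_(s in `[0, M]) ((1 - q n) * (1 - q n)).[s] - l n ^+ 2 * c.
  rewrite zE ipBl !ipBr !ipZl !ipZr (ipC w) pw ww (ip_pact2_integral A2sym Am2).
  by field; rewrite gt_eqF.
have eta1 : fine (eta `[0, M]%classic) = 1.
  have := momy 0; rewrite /= h1 => ->.
  by under eq_Rintegral do rewrite expr0; rewrite Rintegral_cst// mul1r.
have lim_l : l n @[n --> \oo] --> (1 : R).
  rewrite -[X in _ --> X]subr0; apply: cvgB; first exact: cvg_cst.
  rewrite -[X in _ --> X](_ : (b ^+ 2 == 0)%:R = _); last by rewrite gt_eqF.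
  by apply: bump_at_cvg => //; rewrite subr0 ger0_norm// ltW.
have lim1 : \int[eta]_(s in `[0, M]) (1 - q n).[s] @[n --> \oo] -->
    1 - fine (eta [set 0]).
  rewrite (_ : (fun n => _) = fun n => 1 - \int[eta]_(s in `[0, M]) (q n).[s]).
    by apply: cvgB; [exact: cvg_cst|apply: Rintegral_bump_cvg; rewrite ?lexx ?ltW].
  apply/funext => n; under eq_Rintegral do rewrite horner_1sub.
  rewrite RintegralB//; [|exact: finite_measure_integrable_cst|by apply: bdm_integrable => //; exact: bdm_horner].
  by rewrite Rintegral_cst// mul1r eta1.
have lim2 : \int[eta]_(s in `[0, M]) ((1 - q n) * (1 - q n)).[s] @[n --> \oo] -->
    1 - fine (eta [set 0]).
  rewrite (_ : (fun n => _) = fun n => (1 - 2 * \int[eta]_(s in `[0, M]) (q n).[s])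
      + \int[eta]_(s in `[0, M]) (q n * q n).[s]).
    rewrite [X in _ --> X](_ : _ = (1 - 2 * fine (eta [set 0])) + fine (eta [set 0])); last by ring.
    apply: cvgD; last by apply: Rintegral_bump_sqr_cvg; rewrite ?lexx ?ltW.
    apply: cvgB; first exact: cvg_cst.
    by apply: cvgMl_tmp; apply: Rintegral_bump_cvg; rewrite ?lexx ?ltW.
  have iq (p : {poly R}) : eta.-integrable `[0, M] (EFin \o horner p).
    by apply: bdm_integrable => //; exact: bdm_horner.
  apply/funext => n.
  rewrite (_ : (1 - q n) * (1 - q n) = (1 - 2 *: q n) + q n * q n); last first.
    by rewrite -mul_polyC polyCMn; ring.
  have -> : 1 - 2 * \int[eta]_(s in `[0, M]) (q n).[s] = \int[eta]_(s in `[0, M]) (1 - 2 *: q n).[s].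
    rewrite -RintegralZl//; under [RHS]eq_Rintegral do rewrite horner_1sub hornerZ.
    rewrite RintegralB//; [|exact: finite_measure_integrable_cst|].
      by rewrite Rintegral_cst// mul1r eta1.
    by have := iq (2 *: q n); apply: eq_integrable => // s _; rewrite /= hornerZ.
  by rewrite -RintegralD//; apply: eq_Rintegral => s _; rewrite hornerD.
(* Both [ip h (z n)] and [ip (z n) (z n)] tend to [D], as they would if [z n] approached an
   orthogonal projection of [h]. *)
pose D := 1 - fine (eta [set 0]) - c.
have limh : ip h (z n) @[n --> \oo] --> D.
  rewrite (_ : (fun n => _) = fun n => \int[eta]_(s in `[0, M]) (1 - q n).[s] - l n * c); last exact/funext.
  by apply: cvgB => //; rewrite -[X in _ --> X]mul1r; apply: cvgMr_tmp.
have limz : ip (z n) (z n) @[n --> \oo] --> D.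
  rewrite (_ : (fun n => _) = fun n => \int[eta]_(s in `[0, M]) ((1 - q n) * (1 - q n)).[s] - l n ^+ 2 * c); last exact/funext.
  apply: cvgB => //; rewrite -[X in _ --> X]mul1r; apply: cvgMr_tmp.
  by rewrite -[X in _ --> X](mulr1 1); under eq_fun do rewrite expr2; exact: cvgM.
have D0 : 0 <= D.
  by apply: (cvgr_to_ge limz); apply: nearW => n; exact: ip_ge0.
(* [eigenvector_atom] for the eigenvalue 0 of [A1], in the limit; a factor [D] then cancels unless
   [D = 0], where the claim is clear. *)
have DD : D * D <= fine (xi [set 0]) * D.
  have s1 : ip h (z n) * ip h (z n) @[n --> \oo] --> D * D by apply: cvgM.
  have s2 : fine (xi [set 0]) * ip (z n) (z n) @[n --> \oo] --> fine (xi [set 0]) * D.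
    by apply: cvgMl_tmp.
  apply: (ler_cvg_to s1 s2); apply: nearW => n; rewrite -expr2.
  apply: (eigenvector_atom (modulus_sym NS1) Am1) => //; first by rewrite lexx ltW.
  by rewrite scale0r -[LHS]/(A1 (z n)).
have xi0 : 0 <= fine (xi [set 0]) by rewrite fine_ge0.
suff : D <= fine (xi [set 0]) by rewrite /D; lra.
have [->//|Dn0] := eqVneq D 0.
by rewrite -(@ler_pM2r _ D)// lt_neqAle eq_sym Dn0.
Qed.

End joint_atoms.

End atoms.

Section concentrated_measures.
Variables (d : measure_display) (T : measurableType d) (R : realType).
Variables (m : {finite_measure set T -> \bar R}) (D : set T).
Hypotheses (mD : measurable D) (mDC : m (~` D) = 0%E).

Lemma concentrated_measure A : measurable A -> m A = m (D `&` A).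
Proof.
move=> mA; rewrite -[in LHS](setIT A) -(setUv D) setIUr measureU//.
- rewrite [X in (_ + X)%E](_ : _ = 0%E) ?adde0 1?setIC//.
  by apply: subset_measure0 mDC => //; [apply: measurableI => //; exact: measurableC|exact: measurableC].
- exact: measurableI.
- by apply: measurableI => //; exact: measurableC.
- by rewrite setIACA setICr setI0.
Qed.

Lemma concentrated_integrable f : measurable_fun setT f -> bdm D f ->
  m.-integrable setT (EFin \o f).
Proof.
move=> mf bf; apply/(negligible_integrable (measurableC mD) measurableT _ mDC).
  exact/measurable_EFinP.
by rewrite setDE setTI setCK; exact: bdm_integrable.
Qed.

Lemma concentrated_integral f : measurable_fun setT f -> bdm D f ->
  (\int[m]_t (f t)%:E)%E = (\int[m]_(t in D) f t)%:E.
Proof.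
move=> mf bf; rewrite (negligible_integral (measurableC mD) measurableT _ mDC); last first.
  exact: concentrated_integrable.
rewrite setDE setTI setCK /Rintegral fineK//.
by apply: integrable_fin_num => //; exact: bdm_integrable.
Qed.

End concentrated_measures.

Section compact_support.
Variable R : realType.
Implicit Types (m : {finite_measure set R -> \bar R}).

Lemma moment_determinacy (M : R) (m1 m2 : {finite_measure set (R * R)%type -> \bar R}) :
  m1 (~` (`[0, M]%classic `*` `[0, M]%classic)) = 0%E ->
  m2 (~` (`[0, M]%classic `*` `[0, M]%classic)) = 0%E ->
  (forall k j, \int[m1]_(p in `[0, M] `*` `[0, M]) (p.1 ^+ k * p.2 ^+ j) =
     \int[m2]_(p in `[0, M] `*` `[0, M]) (p.1 ^+ k * p.2 ^+ j)) ->
  forall A, measurable A -> m1 A = m2 A.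
Proof.
move=> m10 m20 m12; apply: measure_eq_quadrant => x y.
have mD : measurable (`[0, M]%classic `*` `[0, M]%classic : set (R * R)).
  exact: measurableX.
have E : (`[0, M]%classic `*` `[0, M]%classic) `&` (`]-oo, x[%classic `*` `]-oo, y[%classic) =
    (`[0, M]%classic `*` `[0, M]%classic) `&` [set t : R * R | t.1 < x /\ t.2 < y].
  by apply/seteqP; split=> s /=; rewrite !in_itv/=; tauto.
rewrite [LHS](concentrated_measure mD m10) 1?[RHS](concentrated_measure mD m20);
  try exact: measurableX.
rewrite E; apply: (cdf_determined (M := M)) => //.
- exact: measurable_funTS.
- exact: measurable_funTS.
- by move=> t [] /=; rewrite in_itv.
- by move=> t [] _ /=; rewrite in_itv.
Qed.

Lemma support_widen m (M M' : R) : M <= M' -> m (~` `[0, M]%classic) = 0%E ->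
  m (~` `[0, M']%classic) = 0%E.
Proof.
move=> MM'; apply: subset_measure0; try exact: measurableC.
apply: subsetC => s /=; rewrite !in_itv/= => /andP[-> /le_trans]; exact.
Qed.

Lemma measurable_expr k : measurable_fun setT (fun s : R => s ^+ k).
Proof. exact: exprn_measurable. Qed.

Lemma bdm_expr (M : R) k : bdm `[0, M] (fun s : R => s ^+ k).
Proof. by apply: bdmX; exact: bdm_id. Qed.

(** Stated for every sufficiently large [M], so that several Berger measures can be placed on one
    interval. *)
Lemma berger_moment (w : nat -> R) (zeta : probability R R) :
  is_berger w zeta -> exists M0, forall M, M0 <= M ->
    zeta (~` `[0, M]%classic) = 0%E /\
    forall k, \int[zeta]_(s in `[0, M]) s ^+ k = \prod_(i < k) w i ^+ 2.
Proof.
move=> [[M0 zM0] zmom]; exists M0 => M MM.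
have zM := support_widen MM zM0; split=> // k; apply: EFin_inj.
rewrite -zmom.
have mM : measurable `[0, M]%classic by [].
by rewrite (concentrated_integral mM zM (@measurable_expr k) (@bdm_expr M k)).
Qed.

End compact_support.

(** * Direct sums and shifts *)

Section hilbert_limits.
Variables (R : realType) (H : hilbert R).
Implicit Types (u v : nat -> H) (x y l : H).

(** The form in which [hilbert_complete] provides limits; [hcvgP] turns it into convergence of a
    real sequence. *)
Definition hcvg u l : Prop := forall e : R, 0 < e ->
  exists N, forall n, (N <= n)%N -> hnorm (u n - l) < e.

Lemma hcvgP u l : hcvg u l <-> hnorm (u n - l) @[n --> \oo] --> (0 : R).
Proof.
split=> [ul|/cvgrPdist_lt ul e e0].
  apply/cvgrPdist_lt => e /ul[N uN]; exists N => // n /= Nn.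
  by rewrite sub0r normrN ger0_norm ?hnorm_ge0// uN.
have [N _ uN] := ul _ e0; exists N => n Nn.
by have := uN n Nn; rewrite sub0r normrN ger0_norm ?hnorm_ge0.
Qed.

Lemma hcvg_unique u l l' : hcvg u l -> hcvg u l' -> l = l'.
Proof.
move=> /hcvgP ul /hcvgP ul'; apply/eqP; rewrite -subr_eq0; apply/eqP/hnorm_eq0.
apply/eqP; rewrite eq_le hnorm_ge0 andbT.
have s : hnorm (u n - l) + hnorm (u n - l') @[n --> \oo] --> (0 + 0 : R) by apply: cvgD.
rewrite -[X in _ <= X](addr0 0); apply: (cvgr_to_ge s); apply: nearW => n.
rewrite (_ : l - l' = - (u n - l) + (u n - l')).
  by rewrite (le_trans (hnormD _ _))// hnormN.
by rewrite opprB addrA subrK.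
Qed.

Lemma hcvgD u v l l' : hcvg u l -> hcvg v l' -> hcvg (fun n => u n + v n) (l + l').
Proof.
move=> /hcvgP ul /hcvgP vl; apply/hcvgP.
have s : hnorm (u n - l) + hnorm (v n - l') @[n --> \oo] --> (0 + 0 : R) by apply: cvgD.
rewrite addr0 in s; apply: (@squeeze_cvgr _ _ _ _ (cst 0) _ _ _ _ _ s); last exact: cvg_cst.
by apply: nearW => n; rewrite hnorm_ge0 /= opprD addrACA hnormD.
Qed.

Lemma hcvg_ip u v l l' : hcvg u l -> hcvg v l' ->
  ip (u n) (v n) @[n --> \oo] --> ip l l'.
Proof.
move=> /hcvgP ul /hcvgP vl.
rewrite -[ip l l']addr0 -[X in _ + X]addr0 -[X in _ + (_ + X)]addr0.
have -> : (fun n => ip (u n) (v n)) = (fun n => ip l l' + (ip (u n - l) l' +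
    (ip l (v n - l') + ip (u n - l) (v n - l')))).
  by apply/funext => n; rewrite !ipBl !ipBr; ring.
have bnd (f g : nat -> H) : hnorm (f n) * hnorm (g n) @[n --> \oo] --> (0 : R) ->
    ip (f n) (g n) @[n --> \oo] --> (0 : R).
  move=> fg; apply: norm_cvg0; apply: (@squeeze_cvgr _ _ _ _ (cst 0) _ _ _ _ _ fg); last exact: cvg_cst.
  apply: nearW => n; rewrite normr_ge0 /= ler_norml ip_le_hnorm andbT.
  by rewrite lerNl -ipNl (le_trans (ip_le_hnorm _ _))// hnormN.
apply: cvgD; first exact: cvg_cst.
apply: cvgD; first by apply: (bnd _ (fun=> l')); rewrite -[X in _ --> X](mul0r (hnorm l')); exact: cvgMr_tmp.
apply: cvgD; first by apply: (bnd (fun=> l)); rewrite -[X in _ --> X](mulr0 (hnorm l)); exact: cvgMl_tmp.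
by apply: bnd; rewrite -[X in _ --> X](mulr0 0); exact: cvgM.
Qed.

Lemma Im_hdot x y : complex.Im (hdot H x y) = ip (Complex 0 (-1) *: x) y.
Proof. by rewrite /ip linearZl_LR/= Defs.ReM /= mul0r mulN1r opprK add0r. Qed.

(** Identities proved for the real part for all vectors thereby pass to the complex inner
    product. *)
Lemma hdotE x y : hdot H x y = Complex (ip x y) (ip (Complex 0 (-1) *: x) y).
Proof. by rewrite -Im_hdot /ip; case: (hdot H x y). Qed.

End hilbert_limits.

Section bounded_operators.
Variable R : realType.

Lemma bounded_op_ge0 (H : hilbert R) (T : {linear H -> H}) : bounded_op T ->
  exists2 M, 0 <= M & forall x, hnorm (T x) <= M * hnorm x.
Proof.
move=> [M TM]; exists `|M| => // x; rewrite (le_trans (TM x))//.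
by rewrite ler_wpM2r ?hnorm_ge0// ler_norm.
Qed.

Lemma bounded_op_sqr (H : hilbert R) (T : {linear H -> H}) : bounded_op T ->
  exists2 C, 0 <= C & forall x, ip (T x) (T x) <= C * ip x x.
Proof.
move=> /bounded_op_ge0[M M0 TM]; exists (M ^+ 2); first exact: sqr_ge0.
by move=> x; rewrite -!hnormE -exprMn lerXn2r// nnegrE ?mulr_ge0 ?hnorm_ge0.
Qed.

Lemma hcvg_bounded (H K : hilbert R) (T : {linear H -> K}) (M : R) u l :
  (forall x, hnorm (T x) <= M * hnorm x) -> hcvg u l ->
  hcvg (fun n => T (u n)) (T l).
Proof.
move=> TM /hcvgP ul; apply/hcvgP.
have s : M * hnorm (u n - l) @[n --> \oo] --> M * 0 by apply: cvgMl_tmp.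
rewrite mulr0 in s; apply: (@squeeze_cvgr _ _ _ _ (cst 0) _ _ _ _ _ s); last exact: cvg_cst.
by apply: nearW => n; rewrite hnorm_ge0 /= -linearB.
Qed.

Lemma hcvg_iter (H : hilbert R) (T : {linear H -> H}) u l k :
  bounded_op T -> hcvg u l -> hcvg (fun n => iter k T (u n)) (iter k T l).
Proof.
by move=> [M TM] ul; elim: k => //= k IH; exact: hcvg_bounded TM IH.
Qed.

(** Polarization for the real part; complex linearity of [V] and [hdotE] give the imaginary part. *)
Lemma isometric_of_norm (H K : hilbert R) (V : {linear H -> K}) :
  (forall x, hnorm (V x) = hnorm x) -> isometric V.
Proof.
move=> Vn.
have Vip x y : ip (V x) (V y) = ip x y.
  have := hnormE (V (x + y)); rewrite Vn hnormE linearD !ipDl !ipDr.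
  rewrite -!(hnormE (V _)) !Vn !hnormE (ipC y) (ipC (V y)); lra.
by move=> x y; rewrite !hdotE -linearZ !Vip.
Qed.

End bounded_operators.

Section direct_sum.
Variables (R : realType) (H K : hilbert R).
Local Notation HK := (H * K)%type.

Definition sum_dot (p q : HK) : R[i] := hdot H p.1 q.1 + hdot K p.2 q.2.

Fact sum_dot_is_bilinear : bilinear_for
  (GRing.Scale.Law.clone _ _ *%R _) (GRing.Scale.Law.clone _ _ (Num.conj \; *%R) _)
  sum_dot.
Proof.
have dist (c s t s' t' : R[i]) :
    c * s + t + (c * s' + t') = c * (s + s') + (t + t').
  by rewrite mulrDr addrACA.
split=> [q|p] c x y /=; rewrite /sum_dot /=.
  by rewrite !linearDl/= !linearZl_LR/=; exact: dist.
rewrite !linearDr/= !linearZr_LR/=.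
exact: addrACA.
Qed.
HB.instance Definition _ := bilinear_isBilinear.Build R[i] HK HK R[i] _ _ sum_dot
  sum_dot_is_bilinear.

Fact sum_dot_herm p q : sum_dot p q = (-1) ^+ false * (sum_dot q p)^*.
Proof. by rewrite expr0 mul1r /sum_dot (hdotC p.1) (hdotC p.2) rmorphD. Qed.
HB.instance Definition _ := isHermitianSesquilinear.Build R[i] HK false Num.conj
  sum_dot sum_dot_herm.

Fact sum_dot_gt0 p : p != 0 -> 0 < sum_dot p p.
Proof.
rewrite /sum_dot => p0; have [p1|p1] := eqVneq p.1 0.
  have p2 : p.2 != 0.
    by apply: contra p0 => /eqP p2; rewrite [p]surjective_pairing p1 p2.
  by rewrite ltr_wpDl ?hdot_ge0// dnorm_gt0.
by rewrite ltr_pwDl ?hdot_ge0// dnorm_gt0.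
Qed.
HB.instance Definition _ := isDotProduct.Build R[i] HK sum_dot sum_dot_gt0.

Lemma sum_dnorm p : dnorm sum_dot p = Num.sqrt (hnorm p.1 ^+ 2 + hnorm p.2 ^+ 2).
Proof. by rewrite !hnormE /dnorm /sum_dot Defs.ReD. Qed.

Lemma le_sum_dnorm p : hnorm p.1 <= dnorm sum_dot p /\ hnorm p.2 <= dnorm sum_dot p.
Proof.
have h (x y : R) : 0 <= x -> x <= Num.sqrt (x ^+ 2 + y ^+ 2).
  by move=> x0; rewrite -{1}(ger0_norm x0) -sqrtr_sqr ler_wsqrtr// lerDl sqr_ge0.
by rewrite sum_dnorm h ?hnorm_ge0// addrC h ?hnorm_ge0.
Qed.

Lemma sum_dnorm_le p : dnorm sum_dot p <= hnorm p.1 + hnorm p.2.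
Proof.
have h0 : 0 <= hnorm p.1 + hnorm p.2 by rewrite addr_ge0 ?hnorm_ge0.
rewrite sum_dnorm -[leRHS]ger0_norm// -sqrtr_sqr ler_wsqrtr// sqrrD.
by rewrite addrAC lerDl mulrn_wge0// mulr_ge0 ?hnorm_ge0.
Qed.

Lemma sum_complete (u : nat -> HK) :
  (forall eps : R, 0 < eps -> exists N, forall m n, (N <= m)%N -> (N <= n)%N ->
     dnorm sum_dot (u m - u n) < eps) ->
  exists l, forall eps : R, 0 < eps -> exists N, forall n, (N <= n)%N ->
     dnorm sum_dot (u n - l) < eps.
Proof.
move=> cu.
have [l1 u1] := @hilbert_complete _ H (fun n => (u n).1) (fun e e0 =>
  let: ex_intro N uN := cu e e0 in
  ex_intro _ N (fun m n Nm Nn => le_lt_trans (le_sum_dnorm _).1 (uN m n Nm Nn))).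
have [l2 u2] := @hilbert_complete _ K (fun n => (u n).2) (fun e e0 =>
  let: ex_intro N uN := cu e e0 in
  ex_intro _ N (fun m n Nm Nn => le_lt_trans (le_sum_dnorm _).2 (uN m n Nm Nn))).
exists (l1, l2) => e e0; have e2 : 0 < e / 2 by rewrite divr_gt0.
have [N1 uN1] := u1 _ e2; have [N2 uN2] := u2 _ e2.
exists (maxn N1 N2) => n; rewrite geq_max => /andP[n1 n2].
rewrite (le_lt_trans (sum_dnorm_le _))// [ltRHS]splitr.
by rewrite ltrD ?uN1 ?uN2.
Qed.

Definition hsum : hilbert R := Hilbert sum_complete.

Section diagonal.
Variables (S : {linear H -> H}) (T : {linear K -> K}).

Definition diag_op (p : hsum) : hsum := (S p.1, T p.2).

Lemma diag_op_linear : linear diag_op.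
Proof. by move=> c x y; rewrite /diag_op /= !linearP. Qed.

HB.instance Definition _ := GRing.isLinear.Build R[i] hsum hsum _ diag_op diag_op_linear.

End diagonal.

Lemma hdot_hsum (p q : hsum) : hdot hsum p q = hdot H p.1 q.1 + hdot K p.2 q.2.
Proof. by []. Qed.

Lemma iter_diag S T k (p : hsum) :
  iter k (diag_op S T : {linear hsum -> hsum}) p = (iter k S p.1, iter k T p.2) :> HK.
Proof. by elim: k => [|k /= ->]//; case: p. Qed.

Lemma diag_normal S T : normal_op S -> normal_op T ->
  normal_op (diag_op S T : {linear hsum -> hsum}).
Proof.
move=> [/bounded_op_ge0[M M0 SM] [S' SS' cS]] [/bounded_op_ge0[L L0 TL] [T' TT' cT]].
split.
  exists (M + L) => p; apply: le_trans (sum_dnorm_le _) _ => /=.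
  rewrite mulrDl; have [h1 h2] := le_sum_dnorm p; apply: lerD.
    by rewrite (le_trans (SM _))// ler_wpM2l.
  by rewrite (le_trans (TL _))// ler_wpM2l.
exists (diag_op S' T') => [p q|p].
  by rewrite !hdot_hsum /= SS' TT'.
by rewrite /= /diag_op /= cS cT.
Qed.

Lemma diag_commute S S' T T' : commute_op S S' -> commute_op T T' ->
  commute_op (diag_op S T : {linear hsum -> hsum}) (diag_op S' T').
Proof. by move=> cS cT p; rewrite /= /diag_op /= cS cT. Qed.

End direct_sum.

Section zero_operator.
Variables (R : realType) (H : hilbert R).

Lemma zero_normal : normal_op (\0%R : {linear H -> H}).
Proof.
split; first by exists 0 => x; rewrite hnorm0 mul0r.
exists \0%R => [x y|//]; by rewrite linear0l linear0r.
Qed.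

Lemma zero_commute (T : {linear H -> H}) : commute_op T \0%R.
Proof. by move=> x; rewrite /= linear0. Qed.

End zero_operator.

Section ell2_basis.
Variables (R : realType) (T : choiceType).

Lemma nsum_delta (k : T) : nsum (fun j => ((j == k)%:R : R)) = 1%E.
Proof.
rewrite /nsum (esumID [set k]); last by move=> j _; rewrite lee_fin.
rewrite setTI esum_set1 ?lee_fin// eqxx esum1 ?adde0//.
by move=> j [_ /= /eqP/negPf ->].
Qed.

Lemma delta_l2 (k : T) : (fun j => ((j == k)%:R : R[i])) \in @l2_pred R T.
Proof.
rewrite l2_predE (_ : (fun _ => _) = (fun j => ((j == k)%:R : R))).
  by rewrite nsum_delta ltry.
by apply/funext => j; case: eqP; rewrite ?normc1 ?normc0 ?expr1n ?expr0n.
Qed.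

Definition delta (k : T) : ell2 R T := L2 (delta_l2 k).

Lemma rsum_delta (k : T) (c : R) : rsum (fun j => c * (j == k)%:R) = c.
Proof.
have sd : smb (fun j => ((j == k)%:R : R)).
  by rewrite /smb (_ : (fun _ => _) = (fun j => ((j == k)%:R : R)))
    ?nsum_delta ?ltry//; apply/funext => j; rewrite normr_nat.
by rewrite rsumZ// rsum_ge0E ?nsum_delta ?ltry ?mulr1.
Qed.

Lemma hdot_delta (F : ell2 R T) k : hdot (ell2 R T) F (delta k) = F k.
Proof.
rewrite -[LHS]/(csum (fun j => F j * ((j == k)%:R)^*)) /csum.
have -> : (fun j => complex.Re (F j * ((j == k)%:R)^*)) =
    (fun j => complex.Re (F k) * (j == k)%:R).
  apply/funext => j; case: eqP => [->|_]; rewrite ?conjC1 ?conjC0 ?mulr1 ?mulr0//.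
have -> : (fun j => complex.Im (F j * ((j == k)%:R)^*)) =
    (fun j => complex.Im (F k) * (j == k)%:R).
  apply/funext => j; case: eqP => [->|_]; rewrite ?conjC1 ?conjC0 ?mulr1 ?mulr0//.
by rewrite !rsum_delta; case: (F k).
Qed.

Lemma hnorm_ell2 (F : ell2 R T) :
  hnorm F ^+ 2 = fine (nsum (fun k => normc (F k) ^+ 2)).
Proof. by rewrite hnormE /ip -[hdot _ F F]/(l2_dot F F) l2_dotE. Qed.

End ell2_basis.

Section composition_operators.
Variables (R : realType) (T : choiceType).

Section composition.
Variables (f g : T -> T).
Hypotheses (fK : cancel f g) (gK : cancel g f).

Lemma esum_reindex (a : T -> \bar R) :
  (\esum_(k in [set: T]) a (g k) = \esum_(k in [set: T]) a k)%E.
Proof.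
rewrite -(@esum_image _ _ _ [set: T] g a); last first.
  by move=> i j _ _; exact: (can_inj gK).
congr (esum _ _); apply/seteqP; split=> // k _; by exists (f k).
Qed.

Lemma rsum_reindex (a : T -> R) : rsum (fun k => a (g k)) = rsum a.
Proof.
rewrite /rsum -(esum_reindex (EFin \o a)^\+%E) -(esum_reindex (EFin \o a)^\-%E).
by rewrite -[EFin \o (fun k => a (g k))]/((EFin \o a) \o g) funepos_comp funeneg_comp.
Qed.

Lemma comp_l2 (F : l2 R T) : (fun k => F (g k)) \in @l2_pred R T.
Proof.
by rewrite l2_predE /nsum (esum_reindex (fun k => (normc (F k) ^+ 2)%:E)); exact: l2_sum.
Qed.

(** The unitary induced by the bijection [f] of the index set: coordinates are read through the
    inverse [g], so that [delta p] moves to [delta (f p)]. *)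
Definition comp_op (F : l2 R T) : l2 R T := L2 (comp_l2 F).

Lemma comp_op_linear : linear comp_op.
Proof. by move=> c F G; apply: l2_eq. Qed.

HB.instance Definition _ := GRing.isLinear.Build R[i] (l2 R T) (l2 R T) _
  comp_op comp_op_linear.

End composition.

Definition compL f g (fK : cancel f g) (gK : cancel g f) :
  {linear ell2 R T -> ell2 R T} := comp_op fK gK.

Lemma comp_adjoint f g (fK : cancel f g) (gK : cancel g f) :
  adjoint_op (compL fK gK) (compL gK fK).
Proof.
move=> F G.
rewrite -[LHS]/(csum (fun k => F (g k) * (G k)^*)).
rewrite -[RHS]/(csum (fun k => F k * (G (f k))^*)) /csum.
rewrite -(rsum_reindex fK gK (fun k => complex.Re (F k * (G (f k))^*))).
rewrite -(rsum_reindex fK gK (fun k => complex.Im (F k * (G (f k))^*))).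
by congr Complex; congr rsum; apply/funext => k; rewrite gK.
Qed.

Lemma comp_isometry f g (fK : cancel f g) (gK : cancel g f) F :
  compL gK fK (compL fK gK F) = F.
Proof. by apply: l2_eq => k; rewrite /= fK. Qed.

Lemma scaled_comp_normal f g (fK : cancel f g) (gK : cancel g f) (b : R) :
  normal_op (b%:C%C \*: compL fK gK : {linear ell2 R T -> ell2 R T}).
Proof.
have nrm F : hnorm (compL fK gK F) = hnorm F.
  by rewrite /hnorm /dnorm comp_adjoint comp_isometry.
split; first by exists (normc b%:C%C) => F; rewrite /= hnormZ nrm.
exists (b%:C%C \*: compL gK fK) => [F G|F].
  rewrite -[LHS]/(hdot _ (b%:C%C *: compL fK gK F) G).
  rewrite -[RHS]/(hdot _ F (b%:C%C *: compL gK fK G)).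
  by rewrite linearZl_LR/= linearZr_LR/= comp_adjoint Defs.conjE /= oppr0.
rewrite -[LHS]/(b%:C%C *: compL fK gK (b%:C%C *: compL gK fK F)).
rewrite -[RHS]/(b%:C%C *: compL gK fK (b%:C%C *: compL fK gK F)).
by rewrite !linearZ !comp_isometry.
Qed.

End composition_operators.

Section bilateral_shifts.
Variables (R : realType) (b : R).
Local Notation Z2 := (int * int)%type.

Let right (p : Z2) : Z2 := (p.1 + 1, p.2).
Let left (p : Z2) : Z2 := (p.1 - 1, p.2).
Let up (p : Z2) : Z2 := (p.1, p.2 + 1).
Let down (p : Z2) : Z2 := (p.1, p.2 - 1).

Let rightK : cancel right left.
Proof. by move=> [i j]; rewrite /left /= addrK. Qed.
Let leftK : cancel left right.
Proof. by move=> [i j]; rewrite /right /= subrK. Qed.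
Let upK : cancel up down.
Proof. by move=> [i j]; rewrite /down /= addrK. Qed.
Let downK : cancel down up.
Proof. by move=> [i j]; rewrite /up /= subrK. Qed.

Lemma comp_delta (T : choiceType) (f g : T -> T) (fK : cancel f g) (gK : cancel g f) (p : T) :
  compL R fK gK (delta R p) = delta R (f p).
Proof. by apply: l2_eq => k; rewrite /= -(can_eq fK) gK. Qed.

Lemma iter_scaled_comp (T : choiceType) (f g : T -> T) (fK : cancel f g) (gK : cancel g f)
    (c : R) n (p : T) :
  iter n (c%:C%C \*: compL R fK gK) (delta R p) = (c ^+ n)%:C%C *: delta R (iter n f p).
Proof.
elim: n => [|n IH]; first by rewrite scale1r.
rewrite iterS IH -[LHS]/(c%:C%C *: compL R fK gK _) linearZ /= -/(compL R fK gK _).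
by rewrite scalerA -rmorphM -exprS (comp_delta fK gK).
Qed.

Lemma hdot_deltas (T : choiceType) (p q : T) :
  hdot (ell2 R T) (delta R p) (delta R q) = (p == q)%:R.
Proof. by rewrite hdot_delta /= eq_sym. Qed.

(** A realization of the unit point mass at [(1, b ^+ 2)] in which distinct powers stay orthogonal.
    Indexing by all pairs of integers makes both shifts multiples of unitaries, hence normal. *)
Lemma bilateral_shifts : exists (L : hilbert R) (U1 U2 : {linear L -> L}) (e : L),
  [/\ normal_op U1, normal_op U2, commute_op U1 U2 &
   forall k j k' j', hdot L (iter k U1 (iter j U2 e)) (iter k' U1 (iter j' U2 e)) =
     (b ^+ (j + j') * ((k, j) == (k', j'))%:R)%:C%C].
Proof.
exists (ell2 R Z2), (1%:C%C \*: compL R rightK leftK),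
  (b%:C%C \*: compL R upK downK), (delta R (0, 0)); split.
- exact: scaled_comp_normal.
- exact: scaled_comp_normal.
- move=> F; apply: l2_eq => -[i j].
  rewrite -[LHS]/(1%:C%C * (b%:C%C * F (down (left (i, j))))).
  by rewrite -[RHS]/(b%:C%C * (1%:C%C * F (left (down (i, j))))) !mul1r.
have ir n (i j : int) : iter n right (i, j) = (i + n%:Z, j).
  by elim: n => [|n /= ->]; rewrite ?addr0// /right /= -addrA -PoszD addn1.
have iu n (i j : int) : iter n up (i, j) = (i, j + n%:Z).
  by elim: n => [|n /= ->]; rewrite ?addr0// /up /= -addrA -PoszD addn1.
have E k j : iter k (1%:C%C \*: compL R rightK leftK)
    (iter j (b%:C%C \*: compL R upK downK) (delta R (0, 0))) =
    (b ^+ j)%:C%C *: delta R (k%:Z, j%:Z).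
  rewrite iter_scaled_comp iu add0r.
  rewrite (iter_linZ (1%:C%C \*: compL R rightK leftK : {linear ell2 R _ -> ell2 R _})).
  by rewrite iter_scaled_comp ir add0r expr1n scale1r.
move=> k j k' j'; rewrite !E linearZl_LR/= linearZr_LR/= hdot_deltas.
rewrite Defs.conjE /= oppr0 !xpair_eqE !eqz_nat rmorphM exprD rmorphM /= -mulrA.
by case: (_ && _); rewrite /= ?rmorph0 ?rmorph1.
Qed.

End bilateral_shifts.

Lemma hdot_suml (R : realType) (K : hilbert R) I (r : seq I) (F : I -> K) y :
  hdot K (\sum_(i <- r) F i) y = \sum_(i <- r) hdot K (F i) y.
Proof. by elim/big_rec2: _ => [|i u v _ <-]; rewrite ?linear0l ?linearDl. Qed.

(** * Orthonormal families and isometric embeddings of the sequence space *)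

Section orthonormal.
Variables (R : realType) (T : countType).

(** An increasing exhaustion of [T] by finite lists; codes that no element of [T] has are
    dropped. *)
Definition first_indices n : seq T := pmap (@pickle_inv T) (iota 0 n).

Lemma first_indices_uniq n : uniq (first_indices n).
Proof. exact: (pmap_uniq (@pickle_invK T)) (iota_uniq _ _). Qed.

Lemma mem_first_indices n k : (k \in first_indices n) = (pickle k < n)%N.
Proof.
rewrite mem_pmap; apply/mapP/idP => [|kn].
  by case=> i; rewrite mem_iota /= add0n => ni ki; have := @pickle_invK T i; rewrite -ki /= => ->.
by exists (pickle k); [rewrite mem_iota|rewrite pickleK_inv].
Qed.

Section combination.
Variables (K : hilbert R) (u : T -> K).
Hypothesis uo : forall k l, hdot K (u k) (u l) = (k == l)%:R.

Definition partial_comb (c : T -> R[i]) n : K := \sum_(k <- first_indices n) c k *: u k.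

Lemma hdot_partial_comb (c : T -> R[i]) n k : (pickle k < n)%N ->
  hdot K (partial_comb c n) (u k) = c k.
Proof.
rewrite -mem_first_indices /partial_comb hdot_suml => kn.
rewrite (bigD1_seq k) ?first_indices_uniq//= big1 ?addr0.
  by rewrite linearZl_LR/= uo eqxx mulr1.
by move=> i /negPf ik; rewrite linearZl_LR/= uo ik mulr0.
Qed.

Lemma ip_partial_comb (c : T -> R[i]) n :
  ip (partial_comb c n) (partial_comb c n) = \sum_(k <- first_indices n) normc (c k) ^+ 2.
Proof.
rewrite {2}/partial_comb ipC ip_suml big_seq [RHS]big_seq; apply: eq_bigr => k.
rewrite mem_first_indices => kn; rewrite ipC /ip linearZr_LR/= hdot_partial_comb//.
by rewrite sqr_normcE Defs.conjE Defs.ReM /=; ring.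
Qed.

Lemma partial_comb_widen (c : T -> R[i]) m n : (m <= n)%N ->
  partial_comb c m = partial_comb (fun k => if (pickle k < m)%N then c k else 0) n.
Proof.
move=> mn; rewrite /partial_comb.
rewrite [RHS](eq_bigr (fun k => if (pickle k < m)%N then c k *: u k else 0)); last first.
  by move=> k _; case: ifP => //; rewrite scale0r.
rewrite -big_mkcond -big_filter; apply: perm_big; apply: uniq_perm.
- exact: first_indices_uniq.
- by rewrite filter_uniq// first_indices_uniq.
- move=> k; rewrite mem_filter !mem_first_indices.
  by case: ltnP => //= km; rewrite (leq_trans km mn).
Qed.

Lemma partial_combD z (c d : T -> R[i]) n :
  partial_comb (fun k => z * c k + d k) n = z *: partial_comb c n + partial_comb d n.
Proof.
rewrite scaler_sumr -big_split; apply: eq_bigr => k _.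
by rewrite scalerDl scalerA.
Qed.

(** The right side does not mention [u]: partial sums along any orthonormal family are as far apart
    as those along the deltas, so the Cauchy property transfers from the latter. *)
Lemma ip_partial_comb_diff (c : T -> R[i]) m n :
  ip (partial_comb c m - partial_comb c n) (partial_comb c m - partial_comb c n) =
  \sum_(k <- first_indices (maxn m n)) normc (- 1 *
     (if (pickle k < n)%N then c k else 0) + (if (pickle k < m)%N then c k else 0)) ^+ 2.
Proof.
rewrite (partial_comb_widen c (leq_maxl m n)) (partial_comb_widen c (leq_maxr m n)).
by rewrite addrC -scaleN1r -partial_combD ip_partial_comb.
Qed.

End combination.

Implicit Types F G : ell2 R T.

Let del := @delta R T.

Let del_orth k l : hdot (ell2 R T) (del k) (del l) = (k == l)%:R.
Proof. exact: hdot_deltas. Qed.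

Lemma ip_delta_comb F n : ip F (partial_comb del F n) =
  \sum_(k <- first_indices n) normc (F k) ^+ 2.
Proof.
rewrite ipC ip_suml; apply: eq_bigr => k _.
by rewrite ipC /ip linearZr_LR/= hdot_delta sqr_normcE Defs.conjE Defs.ReM /=; ring.
Qed.

Lemma partial_sum_adherent F (e : R) : 0 < e -> exists N, forall n, (N <= n)%N ->
  ip F F - e < \sum_(k <- first_indices n) normc (F k) ^+ 2.
Proof.
move=> e0; have : ((ip F F - e)%:E < nsum (fun k => (normc (F k) ^+ 2)%R))%E.
  rewrite -hnormE hnorm_ell2 -[ltRHS]fineK.
    by rewrite lte_fin ltrBlDr ltrDl.
  by rewrite nsum_fin ?l2_sum// => k; rewrite sqr_ge0.
move=> /ereal_sup_gt[_ [X [finX _] <-]].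
rewrite fsbig_finite//= sumEFin lte_fin.
have : uniq (finmap.enum_fset (fset_set X)) := finmap.fset_uniq _.
move: (finmap.enum_fset _) => r ur lt.
exists (\max_(k <- r) pickle k).+1 => n Nn.
apply: (lt_le_trans lt).
have sub k : k \in r -> k \in first_indices n.
  rewrite mem_first_indices => kr; rewrite (leq_trans _ Nn)// ltnS.
  exact: (@leq_bigmax_seq _ _ _ (fun k : T => pickle k)).
have -> : \sum_(k <- r) normc (F k) ^+ 2 =
    \sum_(k <- first_indices n | k \in r) normc (F k) ^+ 2.
  rewrite -[RHS]big_filter; apply: perm_big; apply: uniq_perm => //.
    by rewrite filter_uniq// first_indices_uniq.
  by move=> k; rewrite mem_filter; case: (boolP (k \in r)) => //= /sub ->.
rewrite big_mkcond; apply: ler_sum => k _.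
by case: ifP => // _; rewrite sqr_ge0.
Qed.

Lemma partial_comb_cvg F : hcvg (partial_comb del F) F.
Proof.
move=> e e0; have [|N FN] := @partial_sum_adherent F (e ^+ 2); first exact: exprn_gt0.
exists N => n /FN lt; rewrite -(@ltr_pXn2r _ 2)// ?nnegrE ?hnorm_ge0 ?ltW//.
rewrite hnormE ipBl !ipBr (ip_partial_comb del_orth) ip_delta_comb ipC ip_delta_comb.
by lra.
Qed.

Lemma eq_on_deltas (K : hilbert R) (A B : {linear ell2 R T -> K}) (a b : R) :
  (forall F, hnorm (A F) <= a * hnorm F) -> (forall F, hnorm (B F) <= b * hnorm F) ->
  (forall k, A (del k) = B (del k)) -> forall F, A F = B F.
Proof.
move=> Aa Bb AB F; have cF := @partial_comb_cvg F.
apply: hcvg_unique (hcvg_bounded Aa cF) _.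
rewrite (_ : (fun _ => _) = fun n => B (partial_comb del F n)).
  exact: hcvg_bounded Bb cF.
by apply/funext => n; rewrite !linear_sum; apply: eq_bigr => k _; rewrite !linearZ /= AB.
Qed.

Lemma orthonormal_embedding (K : hilbert R) (u : T -> K) :
  (forall k l, hdot K (u k) (u l) = (k == l)%:R) ->
  exists V : {linear ell2 R T -> K}, isometric V /\ forall k, V (del k) = u k.
Proof.
move=> uo.
have cauchy F : exists l, hcvg (partial_comb u F) l.
  apply: hilbert_complete => e e0.
  have [N FN] := @partial_comb_cvg F (e / 2) (divr_gt0 e0 (ltr0Sn _ _)).
  exists N => m n Nm Nn; rewrite -/(hnorm _).
  have -> : hnorm (partial_comb u F m - partial_comb u F n) =
      hnorm (partial_comb del F m - partial_comb del F n).
    apply/eqP; rewrite -(@eqrXn2 _ 2)// ?hnorm_ge0// !hnormE.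
    by rewrite (ip_partial_comb_diff uo) (ip_partial_comb_diff del_orth).
  rewrite [X in hnorm X](_ : _ = (partial_comb del F m - F) - (partial_comb del F n - F)).
    rewrite (le_lt_trans (hnormD _ _))// hnormN [ltRHS]splitr.
    by rewrite ltrD ?FN.
  by rewrite opprB addrA subrK.
pose V F := sval (cid (cauchy F)).
have VP F : hcvg (partial_comb u F) (V F) by rewrite /V; case: cid.
have Vlin : linear V.
  move=> c F G; apply: hcvg_unique (VP _) _.
  rewrite (_ : partial_comb u _ = fun n => c *: partial_comb u F n + partial_comb u G n).
    apply: hcvgD; last exact: VP.
    apply: (@hcvg_bounded _ _ _ (c \*: idfun : {linear K -> K}) (normc c)); last exact: VP.
    by move=> x; rewrite /= hnormZ.
  by apply/funext => n; rewrite -partial_combD.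
pose VL := HB.pack_for {linear ell2 R T -> K} V
  (GRing.isLinear.Build R[i] (ell2 R T) K _ V Vlin).
exists VL; split.
  apply: isometric_of_norm => F; apply/eqP; rewrite -(@eqrXn2 _ 2)// ?hnorm_ge0// !hnormE.
  have c1 := hcvg_ip (VP F) (VP F).
  have c2 := hcvg_ip (@partial_comb_cvg F) (@partial_comb_cvg F).
  rewrite -(cvg_lim (@Rhausdorff R) c1) -(cvg_lim (@Rhausdorff R) c2).
  apply/eqP; congr (limn _); apply/funext => n.
  by rewrite (ip_partial_comb uo) (ip_partial_comb del_orth).
move=> k; apply: hcvg_unique (VP _) _ => e e0; exists (pickle k).+1 => n kn.
rewrite (_ : partial_comb _ _ _ = u k) ?subrr ?hnorm0//.
rewrite /partial_comb (bigD1_seq k) ?first_indices_uniq ?mem_first_indices//=.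
rewrite eqxx scale1r big1 ?addr0// => i /negPf ik.
by rewrite ik scale0r.
Qed.

End orthonormal.

(** * Construction of the normal extension *)

Section spectral_density.
Variables (R : realType) (K : hilbert R) (N S : {linear K -> K}).
Hypotheses (NS : adjoint_op N S) (NSc : commute_op N S) (Nb : bounded_op N).
Variables (m : {finite_measure set R -> \bar R}) (M a : R) (h : K).
Hypotheses (M0 : 0 < M) (a0 : 0 < a) (aM : a <= M).
Hypothesis mom : forall k,
  ip (iter k N h) (iter k N h) = \int[m]_(s in `[0, M]) s ^+ k.
Hypothesis orth : forall j k, j != k -> hdot K (iter j N h) (iter k N h) = 0.

Let A : {linear K -> K} := S \o N.

Let Asym : forall u v, ip (A u) v = ip u (A v).
Proof. exact: (modulus_sym NS). Qed.

Let momA k : ip (iter k A h) h = \int[m]_(s in `[0, M]) s ^+ k.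
Proof. by rewrite (ip_iter_modulus NS NSc) mom. Qed.

Lemma iter_pact k p u : iter k N (pact A p u) = pact A p (iter k N u).
Proof.
have NA z : N (A z) = A (N z) by exact: (modulus_comm NSc).
elim: k => //= k ->; rewrite /pact linear_sum; apply: eq_bigr => i _.
by rewrite linearZ /= (iter_comm i (iter k N u) NA).
Qed.

Lemma hdot_iter_modulus n u v :
  hdot K (iter n A u) v = hdot K (iter n N u) (iter n N v).
Proof. by rewrite !hdotE -iter_linZ !(ip_iter_modulus NS NSc) iter_linZ. Qed.

Lemma hdot_iter_sym n u v : hdot K (iter n A u) v = hdot K u (iter n A v).
Proof. by rewrite !hdotE -iter_linZ !(ip_iter Asym). Qed.

(** Powers of [A] only raise both exponents equally: [A^i N^j h] against [A^l N^k h] gives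
    [N^(i+l+j) h] against [N^(i+l+k) h]. *)
Lemma orth_pact p j k : j != k ->
  hdot K (iter j N (pact A p h)) (iter k N (pact A p h)) = 0.
Proof.
move=> jk.
have z i l : hdot K (iter i A (iter j N h)) (iter l A (iter k N h)) = 0.
  rewrite hdot_iter_sym -iterD -hdot_iter_sym hdot_iter_modulus -!iterD orth//.
  by rewrite eqn_add2l.
rewrite !iter_pact /pact hdot_suml big1// => i _.
rewrite linearZl_LR/= hdotC hdot_suml big1 ?conjC0 ?mulr0// => l _.
by rewrite linearZl_LR/= hdotC z conjC0 mulr0.
Qed.

Variables (c d : R).
Hypotheses (d0 : 0 <= d) (dm : d <= fine (m [set 0])).
Hypotheses (c0 : 0 <= c) (cm : c <= fine (m [set a])).

(* [h1] is [G(A) h], a limit of polynomials in [A] applied to [h], where [G] is 1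
   except at 0 and [a], at which [G ^+ 2] scales the atoms down by [d] and [c]. *)
Lemma spectral_density : exists h1 : K,
  (forall j k, j != k -> hdot K (iter j N h1) (iter k N h1) = 0) /\
  forall k, ip (iter k N h1) (iter k N h1) =
    \int[m]_(s in `[0, M]) s ^+ k - 0 ^+ k * d - a ^+ k * c.
Proof.
(* Here [(1 + t) ^+ 2] scales a mass [x] down to [x - y]. If [x = 0] then [y = 0], and the equation
   holds whatever [t] is. *)
have weight (x y : R) : 0 <= y <= x -> exists t, (2 * t + t ^+ 2) * x = - y.
  move=> /andP[y0 yx]; exists (Num.sqrt (1 - y / x) - 1).
  have [x0|x0] := eqVneq x 0.
    have -> : y = 0 by apply/eqP; rewrite eq_le y0 andbT -x0.
    by rewrite x0 mulr0 oppr0.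
  have xp : 0 < x by rewrite lt_neqAle eq_sym x0 (le_trans y0 yx).
  have s0 : 0 <= 1 - y / x by rewrite subr_ge0 ler_pdivrMr// mul1r.
  have -> : 2 * (Num.sqrt (1 - y / x) - 1) + (Num.sqrt (1 - y / x) - 1) ^+ 2 =
    Num.sqrt (1 - y / x) ^+ 2 - 1 by ring.
  by rewrite sqr_sqrtr//; field.
have [t0 t0E] := weight (fine (m [set 0])) d (introT andP (conj d0 dm)).
have [t1 t1E] := weight (fine (m [set a])) c (introT andP (conj c0 cm)).
pose P n := 1 + t0 *: bump_at 0 M n + t1 *: bump_at a M n.
pose G (s : R) := 1 + t0 * (s == 0)%:R + t1 * (s == a)%:R : R.
have PE n s : (P n).[s] = 1 + t0 * (bump_at 0 M n).[s] + t1 * (bump_at a M n).[s].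
  by rewrite !hornerD !hornerZ hornerC.
have zM : 0 <= (0 : R) <= M by rewrite lexx ltW.
have aM' : 0 <= a <= M by rewrite ltW.
pose B := 1 + `|t0| + `|t1|.
have B0 : 0 <= B by rewrite !addr_ge0.
have bnd (x y : R) : 0 <= x <= 1 -> 0 <= y <= 1 -> `|1 + t0 * x + t1 * y| <= B.
  move=> /andP[x0 x1] /andP[y0 y1].
  rewrite (le_trans (ler_normD _ _))// lerD// ?(le_trans (ler_normD _ _))//.
    by rewrite normr1 lerD2l normrM ler_piMr// ger0_norm.
  by rewrite normrM ler_piMr// ger0_norm.
have PB n s : 0 <= s <= M -> `|(P n).[s]| <= B.
  by move=> sM; rewrite PE bnd//; apply: bump_at_01 => //; exact: itv_dist.
have GB s : `|G s| <= B by rewrite /G bnd//; case: eqP; rewrite ?ler01 ?lexx.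
have PG s : 0 <= s <= M -> (P n).[s] @[n --> \oo] --> G s.
  move=> sM; under eq_fun do rewrite PE.
  by apply: cvgD; [apply: cvgD; first exact: cvg_cst|]; apply: cvgMl_tmp;
    apply: bump_at_cvg => //; exact: itv_dist.
have bG : bdm `[0, M] G.
  split; last by exists B => s _.
  apply: measurable_funD; first apply: measurable_funD => //;
    by apply: measurable_funM => //; exact: measurable_eq_fun.
have bPG n : bdm `[0, M] (fun s => ((P n).[s] - G s) ^+ 2).
  by apply: bdmX; apply: bdmB => //; exact: bdm_horner.
pose v n := pact A (P n) h.
(* The squared distance of [P n] to [G] in the space of square integrable functions. It tends to 0,
   and [vv] carries this over to the Cauchy property of [v]. *)
pose del n := \int[m]_(s in `[0, M]) ((P n).[s] - G s) ^+ 2.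
have del0 : del n @[n --> \oo] --> (0 : R).
  rewrite -[X in _ --> X](_ : \int[m]_(s in `[0, M]) (cst 0 s) = 0); last first.
    by rewrite Rintegral_cst// mul0r.
  apply: (@bounded_cvg_Rintegral _ _ _ _ _ _ _ _ ((B + B) ^+ 2)) => //.
  - by move=> n; have [] := bPG n.
  - move=> n s /=; rewrite in_itv/= => sM; rewrite normrX lerXn2r ?nnegrE ?addr_ge0//.
    by rewrite (le_trans (ler_normB _ _))// lerD// PB.
  - move=> s /=; rewrite in_itv/= => sM.
    have z : (P n).[s] - G s @[n --> \oo] --> (0 : R).
      by rewrite -(subrr (G s)); apply: cvgB; [exact: PG|exact: cvg_cst].
    have zz : ((P n).[s] - G s) * ((P n).[s] - G s) @[n --> \oo] --> (0 * 0 : R).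
      exact: cvgM.
    by rewrite mulr0 in zz; under eq_fun do rewrite expr2; exact: zz.
have vv n k : ip (v n - v k) (v n - v k) <= 2 * del n + 2 * del k.
  rewrite /v -pactB (ip_pact2_integral Asym momA) /del.
  have i1 j := bdm_integrable (measurable_itv `[0, M]) m (bPG j).
  rewrite -!RintegralZl// -RintegralD//; last 2 first.
  - by apply: bdm_integrable => //; apply: bdmM => //; exact: bdm_cst.
  - by apply: bdm_integrable => //; apply: bdmM => //; exact: bdm_cst.
  apply: le_Rintegral => //.
  - by apply: bdm_integrable => //; exact: bdm_horner.
  - by apply: bdm_integrable => //; apply: bdmD; apply: bdmM => //; exact: bdm_cst.
  move=> s _; rewrite hornerM hornerD hornerN.
  have := sqr_ge0 ((P n).[s] - G s + ((P k).[s] - G s)); lra.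
have [h1 vh1] : exists h1, hcvg v h1.
  apply: hilbert_complete => e e0.
  have e4 : 0 < e ^+ 2 / 4 by rewrite divr_gt0// exprn_gt0.
  have /cvgrPdist_lt/(_ _ e4)[N0 _ HN] := del0.
  have lt n : (N0 <= n)%N -> del n < e ^+ 2 / 4.
    move=> /HN; rewrite sub0r normrN ger0_norm//.
    by apply: Rintegral_ge0 => s _; exact: sqr_ge0.
  exists N0 => n k Nn Nk; rewrite -/(hnorm _).
  rewrite -(@ltr_pXn2r _ 2)// ?nnegrE ?hnorm_ge0 ?ltW// hnormE.
  rewrite (le_lt_trans (vv n k))//.
  by have := lt n Nn; have := lt k Nk; lra.
have cv k := hcvg_iter k Nb vh1.
exists h1; split=> [j k jk|k].
  have z (x y : nat -> K) : (forall n, ip (x n) (y n) = 0) -> forall l l', hcvg x l -> hcvg y l' ->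
      ip l l' = 0.
    move=> xy l l' xl yl; rewrite -(cvg_lim (@Rhausdorff R) (hcvg_ip xl yl)).
    apply: cvg_lim; first exact: Rhausdorff.
    by under eq_fun do rewrite xy; exact: cvg_cst.
  have o n : hdot K (iter j N (v n)) (iter k N (v n)) = 0 by exact: orth_pact.
  rewrite hdotE (z _ _ _ _ _ (cv j) (cv k)); last by move=> n; rewrite /ip o.
  rewrite (z (fun n => Complex 0 (-1) *: iter j N (v n)) (fun n => iter k N (v n)))//.
    by move=> n; rewrite -Im_hdot o.
  apply: (@hcvg_bounded _ _ _ (Complex 0 (-1) \*: idfun : {linear K -> K}) (normc (Complex 0 (-1)))); last exact: cv.
  by move=> x; rewrite /= hnormZ.
have c1 := hcvg_ip (cv k) (cv k).
have vE n : ip (iter k N (v n)) (iter k N (v n)) =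
    \int[m]_(s in `[0, M]) (s ^+ k * ((P n).[s] * (P n).[s])).
  rewrite -(ip_iter_modulus NS NSc) -/A.
  have -> : iter k A (v n) = pact A ('X^k * P n) h.
    rewrite pactM -[pact A (P n) h]/(v n).
    elim: k {cv c1} => [|k IH]; first by rewrite expr0 pact1.
    by rewrite exprS mulrC pactMX -pact_comm -IH.
  rewrite (ip_pact2_integral Asym momA); apply: eq_Rintegral => s _.
  by rewrite !hornerM hornerXn mulrA.
rewrite -(cvg_lim (@Rhausdorff R) c1); apply: cvg_lim; first exact: Rhausdorff.
under eq_fun do rewrite vE.
(* The cross term drops out because 0 and [a] are distinct points. *)
have GE s : s ^+ k * (G s * G s) = s ^+ k + ((2 * t0 + t0 ^+ 2) * 0 ^+ k) * (s == 0)%:R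
    + ((2 * t1 + t1 ^+ 2) * a ^+ k) * (s == a)%:R.
  rewrite /G; have [->|s0] := eqVneq s 0.
    by rewrite lt_eqF//=; ring.
  by have [->|sa] := eqVneq s a; rewrite /=; ring.
have b1 (x : R) : bdm `[0, M] (fun s : R => (s == x)%:R : R).
  split; first exact: measurable_eq_fun.
  by exists 1 => s _; case: eqP; rewrite ?normr1 ?normr0.
have bk : bdm `[0, M] (fun s : R => s ^+ k) by apply: bdmX; exact: bdm_id.
have -> : \int[m]_(s in `[0, M]) s ^+ k - 0 ^+ k * d - a ^+ k * c =
    \int[m]_(s in `[0, M]) (s ^+ k * (G s * G s)).
  under [RHS]eq_Rintegral do rewrite GE.
  have bc (x y : R) : bdm `[0, M] (fun s : R => x * (s == y)%:R).
    exact: (bdmM (@bdm_cst _ _ _ _ x) (b1 y)).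
  rewrite !RintegralD//; try by apply: bdm_integrable => //; try exact: bdmD.
  rewrite !RintegralZl//; try by exact: bdm_integrable.
  rewrite !Rintegral_atom// -[d]opprK -[c]opprK -t0E -t1E; ring.
apply: (@bounded_cvg_Rintegral _ _ _ _ _ _ _ _ (M ^+ k * (B * B))) => //.
- by move=> n; have [] : bdm `[0, M] (fun s => s ^+ k * ((P n).[s] * (P n).[s]));
    [apply: bdmM => //; apply: bdmM; exact: bdm_horner|].
- by have [] : bdm `[0, M] (fun s => s ^+ k * (G s * G s)); [apply: bdmM => //; exact: bdmM|].
- move=> n s /=; rewrite in_itv/= => /[dup] sM /andP[s0 sM'].
  rewrite !normrM; apply: ler_pM; rewrite ?mulr_ge0//; last by apply: ler_pM; rewrite ?PB.
  by rewrite normrX ger0_norm// lerXn2r// nnegrE ltW.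
- move=> s /=; rewrite in_itv/= => sM; apply: cvgMl_tmp; apply: cvgM; exact: PG.
Qed.

End spectral_density.

Section subnormal_bounded.
Variables (R : realType) (H : hilbert R).

Lemma isometric_hnorm (K : hilbert R) (V : {linear H -> K}) : isometric V ->
  forall x, hnorm (V x) = hnorm x.
Proof. by move=> Vi x; rewrite /hnorm /dnorm Vi. Qed.

Lemma subnormal_bounded (T : {linear H -> H}) : subnormal T -> bounded_op T.
Proof.
move=> [K [N [V [[[M NM] _] Vi NV]]]]; exists M => x.
by rewrite -!(isometric_hnorm Vi) -NV.
Qed.

End subnormal_bounded.

Lemma conjC_real_complex (R : realType) (t : R) : (t%:C%C)^* = t%:C%C :> R[i].
Proof. by rewrite Defs.conjE /= oppr0. Qed.

Lemma iter_zero (V : zmodType) (f : V -> V) j v : (forall x, f x = 0) ->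
  iter j f v = if j == 0%N then v else 0.
Proof. by move=> f0; case: j => //= j; rewrite f0. Qed.

(** * The flat shift: its moments, and subnormality in terms of atoms *)

Section flat_shift.
Variable R : realType.
Variables (alpha beta : weights R (nat * nat)) (x y : weights R nat) (a b : R).
Variables (xi eta : probability R R).
Hypotheses (a_gt0 : 0 < a) (b_gt0 : 0 < b).
Hypothesis T_H0 : class_H0 (wshift1 alpha) (wshift2 beta).
Hypothesis alpha_x : forall k1, alpha (k1, 0%N) = x k1.
Hypothesis beta_y : forall k2, beta (0%N, k2) = y k2.
Hypothesis alpha_a : alpha (0%N, 1%N) = a.
Hypothesis alpha_1 : forall k1 k2, (1 <= k1)%N -> (1 <= k2)%N -> alpha (k1, k2) = 1.
Hypothesis beta_b : forall k1 k2, (1 <= k1)%N -> (1 <= k2)%N -> beta (k1, k2) = b.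
Hypothesis xi_berger : is_berger x xi.
Hypothesis eta_berger : is_berger y eta.

Local Notation T1 := (wshift1 alpha).
Local Notation T2 := (wshift2 beta).
Local Notation e := (@ebasis R).

(** The norm of [T1^k T2^j e_(0,0)]: the path climbs the column of index 0, then follows row [j]. *)
Definition path_weight (k j : nat) : R :=
  (\prod_(i < k) alpha (i : nat, j)) * \prod_(i < j) y i.

Local Notation w := path_weight.

Lemma path_weight_gt0 k j : 0 < w k j.
Proof. by rewrite mulr_gt0// prodr_gt0// => i _; exact: weight_gt0. Qed.

Lemma iter_shifts k j :
  iter k T1 (iter j T2 (e (0%N, 0%N))) = (w k j)%:C%C *: e (k, j).
Proof.
have -> : iter j T2 (e (0%N, 0%N)) = (\prod_(i < j) y i)%:C%C *: e (0%N, j).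
  elim: j => [|j IH]; first by rewrite big_ord0 scale1r.
  by rewrite iterS IH linearZ /= wshift2E beta_y scalerA -rmorphM big_ord_recr.
rewrite iter_linZ; have -> : iter k T1 (e (0%N, j)) = (\prod_(i < k) alpha (i : nat, j))%:C%C *: e (k, j).
  elim: k => [|k IH]; first by rewrite big_ord0 scale1r.
  by rewrite iterS IH linearZ /= wshift1E scalerA -rmorphM big_ord_recr.
by rewrite scalerA -rmorphM mulrC.
Qed.

Lemma hdot_ebasis k l : hdot (ell2Z R) (e k) (e l) = (k == l)%:R.
Proof.
have E i : e i = delta R i by exact: l2_eq.
by rewrite !E hdot_deltas.
Qed.

Lemma hdot_iter_shifts k j k' j' :
  hdot (ell2Z R) (iter k T1 (iter j T2 (e (0%N, 0%N))))
    (iter k' T1 (iter j' T2 (e (0%N, 0%N)))) =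
  (w k j * w k' j' * ((k, j) == (k', j'))%:R)%:C%C.
Proof.
rewrite !iter_shifts hdotZl hdotZr hdot_ebasis.
by rewrite conjC_real_complex mulrA -!rmorphM [RHS]rmorphM; congr (_ * _); case: (_ == _).
Qed.

Lemma ip_iter_shifts k j :
  ip (iter k T1 (iter j T2 (e (0%N, 0%N)))) (iter k T1 (iter j T2 (e (0%N, 0%N)))) =
  w k j ^+ 2.
Proof. by rewrite /ip hdot_iter_shifts eqxx mulr1 /= expr2. Qed.

Lemma ebasis_inj_scale (s t : R) k : s%:C%C *: e k = t%:C%C *: e k -> s = t.
Proof.
move=> /(congr1 (fun F : l2 R (nat * nat)%type => F k)).
rewrite -[(s%:C%C *: e k : l2 _ _) k]/(s%:C%C * (k == k)%:R).
by rewrite -[(t%:C%C *: e k : l2 _ _) k]/(t%:C%C * (k == k)%:R) eqxx !mulr1 => -[].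
Qed.

Lemma path_weightS1 k j : w k.+1 j = w k j * alpha (k, j).
Proof. by rewrite /path_weight big_ord_recr/= mulrAC. Qed.

(** The path climbs before it turns right, so a last step upwards requires commutation of [T1] and
    [T2]. *)
Lemma path_weightS2 k j : w k j.+1 = w k j * beta (k, j).
Proof.
have [T12 _ _] := T_H0.
apply: (@ebasis_inj_scale _ _ (k, j.+1)).
rewrite -iter_shifts iterS -iter_comm; last by move=> z; rewrite T12.
by rewrite iter_shifts linearZ /= wshift2E scalerA -rmorphM.
Qed.

Local Notation c := (a ^+ 2 * y 0%N ^+ 2 / b ^+ 2).

Lemma c_gt0 : 0 < c.
Proof. by rewrite divr_gt0 ?mulr_gt0 ?exprn_gt0 ?weight_gt0. Qed.

(** The value at [(1, 1)] is [a^2 y0^2 = c b^2]; a step to the right then multiplies by 1 and a step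
    up by [b^2]. These are the moments of the mass [c] at [(1, b^2)]. *)
Lemma path_weight_sqr k j : (0 < k)%N -> (0 < j)%N -> w k j ^+ 2 = c * b ^+ (2 * j).
Proof.
case: k => // k _; elim: k j => [|k IH] [|j] // _.
  suff -> : w 1 j.+1 = y 0%N * a * b ^+ j.
    by rewrite mulnS exprD 2!exprMn -exprM mulnC; field; rewrite gt_eqF.
  elim: j => [|j IH]; last by rewrite path_weightS2 IH beta_b// exprS; ring.
  by rewrite /path_weight !big_ord_recl !big_ord0 /= alpha_a; ring.
by rewrite path_weightS1 alpha_1// mulr1 IH.
Qed.

Lemma path_weight_row k : w k 0 ^+ 2 = \prod_(i < k) x i ^+ 2.
Proof.
rewrite /path_weight big_ord0 mulr1 -prodrXl.
by apply: eq_bigr => i _; rewrite alpha_x.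
Qed.

Lemma path_weight_column j : w 0 j ^+ 2 = \prod_(i < j) y i ^+ 2.
Proof. by rewrite /path_weight big_ord0 mul1r -prodrXl. Qed.

Lemma common_support : exists M, [/\ 1 <= M, b ^+ 2 <= M,
  xi (~` `[0, M]%classic) = 0%E /\
    forall k, \int[xi]_(s in `[0, M]) s ^+ k = w k 0 ^+ 2 &
  eta (~` `[0, M]%classic) = 0%E /\
    forall k, \int[eta]_(s in `[0, M]) s ^+ k = w 0 k ^+ 2].
Proof.
have [M1 xiP] := berger_moment xi_berger.
have [M2 etaP] := berger_moment eta_berger.
exists (Num.max (Num.max 1 (b ^+ 2)) (Num.max M1 M2)); split.
- by rewrite !le_max lexx.
- by rewrite !le_max lexx orbT.
- have [|A B] := xiP (Num.max (Num.max 1 (b ^+ 2)) (Num.max M1 M2)).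
    by rewrite !le_max lexx !orbT.
  by split=> // k; rewrite path_weight_row B.
- have [|A B] := etaP (Num.max (Num.max 1 (b ^+ 2)) (Num.max M1 M2)).
    by rewrite !le_max lexx !orbT.
  by split=> // k; rewrite path_weight_column B.
Qed.

Definition atom_conditions : Prop := [/\ c <= fine (eta [set b ^+ 2]),
  c <= fine (xi [set 1]) & 1 <= fine (xi [set 0]) + fine (eta [set 0]) + c].

Lemma subnormal_atoms : subnormal_pair T1 T2 -> atom_conditions.
Proof.
move=> [K [N1 [N2 [V [[N1b [S1 NS1 NSc1]] [N2b [S2 NS2 NSc2]] N12 Vi NV]]]]].
have [C C0 NC] := bounded_op_sqr N2b.
have [M [M1 bM [_ xiE] [_ etaE]]] := common_support.
have itV k j : iter k N1 (iter j N2 (V (e (0%N, 0%N)))) =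
    V (iter k T1 (iter j T2 (e (0%N, 0%N)))).
  elim: k => [|k /= ->]; last by rewrite (NV _).1.
  by elim: j => [|j /= ->]//; rewrite (NV _).2.
have Vip z : ip (V z) (V z) = ip z z by rewrite /ip Vi.
apply: (joint_atoms NS1 NSc1 NS2 NSc2 N12 C0 NC (h := V (e (0%N, 0%N))) b_gt0 c_gt0 M1 bM).
- by rewrite -[V _]/(iter 0 N1 (iter 0 N2 (V (e (0%N, 0%N))))) itV Vip ip_iter_shifts /path_weight !big_ord0 mulr1 expr1n.
- by move=> k; rewrite -[V _]/(iter 0 N2 (V (e (0%N, 0%N)))) itV Vip ip_iter_shifts xiE.
- by move=> j; rewrite -[iter j _ _]/(iter 0 N1 (iter j N2 _)) itV Vip ip_iter_shifts etaE.
- by move=> k j k0 j0; rewrite itV Vip ip_iter_shifts path_weight_sqr.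
Qed.

(* The extension acts on [K1 (+) l2(Z x Z) (+) K2]: the first and last summands
   carry the rest of [xi] on the first axis and of [eta] on the second, and the
   bilateral shifts of weights 1 and [b] account for the mass [c] at [(1, b ^+ 2)]. *)
Lemma atoms_subnormal : atom_conditions -> subnormal_pair T1 T2.
Proof.
move=> [C1 C2 C3].
have [M [M1 bM [_ xiE] [_ etaE]]] := common_support.
have M0 : 0 < M by apply: lt_le_trans M1.
have [T12 sub1 sub2] := T_H0.
have [K1 [N1 [V1 [nN1 V1i NV1]]]] := sub1.
have [K2 [N2 [V2 [nN2 V2i NV2]]]] := sub2.
have [L [U1 [U2 [l [nU1 nU2 U12 lE]]]]] := bilateral_shifts b.
have it1 k : iter k N1 (V1 (e (0%N, 0%N))) = V1 (iter k T1 (iter 0 T2 (e (0%N, 0%N)))).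
  by elim: k => //= k ->; rewrite NV1.
have it2 j : iter j N2 (V2 (e (0%N, 0%N))) = V2 (iter 0 T1 (iter j T2 (e (0%N, 0%N)))).
  by elim: j => //= j ->; rewrite NV2.
have b2 : 0 < b ^+ 2 by rewrite exprn_gt0.
have c0 := ltW c_gt0.
have eta_atoms : fine (eta [set 0]) + fine (eta [set b ^+ 2]) <= 1.
  rewrite -lee_fin EFinD !fineK ?fin_num_measure// -measureU//; last first.
    by apply/seteqP; split=> // s /= [-> /eqP]; rewrite lt_eqF.
  by rewrite probability_le1//; exact: measurableU.
have [N1b [S1 NS1 NSc1]] := nN1; have [N2b [S2 NS2 NSc2]] := nN2.
(* The column piece gives up its whole atom at 0, and [d] is what the row piece must give up there
   for the three pieces to have total mass 1. It is nonnegative by [eta_atoms] and [C1], and at most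
   the mass of [xi] at 0 by [C3]. *)
pose d := 1 - fine (eta [set 0]) - c.
have [h1 [ort1 ip1]] : exists h1 : K1,
    (forall j k, j != k -> hdot K1 (iter j N1 h1) (iter k N1 h1) = 0) /\
    forall k, ip (iter k N1 h1) (iter k N1 h1) = w k 0 ^+ 2 - 0 ^+ k * d - 1 ^+ k * c.
  have [| | | |h1 [ort1 ip1]] := @spectral_density _ K1 N1 S1 NS1 NSc1 N1b xi M 1
    (V1 (e (0%N, 0%N))) M0 ltr01 M1 _ _ c d _ _ c0 C2.
  - by move=> k; rewrite it1 /ip V1i -/(ip _ _) ip_iter_shifts xiE.
  - move=> j k jk; rewrite !it1 V1i hdot_iter_shifts xpair_eqE (negPf jk) mulr0//.
  - by rewrite /d; lra.
  - by rewrite /d; lra.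
  by exists h1; split=> // k; rewrite ip1 xiE.
have [h2 [ort2 ip2]] : exists h2 : K2,
    (forall j k, j != k -> hdot K2 (iter j N2 h2) (iter k N2 h2) = 0) /\
    forall k, ip (iter k N2 h2) (iter k N2 h2) =
      w 0 k ^+ 2 - 0 ^+ k * fine (eta [set 0]) - (b ^+ 2) ^+ k * c.
  have [| | |h2 [ort2 ip2]] := @spectral_density _ K2 N2 S2 NS2 NSc2 N2b eta M (b ^+ 2)
    (V2 (e (0%N, 0%N))) M0 b2 bM _ _ c (fine (eta [set 0])) _ (lexx _) c0 C1.
  - by move=> k; rewrite it2 /ip V2i -/(ip _ _) ip_iter_shifts etaE.
  - move=> j k jk; rewrite !it2 V2i hdot_iter_shifts xpair_eqE (negPf jk) andbF mulr0//.
  - by rewrite fine_ge0.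
  by exists h2; split=> // k; rewrite ip2 etaE.
pose K := hsum K1 (hsum L K2).
pose P1 : {linear K -> K} := diag_op N1 (diag_op U1 (\0 : {linear K2 -> K2}) : {linear hsum L K2 -> hsum L K2}).
pose P2 : {linear K -> K} := diag_op (\0 : {linear K1 -> K1}) (diag_op U2 N2 : {linear hsum L K2 -> hsum L K2}).
have nP1 : normal_op P1.
  by apply: diag_normal => //; apply: diag_normal => //; exact: zero_normal.
have nP2 : normal_op P2.
  apply: diag_normal; first exact: zero_normal.
  exact: diag_normal.
have P12 : commute_op P1 P2.
  apply: diag_commute; first exact: zero_commute.
  by apply: diag_commute => // z; rewrite -zero_commute.
pose h : K := (h1, ((Num.sqrt c)%:C%C *: l, h2)).
pose u k j : K := iter k P1 (iter j P2 h).
have uE k j : u k j = (if j == 0%N then iter k N1 h1 else 0,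
    ((Num.sqrt c)%:C%C *: iter k U1 (iter j U2 l), if k == 0%N then iter j N2 h2 else 0)) :> K1 * (L * K2).
  rewrite /u /P2 /P1 !iter_diag /=.
  rewrite !iter_linZ !(iter_zero _ _ (fun=> erefl)).
  congr (_, (_, _)); case: ifP => // _.
  by elim: k => //= k ->; rewrite linear0.
(* The Gram matrix of [hdot_iter_shifts]. On the diagonal the axes are treated apart, since each
   zero operator contributes only through its power of exponent 0. *)
have uu k j k' j' : hdot K (u k j) (u k' j') = (w k j * w k' j' * ((k, j) == (k', j'))%:R)%:C%C.
  rewrite !uE !hdot_hsum /= hdotZl hdotZr lE conjC_real_complex.
  have [[<- <-]|ne] := eqVneq (k, j) (k', j').
    rewrite !mulr1 -!rmorphM mulrA -expr2 sqr_sqrtr// addnn -mul2n.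
    case: k => [|k]; case: j => [|j] /=.
    - rewrite !hdot_self (ip1 0%N) (ip2 0%N) -!rmorphD /=; congr (_%:C%C).
      rewrite /d /path_weight !big_ord0 !expr0; ring.
    - rewrite linear0l hdot_self (ip2 j.+1) -!rmorphD /=; congr (_%:C%C).
      by rewrite expr0n/= mul0r subr0 -exprM; ring.
    - rewrite linear0l hdot_self (ip1 k.+1) -!rmorphD /=; congr (_%:C%C).
      by rewrite expr0n/= mul0r subr0 expr1n; ring.
    - rewrite !linear0l -!rmorphD /= add0r addr0 -expr2 path_weight_sqr//.
  rewrite !mulr0 add0r.
  have z1 : hdot K1 (if j == 0%N then iter k N1 h1 else 0) (if j' == 0%N then iter k' N1 h1 else 0) = 0.
    case: eqP => [j0|_]; last exact: linear0l.
    case: eqP => [j0'|_]; last exact: linear0r.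
    by apply: ort1; apply: contra ne => /eqP ->; rewrite j0 j0'.
  have z2 : hdot K2 (if k == 0%N then iter j N2 h2 else 0) (if k' == 0%N then iter j' N2 h2 else 0) = 0.
    case: eqP => [k0|_]; last exact: linear0l.
    case: eqP => [k0'|_]; last exact: linear0r.
    by apply: ort2; apply: contra ne => /eqP ->; rewrite k0 k0'.
  by rewrite z1 z2 addr0.
have wV k j : w k j != 0 by rewrite gt_eqF// path_weight_gt0.
pose v (p : nat * nat) : K := (w p.1 p.2)^-1%:C%C *: u p.1 p.2.
have vo p q : hdot K (v p) (v q) = (p == q)%:R.
  rewrite /v hdotZl hdotZr uu conjC_real_complex -!rmorphM.
  rewrite -!surjective_pairing; case: eqVneq => [->|_]; last by rewrite !mulr0 rmorph0.
  have wq := wV q.1 q.2; rewrite mulr1.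
  have -> : (w q.1 q.2)^-1 * ((w q.1 q.2)^-1 * (w q.1 q.2 * w q.1 q.2)) = 1 by field.
  by [].
have [V [Vi VE]] := orthonormal_embedding vo.
have uv p : u p.1 p.2 = (w p.1 p.2)%:C%C *: v p.
  by rewrite /v scalerA -rmorphM divff// scale1r.
have VE' p : V (e p) = v p by rewrite -VE; congr (V _); exact: l2_eq.
have VZ (t : R[i]) p : V (t *: e p) = t *: v p.
  by rewrite -VE'; exact: linearZ.
exists K, P1, P2, V; split => // F.
(* By boundedness the intertwining relation need only be checked on basis vectors. *)
have ext (P : {linear K -> K}) (T : {linear ell2Z R -> ell2Z R}) : bounded_op P -> bounded_op T ->
    (forall p, P (V (e p)) = V (T (e p))) -> P (V F) = V (T F).
  move=> [s Ps] [t Tt] PV.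
  pose PV' : {linear ell2Z R -> K} := P \o V.
  pose VT : {linear ell2Z R -> K} := V \o T.
  apply: (@eq_on_deltas _ _ K PV' VT s t) => [G|G|p].
  - by rewrite (le_trans (Ps _))// (isometric_hnorm Vi).
  - by rewrite /= (isometric_hnorm Vi).
  - by have := PV p; rewrite (_ : e p = delta R p)//; exact: l2_eq.
have PS P (al : R) p q : P (u p.1 p.2) = u q.1 q.2 -> w q.1 q.2 = w p.1 p.2 * al ->
    forall (Pl : {linear K -> K}), Pl =1 P -> Pl (v p) = al%:C%C *: v q.
  move=> Pu we Pl PlE; rewrite [v p]/v linearZ /= PlE Pu uv scalerA -rmorphM we.
  by rewrite mulrA mulVf// mul1r.
split.
  apply: ext; [by case: nP1|exact: subnormal_bounded|move=> [k j]].
  rewrite VE' wshift1E VZ.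
  by apply: (PS P1 _ (k, j) (k.+1, j)) => //; rewrite /= path_weightS1.
apply: ext; [by case: nP2|exact: subnormal_bounded|move=> [k j]].
rewrite VE' wshift2E VZ.
apply: (PS P2 _ (k, j) (k, j.+1)) => //; last by rewrite /= path_weightS2.
by rewrite /u /= iter_comm// => z; rewrite P12.
Qed.

End flat_shift.

(** * Signed measures *)

Section charge_integral.
Variables (d : measure_display) (T : measurableType d) (R : realType).
Local Open Scope ereal_scope.

Lemma integral_measure_split (m p q : {measure set T -> \bar R}) (f : T -> \bar R) :
  (forall A, measurable A -> m A = p A + q A) -> m.-integrable setT f ->
  [/\ p.-integrable setT f, q.-integrable setT f &
      \int[m]_t f t = \int[p]_t f t + \int[q]_t f t].
Proof.
move=> mE /integrableP[mf fin].
have addE (g : T -> \bar R) : \int[m]_t g t = \int[measure_add p q]_t g t.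
  by apply: eq_measure_integral => A mA _; rewrite [RHS]measure_addE mE.
have absE : \int[m]_t `|f t| = \int[p]_t `|f t| + \int[q]_t `|f t|.
  by rewrite addE ge0_integral_measure_add//; exact: measurableT_comp.
have ip : p.-integrable setT f.
  apply/integrableP; split=> //; apply: le_lt_trans fin.
  by rewrite absE leeDl// integral_ge0.
have iq : q.-integrable setT f.
  apply/integrableP; split=> //; apply: le_lt_trans fin.
  by rewrite absE leeDr// integral_ge0.
by split=> //; rewrite addE integral_measure_add.
Qed.

(** The Jordan decomposition is minimal: [m1] and [m2] exceed the positive and negative parts by the
    same measure [r], the sum of [m1] on [N] and [m2] on [P], whose integral cancels. *)
Lemma cintegralE (nu : {charge set T -> \bar R}) (m1 m2 : {finite_measure set T -> \bar R})
    (f : T -> \bar R) :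
  (forall A, measurable A -> nu A = m1 A - m2 A) ->
  m1.-integrable setT f -> m2.-integrable setT f ->
  cintegral nu f = \int[m1]_t f t - \int[m2]_t f t.
Proof.
move=> nuE f1 f2; rewrite /cintegral.
move: (projT2 (hahn nu)) => PN; set P := (projT1 _).1; set N := (projT1 _).2.
have [[mP _] [mN _] PNT PN0] := PN; rewrite -/P -/N in mP mN PNT PN0.
pose r : {measure set T -> \bar R} := measure_add (mrestr m1 mN) (mrestr m2 mP).
have alg (a b c : \bar R) : a \is a fin_num -> b \is a fin_num -> c \is a fin_num ->
    a + b = (a - c) + (b + c).
  move: a b c => [a| |] [b| |] [c| |]// _ _ _.
  by rewrite -EFinB -!EFinD; congr _%:E; ring.
have alg' (a b c : \bar R) : a \is a fin_num -> b \is a fin_num -> c \is a fin_num ->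
    a + b = - (c - b) + (c + a).
  move: a b c => [a| |] [b| |] [c| |]// _ _ _.
  by rewrite -EFinB -EFinN -!EFinD; congr _%:E; ring.
have rE A : r A = m1 (A `&` N) + m2 (A `&` P) := measure_addE _ _ A.
have jpE A : measurable A -> jordan_pos PN A = nu (A `&` P).
  by move=> mA; rewrite jordan_posE cjordan_posE /crestr0 mem_set.
have jnE A : measurable A -> jordan_neg PN A = - nu (A `&` N).
  by move=> mA; rewrite jordan_negE cjordan_negE /crestr0 mem_set.
have split12 A (m : {finite_measure set T -> \bar R}) : measurable A ->
    m A = m (A `&` P) + m (A `&` N).
  move=> mA; rewrite -measureU; [|exact: measurableI|exact: measurableI|].
    by rewrite -setIUr PNT setIT.
  by rewrite setIACA PN0 setI0.
have [mAP mAN] : (forall A, measurable A -> measurable (A `&` P)) /\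
    (forall A, measurable A -> measurable (A `&` N)).
  by split=> A mA; exact: measurableI.
have [_ ir1 ->] : [/\ (jordan_pos PN).-integrable setT f, r.-integrable setT f &
    \int[m1]_t f t = \int[jordan_pos PN]_t f t + \int[r]_t f t].
  apply: integral_measure_split => // A mA.
  rewrite [LHS](split12 A m1)// rE [X in _ = X + _]jpE// nuE ?mAP; last exact: mAP.
  by apply: alg; apply: fin_num_measure; [exact: mAP|exact: mAN|exact: mAP].
have [ij _ ->] : [/\ (jordan_neg PN).-integrable setT f, r.-integrable setT f &
    \int[m2]_t f t = \int[jordan_neg PN]_t f t + \int[r]_t f t].
  apply: integral_measure_split => // A mA.
  rewrite [LHS](split12 A m2)// rE [X in _ = X + _]jnE// nuE ?mAN; last exact: mAN.
  by apply: alg'; apply: fin_num_measure; [exact: mAP|exact: mAN|exact: mAN].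
rewrite oppeD ?fin_num_adde_defl ?integrable_fin_num//.
rewrite addeACA subee ?adde0//.
exact: integrable_fin_num.
Qed.

Lemma scaled_dirac_integral (c : {nonneg R}) (p : T) (g : T -> R) :
  measurable_fun setT g ->
  (mscale c (\d_p : {measure set T -> \bar R})).-integrable setT (EFin \o g) /\
  \int[mscale c \d_p]_t (g t)%:E = (c%:num * g p)%:E.
Proof.
move=> mg.
have E (h : T -> R) : measurable_fun setT h -> (forall t, 0 <= h t)%R ->
    \int[mscale c \d_p]_t (h t)%:E = (c%:num * h p)%:E.
  move=> mh h0; have mEh : measurable_fun setT (fun t => (h t)%:E) by exact/measurable_EFinP.
  rewrite ge0_integral_mscale//; last by move=> t _; rewrite lee_fin.
  by rewrite integral_dirac// diracT mul1e.
have int : (mscale c (\d_p : {measure set T -> \bar R})).-integrable setT (EFin \o g).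
  apply/integrableP; split; first exact/measurable_EFinP.
  rewrite (E (fun t => `|g t|)%R) ?ltry//.
  exact: measurableT_comp.
split=> //; rewrite integralE.
rewrite -[fun t => (g t)%:E]/(EFin \o g) funerpos funerneg.
rewrite !E//; last 2 first.
- exact: measurable_funrneg.
- exact: measurable_funrpos.
by rewrite -EFinB -mulrBr -[in RHS](funrposBneg g).
Qed.

(** The signed measures integrated in the claim all have this shape, with weight 0 for a missing
    atom. *)
Lemma cintegral_two_atoms (nu : {charge set T -> \bar R})
    (m : {finite_measure set T -> \bar R}) (p q : T) (c e : R) (g : T -> R) :
  (0 <= c)%R -> (0 <= e)%R -> measurable_fun setT g ->
  (forall A, measurable A -> nu A = m A - (c%:E * \d_p A + e%:E * \d_q A)) ->
  m.-integrable setT (EFin \o g) ->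
  cintegral nu (EFin \o g) = \int[m]_t (g t)%:E - (c * g p + e * g q)%:E.
Proof.
move=> c0 e0 mg nuE ig.
pose mc : {measure set T -> \bar R} := mscale (NngNum c0) \d_p.
pose me : {measure set T -> \bar R} := mscale (NngNum e0) \d_q.
pose m2 : {measure set T -> \bar R} := measure_add mc me.
have m2E A : m2 A = c%:E * \d_p A + e%:E * \d_q A by exact: measure_addE.
have m2fin : fin_num_fun m2.
  by move=> A mA; rewrite m2E fin_numD !fin_numM ?fin_num_measure.
pose m2f : {finite_measure set T -> \bar R} :=
  HB.pack_for {finite_measure set T -> \bar R} (m2 : set T -> \bar R)
  (Measure.class m2) (Measure_isFinite.Build _ _ _ m2 m2fin).
have [ic Ec] := scaled_dirac_integral (NngNum c0) p mg.
have [ie Ee] := scaled_dirac_integral (NngNum e0) q mg.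
have mEg : measurable_fun setT (EFin \o g) by exact/measurable_EFinP.
have i2 : m2.-integrable setT (EFin \o g).
  apply/integrableP; split=> //.
  rewrite ge0_integral_measure_add//; last exact: measurableT_comp.
  by apply: lte_add_pinfty; [case/integrableP: ic|case/integrableP: ie].
have nuE' A : measurable A -> nu A = m A - m2f A.
  by move=> mA; rewrite nuE// -m2E.
rewrite (cintegralE nuE' ig i2); congr (_ - _).
by rewrite integral_measure_add// Ec Ee EFinD.
Qed.

End charge_integral.

Lemma measurable_invr (R : realType) : measurable_fun [set: R] (fun t : R => t^-1).
Proof.
have U : [set 0%R] `|` ~` [set 0%R] = [set: R] := setUv _.
rewrite -U; apply/measurable_funU => //; first exact: measurableC.
split.
  exact: measurable_fun_set1.
apply: open_continuous_measurable_fun.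
  by apply: closed_openC; exact: accessible_closed_set1 (hausdorff_accessible (@Rhausdorff R)) _.
move=> t; rewrite inE /= => /eqP t0; exact: inv_continuous.
Qed.

(** * Recovering a measure away from 0 from its density [t], given by moments *)

Section inverse_density.
Variables (R : realType) (eta eta1 : {finite_measure set R -> \bar R}) (M z : R).
Hypotheses (M0 : 0 < M) (z0 : 0 <= z).
Hypothesis eta0 : eta (~` `[0, M]%classic) = 0%E.
Hypothesis eta10 : eta1 (~` `[0, M]%classic) = 0%E.
Hypothesis mom : forall k,
  z * \int[eta1]_(s in `[0, M]) s ^+ k = \int[eta]_(s in `[0, M]) s ^+ k.+1.

Let D := `[0, M]%classic : set R.

Let mD : measurable D. Proof. exact: measurable_itv. Qed.

(* [(1 - (1 - t^2/M^2)^n) / t], a polynomial vanishing at 0. *)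
Definition approx_inv n : {poly R} :=
  (M ^- 2 *: 'X) * \sum_(i < n) bump_at 0 M i.

Lemma approx_invX n : approx_inv n * 'X = 1 - bump_at 0 M n.
Proof.
have E i : bump_at 0 M i = (1 - M ^- 2 *: 'X ^+ 2) ^+ i by rewrite /bump_at subr0.
rewrite /approx_inv E (eq_bigr (fun i : 'I_n => (1 - M ^- 2 *: 'X ^+ 2) ^+ i)); last by move=> i _; exact: E.
rewrite -[RHS]opprB subrX1 -mulNr !opprB addrCA subrr addr0 mulrAC; congr (_ * _).
by rewrite -scalerAl expr2.
Qed.

Lemma approx_inv0 n : (approx_inv n).[0] = 0.
Proof. by rewrite hornerM hornerZ hornerX mulr0 mul0r. Qed.

Lemma approx_inv_mul n t : (approx_inv n).[t] * t = 1 - (bump_at 0 M n).[t].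
Proof. by rewrite -horner_1sub -approx_invX [RHS]hornerM hornerX. Qed.

Let dist0 t : 0 <= t <= M -> `|t - 0| <= M.
Proof. by move=> tM; apply: itv_dist => //; rewrite lexx ltW. Qed.

Lemma approx_inv_nd t : 0 <= t <= M ->
  {homo (fun n => (approx_inv n).[t]) : m n / (m <= n)%N >-> m <= n}.
Proof.
move=> tM; apply: homo_leq => // [y x u|n]; first exact: le_trans.
have /andP[b0 _] := bump_at_01 n M0 (dist0 tM).
have /andP[t0 _] := tM.
rewrite /approx_inv !hornerM !hornerZ !hornerX big_ord_recr hornerD /=.
by apply: ler_wpM2l; [rewrite mulr_ge0// invr_ge0 exprn_ge0// ltW|rewrite lerDl].
Qed.

Lemma approx_inv_ge0 n t : 0 <= t <= M -> 0 <= (approx_inv n).[t].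
Proof.
move=> tM; apply: le_trans (approx_inv_nd tM (leq0n n)).
by rewrite /approx_inv big_ord0 mulr0 horner0.
Qed.

Lemma approx_inv_cvg t : 0 <= t <= M -> (approx_inv n).[t] @[n --> \oo] --> `|t|^-1.
Proof.
move=> tM; have [->|t0] := eqVneq t 0.
  by under eq_fun do rewrite approx_inv0; rewrite normr0 invr0; exact: cvg_cst.
have tp : 0 < t by rewrite lt_neqAle eq_sym t0; case/andP: tM.
have -> : (fun n => (approx_inv n).[t]) = (fun n => (1 - (bump_at 0 M n).[t]) * t^-1).
  by apply/funext => n; rewrite -approx_inv_mul mulfK.
rewrite gtr0_norm// -[X in _ --> X]mul1r; apply: cvgMr_tmp.
rewrite -[X in _ --> X]subr0; apply: cvgB; first exact: cvg_cst.
have := bump_at_cvg M0 (dist0 tM); rewrite (negPf t0); exact.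
Qed.

Lemma poly_shift p :
  z * \int[eta1]_(s in D) p.[s] = \int[eta]_(s in D) (p * 'X).[s].
Proof.
have E (m : {finite_measure set R -> \bar R}) (q : {poly R}) k : (size q <= k)%N ->
    \int[m]_(s in D) q.[s] = \sum_(i < k) q`_i * \int[m]_(s in D) s ^+ i.
  move=> qk; under eq_Rintegral do rewrite (horner_coef_wide _ qk).
  rewrite Rintegral_sum//.
    apply: eq_bigr => i _; rewrite RintegralZl//.
    by apply: bdm_integrable => //; exact: bdm_expr.
  by move=> i; apply: bdmM; [exact: bdm_cst|exact: bdm_expr].
rewrite (E _ _ (size p))// (E _ _ (size p).+1); last first.
  by rewrite (leq_trans (size_polyMleq _ _))// size_polyX addn2.
rewrite big_ord_recl coefMX eqxx mul0r add0r mulr_sumr; apply: eq_bigr => i _.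
by rewrite coefMX /= mulrCA mom.
Qed.

Lemma Rintegral_ray (m : {finite_measure set R -> \bar R}) x f : 0 < x -> bdm D f ->
  \int[m]_(s in D) ((s < x)%R%:R * f s) = \int[m]_(s in D `&` `]-oo, x[) f s.
Proof.
move=> x0 bf; rewrite Rintegral_mkcondr; apply: eq_Rintegral => s _.
by rewrite patchE mem_setE in_itv/=; case: ifP; rewrite ?mul1r ?mul0r.
Qed.

(** Multiplying [p] by [step_below] and passing to the limit localizes the polynomial identity
    [poly_shift] to a ray. *)
Lemma poly_shift_ray p x : 0 < x ->
  z * \int[eta1]_(s in D `&` `]-oo, x[) p.[s] =
  \int[eta]_(s in D `&` `]-oo, x[) (p * 'X).[s].
Proof.
move=> x0; pose k := (Num.truncn (M / x)).+1.
have kx : M <= k%:R * x by rewrite -ler_pdivrMr// ltW// truncnS_gt.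
have lim (m : {finite_measure set R -> \bar R}) (q : {poly R}) :
    \int[m]_(s in D) (step_below x k n * q).[s] @[n --> \oo] -->
    \int[m]_(s in D `&` `]-oo, x[) q.[s].
  have bq := bdm_horner M q; rewrite -Rintegral_ray//.
  have [mq [B qB]] := bq.
  apply: (@bounded_cvg_Rintegral _ _ _ _ _ _ _ _ B) => //.
  - by move=> n; have [] := bdm_horner M (step_below x k n * q).
  - apply: measurable_funM => //.
    have -> : (fun s : R => (s < x)%R%:R : R) = \1_(`]-oo, x[%classic).
      by apply/funext => s; rewrite indicE mem_setE in_itv.
    exact: measurable_indic.
  - move=> n s Ds; rewrite hornerM normrM -[B]mul1r; apply: ler_pM => //; last exact: qB.
    have : 0 <= s <= k%:R * x.
      by move: Ds; rewrite /D /= in_itv/= => /andP[-> /le_trans]; exact.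
    by move=> /(step_below_01 n)/andP[s0 s1]; rewrite ger0_norm.
  - move=> s Ds; under eq_fun do rewrite hornerM.
    apply: cvgMr_tmp; apply: step_below_cvg => //.
    by move: Ds; rewrite /D /= in_itv/= => /andP[-> /le_trans]; exact.
have l1 : z * \int[eta1]_(s in D) (step_below x k n * p).[s] @[n --> \oo] -->
    z * \int[eta1]_(s in D `&` `]-oo, x[) p.[s] by apply: cvgMl_tmp; exact: lim.
rewrite -(cvg_lim (@Rhausdorff R) l1) -(cvg_lim (@Rhausdorff R) (lim eta (p * 'X))).
by congr (limn _); apply/funext => n; rewrite poly_shift mulrA.
Qed.

(** [1/t] is unbounded near 0, so it is approached by the increasing polynomials [approx_inv] under
    monotone convergence. By [poly_shift_ray] their integrals are those of [1 - bump_at 0 M n]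
    against [eta], which tend to the mass off 0. As the inverse of 0 is 0, the point 0 counts on
    neither side; the absolute value makes the density nonnegative on the whole line. *)
Lemma inverse_density_ray x :
  (\int[eta1]_(t in `]-oo, x[) (z * `|t|^-1)%:E = eta (`]-oo, x[ `&` ~` [set 0%R]))%E.
Proof.
have mr : measurable (`]-oo, x[%classic : set R) by [].
have f0 (t : R) : 0 <= z * `|t|^-1 by rewrite mulr_ge0// invr_ge0.
have mf : measurable_fun setT (fun t : R => z * `|t|^-1).
  by apply: measurable_funM => //; exact: measurableT_comp (@measurable_invr R) _.
have mEf : measurable_fun setT (fun t : R => (z * `|t|^-1)%:E) by exact/measurable_EFinP.
pose Dx := D `&` `]-oo, x[%classic.
have mDx : measurable Dx by exact: measurableI.
rewrite (ge0_negligible_integral (measurableC mD) mr _ _ eta10); last 2 first.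
- exact: measurable_funTS.
- by move=> t _; rewrite lee_fin.
rewrite setDE setCK setIC -/Dx.
rewrite (concentrated_measure mD eta0); last by apply: measurableI => //; exact: measurableC.
rewrite setIA -/Dx.
have [x0|x0] := leP x 0.
  rewrite (_ : Dx = set0); first by rewrite set0I measure0 integral_set0.
  apply/seteqP; split=> // t []; rewrite /D /= !in_itv/= => /andP[t0 _] tx.
  by move: (lt_le_trans tx x0); rewrite ltNge t0.
have DxM t : Dx t -> 0 <= t <= M by move=> [+ _]; rewrite /D /= in_itv.
have bDx (f : R -> R) : bdm D f -> bdm Dx f.
  move=> [mf' [B fB]]; split; first exact: (measurable_funS mD _ mf').
  by exists B => t [Dt _]; exact: fB.
pose F n t := z * (approx_inv n).[t].
have mF n : measurable_fun Dx (F n).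
  by apply: measurable_funM => //; have [] := bDx _ (bdm_horner M (approx_inv n)).
have bF n : bdm Dx (F n).
  by apply: bDx; apply: bdmM; [exact: bdm_cst|exact: bdm_horner].
have lF t : Dx t -> F n t @[n --> \oo] --> z * `|t|^-1.
  by move=> Dt; apply: cvgMl_tmp; apply: approx_inv_cvg; exact: DxM.
have c1 : (\int[eta1]_(t in Dx) (F n t)%:E @[n --> \oo] -->
    \int[eta1]_(t in Dx) (z * `|t|^-1)%:E)%E.
  have -> : (\int[eta1]_(t in Dx) (z * `|t|^-1)%:E =
      \int[eta1]_(t in Dx) limn (fun n => (F n t)%:E))%E.
    apply: eq_integral => t; rewrite inE => Dt; apply/esym/cvg_lim => //.
    by apply: cvg_EFin; [exact: nearW|exact: lF].
  apply: cvg_monotone_convergence => //.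
  - by move=> n; exact/measurable_EFinP.
  - by move=> n t Dt; rewrite lee_fin mulr_ge0// approx_inv_ge0// DxM.
  - move=> t Dt m n mn; rewrite lee_fin ler_wpM2l//.
    exact: (approx_inv_nd (DxM _ Dt)).
have FE n : (\int[eta1]_(t in Dx) (F n t)%:E = (\int[eta]_(t in Dx) (1 - (bump_at 0 M n).[t]))%:E)%E.
  rewrite -[LHS]fineK; last by apply: integrable_fin_num => //; exact: bdm_integrable.
  congr _%:E; rewrite -/(Rintegral _ _ _) RintegralZl//; last first.
    by apply: bdm_integrable => //; apply: bDx; exact: bdm_horner.
  rewrite poly_shift_ray// approx_invX; apply: eq_Rintegral => t _.
  by rewrite horner_1sub.
have mDx0 : measurable (Dx `&` ~` [set 0%R]) by apply: measurableI => //; exact: measurableC.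
have c2 : (\int[eta]_(t in Dx) (1 - (bump_at 0 M n).[t]))%:E @[n --> \oo] -->
    eta (Dx `&` ~` [set 0%R]).
  have lr : \int[eta]_(t in Dx) (1 - (bump_at 0 M n).[t]) @[n --> \oo] -->
      \int[eta]_(t in Dx) (\1_(~` [set (0 : R)]) t : R).
    apply: (@bounded_cvg_Rintegral _ _ _ _ _ _ _ _ 1) => //.
    - by move=> n; apply: measurable_funB => //; have [] := bDx _ (bdm_horner M (bump_at 0 M n)).
    - by apply: measurable_indic; exact: measurableC.
    - move=> n t Dt; have /andP[b0 b1] := bump_at_01 n M0 (dist0 (DxM t Dt)).
      by rewrite ger0_norm; lra.
    - move=> t Dt; rewrite (_ : \1__ _ = 1 - (t == 0)%:R :> R); last first.
        by rewrite indicE in_setC in_set1; case: eqP; rewrite ?subrr ?subr0.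
      apply: cvgB; first exact: cvg_cst.
      by apply: bump_at_cvg => //; exact/dist0/DxM.
  rewrite -[eta _]fineK ?fin_num_measure//.
  apply: cvg_EFin; first exact: nearW.
  rewrite (_ : fine _ = \int[eta]_(t in Dx) (\1_(~` [set (0 : R)]) t : R))//.
  by rewrite /Rintegral integral_indic//; [rewrite setIC|exact: measurableC].
rewrite -(cvg_lim (@ereal_hausdorff R) c1) -(cvg_lim (@ereal_hausdorff R) c2).
by congr (limn _); apply/funext => n; rewrite FE.
Qed.

(** Both sides are measures in [B]; they agree on rays, where the right side is finite. *)
Lemma inverse_density B : measurable B ->
  (\int[eta1]_(t in B) (z * `|t|^-1)%:E = eta (B `&` ~` [set 0%R]))%E.
Proof.
have f0 (t : R) : (0 <= (z * `|t|^-1)%:E)%E by rewrite lee_fin mulr_ge0// invr_ge0.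
have mf : measurable_fun setT (fun t : R => (z * `|t|^-1)%:E).
  by apply/measurable_EFinP; apply: measurable_funM => //; exact: measurableT_comp (@measurable_invr R) _.
pose kappa (B : set R) : \bar R := (\int[eta1]_(t in B) (z * `|t|^-1)%:E)%E.
have k0 : kappa set0 = 0%E by rewrite /kappa integral_set0.
have kge0 B' : (0 <= kappa B')%E by apply: integral_ge0.
pose mk : {measure set R -> \bar R} := HB.pack_for {measure set R -> \bar R} kappa
  (isMeasure.Build _ _ _ kappa k0 kge0 (semi_sigma_additive_nng_induced mf f0)).
have m0 : measurable (~` [set (0 : R)]) by exact: measurableC.
move=> mB; have := @measure_eq_ray R mk (mrestr eta m0) _ _ B mB; apply.
- by move=> x; exact: inverse_density_ray.
- move=> x; rewrite [X in (X < _)%E]inverse_density_ray.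
  by rewrite -ge0_fin_numE// fin_num_measure//; exact: measurableI.
Qed.

End inverse_density.

Section charge_with_atoms.
Variables (R : realType).
Local Open Scope ereal_scope.

Lemma two_atoms_le (m : {finite_measure set R -> \bar R}) (p q c e : R) A : p != q ->
  (c <= fine (m [set p]))%R -> (e <= fine (m [set q]))%R -> measurable A ->
  (c * (p \in A)%:R + e * (q \in A)%:R <= fine (m A))%R.
Proof.
move=> pq cp eq mA.
have le_sub B : measurable B -> B `<=` A -> (fine (m B) <= fine (m A))%R.
  by move=> mB BA; rewrite fine_le ?fin_num_measure ?le_measure ?inE.
have m0 : (0 <= fine (m A))%R by rewrite fine_ge0.
have [pA|pA] := boolP (p \in A); have [qA|qA] := boolP (q \in A); rewrite /= ?mulr1 ?mulr0 ?addr0 ?add0r//.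
- have : (fine (m ([set p] `|` [set q])) <= fine (m A))%R.
    apply: le_sub; first exact: measurableU.
    by move=> s [->|->]; exact/set_mem.
  rewrite measureU//; last by apply/seteqP; split=> // s [/= -> /eqP]; rewrite (negPf pq).
  by rewrite fineD ?fin_num_measure//; apply: le_trans; rewrite lerD.
- by apply: le_trans cp _; apply: le_sub => // s ->; exact/set_mem.
- by apply: le_trans eq _; apply: le_sub => // s ->; exact/set_mem.
Qed.

Lemma positive_two_atoms (nu : {charge set R -> \bar R})
    (m : {finite_measure set R -> \bar R}) (p q c e : R) : p != q ->
  (forall A, measurable A -> nu A = m A - (c%:E * \d_p A + e%:E * \d_q A)) ->
  positive_charge nu <-> (c <= fine (m [set p]))%R /\ (e <= fine (m [set q]))%R.
Proof.
move=> pq nuE.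
have val A : measurable A ->
    nu A = (fine (m A) - (c * (p \in A)%:R + e * (q \in A)%:R))%:E.
  move=> mA; have mf : m A = (fine (m A))%:E by rewrite fineK// fin_num_measure.
  by rewrite nuE// mf !diracE -!EFinM -EFinD.
split=> [[_ pos]|[cp eq]].
  have := pos [set p] (measurable_set1 p) (@subsetT _ _).
  have := pos [set q] (measurable_set1 q) (@subsetT _ _).
  rewrite !val// !lee_fin !in_set1 !eqxx [q == p]eq_sym (negPf pq) /= !mulr1 !mulr0 addr0 add0r.
  by rewrite !subr_ge0; split.
by split=> // A mA _; rewrite val// lee_fin subr_ge0; exact: two_atoms_le.
Qed.

End charge_with_atoms.

Section support_bound.
Variables (d : measure_display) (T : measurableType d) (R : realType).
Variables (m : {finite_measure set T -> \bar R}) (D : set T) (f : T -> R) (M rho : R).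
Hypotheses (mD : measurable D) (mf : measurable_fun D f).
Hypotheses (fM : forall t, D t -> 0 <= f t <= M) (rho0 : 0 <= rho).
Hypothesis fmom : forall k, \int[m]_(t in D) f t ^+ k <= rho ^+ k.

(** Markov's inequality for every power: the set where [f >= r] has mass at most [(rho / r) ^+ k],
    hence none if [r > rho]. Countably many such [r] exhaust the set. *)
Lemma support_bound : m (D `&` [set t | rho < f t]) = 0%E.
Proof.
have mDr r : measurable (D `&` [set t | r <= f t]).
  rewrite (_ : [set t | r <= f t] = f @^-1` `[r, +oo[); first exact: mf.
  by apply/seteqP; split=> t /=; rewrite in_itv/= andbT.
have bf : bdm D f by split=> //; exists M => t /fM/andP[f0 ?]; rewrite ger0_norm.
have null r : rho < r -> m (D `&` [set t | r <= f t]) = 0%E.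
  move=> rr; have r0 : 0 < r by apply: le_lt_trans rr.
  set E := _ `&` _; have mE : measurable E by exact: mDr.
  have bound k : fine (m E) <= (rho / r) ^+ k.
    rewrite expr_div_n ler_pdivlMr ?exprn_gt0//; apply: le_trans (fmom k).
    have -> : fine (m E) * r ^+ k = \int[m]_(t in D) (r ^+ k * \1_E t).
      rewrite RintegralZl//; last by apply: bdm_integrable => //; exact: bdm_indic.
      rewrite mulrC; congr (_ * fine _); rewrite integral_indic//.
      by rewrite /E setIAC setIid.
    apply: le_Rintegral => //.
    - by apply: bdm_integrable => //; apply: bdmM; [exact: bdm_cst|exact: bdm_indic].
    - by apply: bdm_integrable => //; exact: bdmX.
    - move=> t Dt; have /andP[f0 _] := fM Dt; rewrite indicE.
      have [|_] := boolP (t \in E); last by rewrite mulr0 exprn_ge0.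
      by rewrite inE => -[_ /= rf]; rewrite mulr1 lerXn2r// ?nnegrE// ltW.
  have c0 : (rho / r) ^+ k @[k --> \oo] --> (0 : R).
    have r0' := ltW r0; apply: cvg_expr; rewrite ger0_norm ?divr_ge0//.
    by rewrite ltr_pdivrMr// mul1r.
  have : fine (m E) <= 0 by apply: (cvgr_to_ge c0); apply: nearW.
  move=> mE0; have : fine (m E) = 0 by apply/eqP; rewrite eq_le mE0 fine_ge0.
  by move=> mE00; rewrite -[LHS]fineK ?fin_num_measure// mE00.
have -> : D `&` [set t | rho < f t] =
    \bigcup_n (D `&` [set t | rho + n.+1%:R^-1 <= f t]).
  apply/seteqP; split=> t.
    move=> [Dt /= rf]; exists (Num.truncn (f t - rho)^-1) => //; split=> //=.
    have p0 : 0 < f t - rho by rewrite subr_gt0.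
    by rewrite -lerBrDl invf_ple ?posrE// ltW// truncnS_gt.
  by move=> [n _ [Dt /= nf]]; split=> //=; apply: lt_le_trans nf; rewrite ltrDl.
apply/eqP; rewrite eq_le measure_ge0 andbT.
have mF n : measurable (D `&` [set t | rho + n.+1%:R^-1 <= f t]) by exact: mDr.
apply: (le_trans (generalized_Boole_inequality m mF (bigcupT_measurable _ mF))).
by rewrite eseries0// => n _ _; rewrite /= null// ltrDl.
Qed.

End support_bound.

Section operator_norm.
Variables (R : realType) (H : hilbert R) (T : {linear H -> H}).

Lemma opnorm_bound : bounded_op T -> forall x, hnorm x = 1 -> hnorm (T x) <= opnorm T.
Proof.
move=> /bounded_op_ge0[M M0 TM] x x1; apply: ub_le_sup; last by exists x => //=; rewrite x1.
exists M => _ [z /= z1 <-]; apply: le_trans (TM z) _.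
by rewrite -[leRHS]mulr1 ler_wpM2l.
Qed.

End operator_norm.

Section integrable_sums.
Variables (d : measure_display) (T : measurableType d) (R : realType).
Local Open Scope ereal_scope.

Lemma integrable_measure_add (p q : {measure set T -> \bar R}) (f : T -> \bar R) :
  p.-integrable setT f -> q.-integrable setT f ->
  (measure_add p q : {measure set T -> \bar R}).-integrable setT f.
Proof.
move=> /integrableP[mf fp] /integrableP[_ fq]; apply/integrableP; split=> //.
rewrite ge0_integral_measure_add//; last exact: measurableT_comp.
exact: lte_add_pinfty.
Qed.

End integrable_sums.

(** * The integrals of [1/t] and the charge [psi] in terms of [eta] *)

Section column_measures.
Variables (R : realType) (y : weights R nat) (a b : R) (eta eta1 : probability R R).
Hypotheses (a_gt0 : 0 < a) (b_gt0 : 0 < b).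
Hypothesis eta_berger : is_berger y eta.
Hypothesis eta1_berger : is_berger (fun n => y n.+1) eta1.

Local Notation y0 := (y 0%N).
Local Notation c := (a ^+ 2 * y0 ^+ 2 / b ^+ 2).

Let y0_gt0 : 0 < y0. Proof. exact: weight_gt0. Qed.
Let b2_gt0 : 0 < b ^+ 2. Proof. by rewrite exprn_gt0. Qed.
Let y2_gt0 : 0 < y0 ^+ 2. Proof. by rewrite exprn_gt0. Qed.

Lemma common_column_support : exists M, [/\ 0 < M,
  eta (~` `[0, M]%classic) = 0%E, eta1 (~` `[0, M]%classic) = 0%E &
  forall k, y0 ^+ 2 * \int[eta1]_(s in `[0, M]) s ^+ k = \int[eta]_(s in `[0, M]) s ^+ k.+1].
Proof.
have [M1 etaP] := berger_moment eta_berger.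
have [M2 eta1P] := berger_moment eta1_berger.
pose M := Num.max 1 (Num.max M1 M2); exists M.
have [|e0 em] := etaP M; first by rewrite !le_max lexx !orbT.
have [|e10 e1m] := eta1P M; first by rewrite !le_max lexx !orbT.
split=> // [|k]; first by rewrite lt_max ltr01.
by rewrite em e1m big_ord_recl.
Qed.

Local Open Scope ereal_scope.

Lemma inv_measurable : measurable_fun setT (fun t : R => (t^-1)%R).
Proof. exact: measurable_invr. Qed.

Lemma integral_abs_inv B : measurable B ->
  \int[eta1]_(t in B) (`|t|^-1)%:E = ((y0 ^- 2)%R%:E * eta (B `&` ~` [set 0%R])).
Proof.
move=> mB; have [M [M0 e0 e10 mom]] := common_column_support.
have := inverse_density M0 (ltW y2_gt0) e0 e10 mom mB => <-.
have mi : measurable_fun setT (fun t : R => (`|t|^-1)%:E).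
  by apply/measurable_EFinP; exact: measurableT_comp (@measurable_invr R) _.
under [X in _ = _ * X]eq_integral do rewrite EFinM.
rewrite ge0_integralZl//; last 2 first.
- exact: measurable_funTS.
- by rewrite lee_fin ltW.
by rewrite muleA -EFinM mulVf ?mul1e// gt_eqF.
Qed.

Lemma inv_integrable : eta1.-integrable setT (fun t => (t^-1)%:E).
Proof.
apply/integrableP; split; first by apply/measurable_EFinP; exact: inv_measurable.
under eq_integral do rewrite abse_EFin normfV.
rewrite integral_abs_inv// -(fineK (fin_num_measure eta _ _)) -?EFinM ?ltry//.
by apply: measurableI => //; exact: measurableC.
Qed.

Lemma integral_inv B : measurable B ->
  \int[eta1]_(t in B) (t^-1)%:E = ((y0 ^- 2) * fine (eta (B `&` ~` [set 0%R])))%R%:E.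
Proof.
move=> mB; have [M [M0 _ e10 _]] := common_column_support.
have mD : measurable (`[0%R, M]%classic : set R) by exact: measurable_itv.
have mB0 : measurable (B `&` ~` [set 0%R]) by apply: measurableI => //; exact: measurableC.
have iB : eta1.-integrable B (fun t => (t^-1)%:E).
  by apply: (integrableS measurableT) => //; exact: inv_integrable.
have iaB : eta1.-integrable B (fun t => (`|t|^-1)%:E).
  have := integrable_abse iB; apply: eq_integrable => // t _.
  by rewrite /= normfV.
rewrite (negligible_integral (measurableC mD) mB iB e10).
transitivity (\int[eta1]_(t in B) (`|t|^-1)%:E); last first.
  by rewrite integral_abs_inv// -(fineK (fin_num_measure eta _ mB0)).
rewrite [RHS](negligible_integral (measurableC mD) mB iaB e10).
apply: eq_integral => t; rewrite setDE setCK inE => -[_ /=].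
by rewrite in_itv/= => /andP[t0 _]; rewrite ger0_norm.
Qed.

Lemma eta_nonzero : fine (eta (~` [set 0%R])) = (1 - fine (eta [set 0%R]))%R.
Proof.
by rewrite probability_setC// fineB ?fin_num_measure.
Qed.

Lemma Lnorm_inv : fine (Lnorm eta1 1 (fun t => (t^-1)%:E)) =
  ((1 - fine (eta [set 0%R])) / y0 ^+ 2)%R.
Proof.
rewrite Lnorm1; under eq_integral do rewrite abse_EFin normfV.
rewrite integral_abs_inv// setTI -(fineK (fin_num_measure eta _ _)); last exact: measurableC.
by rewrite /= eta_nonzero mulrC.
Qed.

Lemma eta1_atom : fine (eta1 [set (b ^+ 2)%R]) = (b ^+ 2 / y0 ^+ 2 * fine (eta [set (b ^+ 2)%R]))%R.
Proof.
have := integral_inv (measurable_set1 (b ^+ 2)%R).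
rewrite (_ : _ `&` _ = [set (b ^+ 2)%R]); last first.
  by apply/seteqP; split=> s /= => [[]|->]//; split=> //; apply/eqP; rewrite gt_eqF.
rewrite (eq_integral (fun=> ((b ^+ 2)^-1)%R%:E)); last by move=> s; rewrite inE => ->.
rewrite integral_cst// => /(congr1 (fun u => fine ((b ^+ 2)%R%:E * u))).
rewrite muleA -EFinM divff ?gt_eqF// mul1e => ->.
by rewrite /= mulrA.
Qed.

Local Notation delta p := (charge_of_finite_measure (\d_(p : R)) : {charge set R -> \bar R}).

Definition psi_charge : {charge set R -> \bar R} :=
  csub (charge_of_finite_measure eta1) (cscale (a ^+ 2) (delta (b ^+ 2)%R)).

Lemma psi_chargeE A : psi_charge A = eta1 A - ((a ^+ 2)%R%:E * \d_(b ^+ 2)%R A + 0%R%:E * \d_(0%R : R) A).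
Proof.
rewrite mul0e adde0 -mulN1e -EFinN.
by rewrite -[LHS]/(eta1 A + (-1)%R%:E * ((a ^+ 2)%R%:E * \d_(b ^+ 2)%R A)).
Qed.

Lemma psi_positive : positive_charge psi_charge <-> (c <= fine (eta [set (b ^+ 2)%R]))%R.
Proof.
rewrite (positive_two_atoms (p := (b ^+ 2)%R) (q := 0%R) (m := eta1) (c := (a ^+ 2)%R) (e := 0%R)).
- rewrite eta1_atom mulrAC ler_pdivlMr// ler_pdivrMr// [X in (_ <= X)%R]mulrC.
  by split=> [[]//|h]; split=> //; rewrite fine_ge0.
- by rewrite gt_eqF.
- by move=> A _; exact: psi_chargeE.
Qed.

(** [k] stands for [norm_psi], which may vanish; both sides are then 0. *)
Lemma psi_integral (B : set R) (k : R) : measurable B ->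
  cintegral psi_charge (fun t => ((t * k)^-1 * \1_B t)%R%:E) =
  ((y0 ^- 2 * fine (eta (B `&` ~` [set 0%R])) - a ^+ 2 / b ^+ 2 * \1_B (b ^+ 2)%R) / k)%R%:E.
Proof.
move=> mB; pose g (t : R) := ((t * k)^-1 * \1_B t)%R.
have gE (t : R) : (g t)%:E = k^-1%:E * (((fun t => (t^-1)%:E) \_ B) t).
  rewrite /g patchE indicE; case: (t \in B) => /=; last by rewrite mulr0 mule0.
  by rewrite mulr1 -EFinM invfM mulrC.
have iinv : eta1.-integrable setT ((fun t => (t^-1)%:E) \_ B).
  apply/(integrable_mkcond _ mB); apply: (integrableS measurableT) => //.
  exact: inv_integrable.
have ig : eta1.-integrable setT (EFin \o g).
  have := integrableZl measurableT k^-1 iinv; apply: eq_integrable => // t _.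
  by rewrite /= gE.
have mg : measurable_fun setT g by apply/measurable_EFinP; exact: measurable_int ig.
rewrite -/(EFin \o g) (cintegral_two_atoms (sqr_ge0 a) (lexx 0%R) mg (fun A _ => psi_chargeE A) ig).
under eq_integral do rewrite gE.
rewrite integralZl// -integral_mkcond integral_inv// -EFinM -EFinB; congr _%:E.
by rewrite /g mul0r addr0 (invfM (b ^+ 2)%R); ring.
Qed.

Definition norm_psi_val : R := fine (cintegral psi_charge (fun t => (t^-1)%:E)).

Lemma norm_psiE : norm_psi_val = ((1 - fine (eta [set 0%R])) / y0 ^+ 2 - a ^+ 2 / b ^+ 2)%R.
Proof.
rewrite /norm_psi_val -[fun t => _]/(EFin \o (fun t : R => (t^-1)%R)).
rewrite (cintegral_two_atoms (sqr_ge0 a) (lexx 0%R) inv_measurable (fun A _ => psi_chargeE A) inv_integrable).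
rewrite integral_inv// setTI eta_nonzero -EFinB /= mul0r addr0.
by rewrite [X in (X - _)%R]mulrC.
Qed.

Lemma norm_psi_scaled : (y0 ^+ 2 * norm_psi_val = 1 - fine (eta [set 0%R]) - c)%R.
Proof. by rewrite norm_psiE; field; rewrite !gt_eqF. Qed.

End column_measures.

Section conditions.
Variables (R : realType) (y : weights R nat) (a b : R) (xi eta eta1 : probability R R).
Hypotheses (a_gt0 : 0 < a) (b_gt0 : 0 < b).
Hypothesis eta_berger : is_berger y eta.
Hypothesis eta1_berger : is_berger (fun n => y n.+1) eta1.

Local Notation y0 := (y 0%N).
Local Notation c := (a ^+ 2 * y0 ^+ 2 / b ^+ 2).
Local Notation delta p := (charge_of_finite_measure (\d_(p : R)) : {charge set R -> \bar R}).
Local Notation xi_c := (charge_of_finite_measure xi : {charge set R -> \bar R}).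
Local Notation norm_psi := (norm_psi_val a b eta1).

Definition phi_charge : {charge set R -> \bar R} :=
  csub (csub xi_c (cscale (y0 ^+ 2 * norm_psi) (delta 0%R))) (cscale c (delta 1%R)).

Lemma phi_chargeE A : (phi_charge A =
  xi A - ((y0 ^+ 2 * norm_psi)%:E * \d_(0%R : R) A + c%:E * \d_(1%R : R) A))%E.
Proof.
rewrite -[LHS]/(xi A + (-1)%R%:E * ((y0 ^+ 2 * norm_psi)%:E * \d_(0%R : R) A) +
  (-1)%R%:E * (c%:E * \d_(1%R : R) A))%E.
by rewrite !EFinN !mulN1e -addeA -fin_num_oppeD// fin_numM// fin_num_measure.
Qed.

Lemma phi_positive : positive_charge phi_charge <->
  1 - fine (eta [set 0]) - c <= fine (xi [set 0]) /\ c <= fine (xi [set 1]).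
Proof.
have e01 : (0 : R) != 1 by rewrite eq_sym oner_eq0.
rewrite (positive_two_atoms e01 (fun A _ => phi_chargeE A)).
by rewrite (norm_psi_scaled a b_gt0 eta_berger eta1_berger).
Qed.

Lemma positive_charges_atoms :
  positive_charge (psi_charge a b eta1) /\ positive_charge phi_charge <->
  atom_conditions y a b xi eta.
Proof.
have psiP := psi_positive a b_gt0 eta_berger eta1_berger.
split=> [[/psiP P /phi_positive [Q S]]|[P Q S]].
  by split=> //; lra.
by split; [exact/psiP|apply/phi_positive; split=> //; lra].
Qed.

(** The number [y0] is itself [b / a] times the square root of [c]. *)
Lemma sqrt_bound (m : R) : (y0 <= b / a * Num.sqrt m) = (c <= m).
Proof.
have y0_gt0 : 0 < y0 by exact: weight_gt0.
have c_gt0 : 0 < c by rewrite divr_gt0 ?mulr_gt0 ?exprn_gt0.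
have E : y0 = b / a * Num.sqrt c.
  have -> : c = (a * y0 / b) ^+ 2 by field; rewrite gt_eqF.
  by rewrite sqrtr_sqr gtr0_norm ?divr_gt0 ?mulr_gt0//; field; rewrite !gt_eqF.
rewrite {1}E ler_pM2l ?divr_gt0//.
have [m0|m0] := leP 0 m; first by rewrite ler_sqrt.
by rewrite (ltr0_sqrtr m0) leNgt sqrtr_gt0 c_gt0 leNgt (lt_trans m0).
Qed.

Lemma comparison_atoms :
  let m : R := fine (eta [set b ^+ 2]) in
  let norm_eta1 : R := fine ('N[eta1]_1[(fun t => (t^-1)%:E)])%E in
  y0 <= b / a * Num.sqrt m /\
  charge_ge xi_c (cscale (y0 ^+ 2)
    (cadd (cscale (norm_eta1 - a ^+ 2 / b ^+ 2) (delta 0%R))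
          (cscale (a ^+ 2 / b ^+ 2) (delta 1%R)))) <->
  atom_conditions y a b xi eta.
Proof.
move=> m norm_eta1; rewrite sqrt_bound /charge_ge.
set nu := csub _ _; pose u := y0 ^+ 2 * (norm_eta1 - a ^+ 2 / b ^+ 2).
have e01 : (0 : R) != 1 by rewrite eq_sym oner_eq0.
have nuE A : measurable A ->
    (nu A = xi A - (u%:E * \d_(0%R : R) A + c%:E * \d_(1%R : R) A))%E.
  move=> mA; rewrite -[LHS]/(xi A + (-1)%R%:E * ((y0 ^+ 2)%:E *
    ((norm_eta1 - a ^+ 2 / b ^+ 2)%:E * \d_(0%R : R) A +
     (a ^+ 2 / b ^+ 2)%:E * \d_(1%R : R) A)))%E.
  rewrite EFinN mulN1e; congr (_ - _)%E.
  rewrite muleDr ?fin_num_adde_defl ?fin_numM ?fin_num_measure//.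
  have -> : c = y0 ^+ 2 * (a ^+ 2 / b ^+ 2) by ring.
  by rewrite !muleA -!EFinM.
have uE : u = 1 - fine (eta [set 0]) - c.
  rewrite /u /norm_eta1 (Lnorm_inv eta_berger eta1_berger).
  by field; rewrite !gt_eqF ?weight_gt0.
rewrite (positive_two_atoms e01 nuE) uE /atom_conditions.
by split=> [[P [Q S]]|[P Q S]]; do ?split=> //; lra.
Qed.

End conditions.

(** * The Berger measure *)

Section measure_difference.
Variables (d : measure_display) (T : measurableType d) (R : realType).
Local Open Scope ereal_scope.

(** The whole space and the empty set form a Hahn decomposition, so the positive Jordan part is the
    required measure. *)
Lemma positive_charge_measure (nu : {charge set T -> \bar R}) : positive_charge nu ->
  exists m : {finite_measure set T -> \bar R}, forall A, measurable A -> m A = nu A.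
Proof.
move=> pos; have hd : hahn_decomposition nu setT set0.
  split=> //; last by rewrite setI0.
  - by split=> // A _; rewrite subset0 => ->; rewrite charge0.
  - by rewrite setU0.
exists (jordan_pos hd) => A mA.
by rewrite -[LHS]/(crestr0 nu measurableT A) /crestr0 mem_set// /crestr setIT.
Qed.

Lemma finite_measure_of (p : {measure set T -> \bar R}) : fin_num_fun p ->
  exists p' : {finite_measure set T -> \bar R}, forall A, p' A = p A.
Proof.
move=> fin; pose p1 : {measure set T -> \bar R} := mscale (NngNum ler01) p.
have p1E A : p1 A = p A by exact: mul1e.
have f1 : fin_num_fun p1 by move=> A mA; rewrite p1E fin.
by exists (HB.pack_for {finite_measure set T -> \bar R} (p1 : set T -> \bar R)
  (Measure.class p1) (Measure_isFinite.Build _ _ _ p1 f1)).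
Qed.

Lemma probability_of (p : {measure set T -> \bar R}) : p setT = 1 ->
  exists p' : probability T R, forall A, p' A = p A.
Proof.
move=> pT; pose p1 : {measure set T -> \bar R} := mscale (NngNum ler01) p.
have p1E A : p1 A = p A by exact: mul1e.
have f1 : p1 setT = 1 by rewrite p1E.
by exists (HB.pack_for (probability T R) (p1 : set T -> \bar R)
  (Measure.class p1) (Measure_isProbability.Build _ _ _ p1 f1)).
Qed.

Lemma measure_difference (p q : {measure set T -> \bar R}) : p setT < +oo ->
  (forall A, measurable A -> q A <= p A) ->
  exists m : {finite_measure set T -> \bar R}, forall A, measurable A -> p A = m A + q A.
Proof.
move=> poo qp.
have pfin : fin_num_fun p.
  move=> A mA; rewrite ge0_fin_numE//; apply: le_lt_trans poo.
  by apply: le_measure; rewrite ?inE.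
have qfin : fin_num_fun q.
  move=> A mA; rewrite ge0_fin_numE//; apply: (le_lt_trans (qp A mA)).
  by rewrite -ge0_fin_numE// pfin.
have [p' p'E] := finite_measure_of pfin; have [q' q'E] := finite_measure_of qfin.
pose nu : {charge set T -> \bar R} :=
  csub (charge_of_finite_measure p') (charge_of_finite_measure q').
have nuE A : nu A = p A - q A.
  by rewrite -[LHS]/(p' A + (-1)%R%:E * q' A) p'E q'E EFinN mulN1e.
have [|m mE] := @positive_charge_measure nu.
  split=> // A mA _; rewrite [X in _ <= X]nuE sube_ge0; last by rewrite qfin.
  exact: qp.
by exists m => A mA; rewrite mE// [X in _ = X + _]nuE subeK// qfin.
Qed.

End measure_difference.

Section power_integral.
Variables (R : realType) (m : {finite_measure set R -> \bar R}) (M : R).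
Hypothesis m0 : m (~` `[0, M]%classic) = 0%E.

Let mD : measurable (`[0, M]%classic : set R). Proof. exact: measurable_itv. Qed.

Lemma scaled_power_integral k r :
  m.-integrable setT (fun s => (s ^+ k * r)%:E) /\
  (\int[m]_s (s ^+ k * r)%:E = ((\int[m]_(s in `[0, M]) s ^+ k) * r)%:E)%E.
Proof.
have mf : measurable_fun setT (fun s : R => s ^+ k * r).
  by apply: measurable_funM => //; exact: measurable_expr.
have bf : bdm `[0, M] (fun s : R => s ^+ k * r).
  by apply: bdmM => //; [exact: bdm_expr|exact: bdm_cst].
split; first exact: concentrated_integrable bf.
rewrite (concentrated_integral mD m0 mf bf) RintegralZr//.
by apply: bdm_integrable => //; exact: bdm_expr.
Qed.

End power_integral.

(** * The planar measure, as a difference of two positive measures *)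

Section planar_measures.
Variables (R : realType) (xi eta : probability R R) (c beta2 : R).
Hypothesis c_ge0 : 0 <= c.

Let embed1 (s : R) : R * R := (s, 0).
Let embed2 (t : R) : R * R := (0, t).

Let measurable_embed1 : measurable_fun setT embed1. Proof. exact: measurable_pair2. Qed.
Let measurable_embed2 : measurable_fun setT embed2. Proof. exact: measurable_pair1. Qed.

Let row_map := HB.pack_for {mfun R >-> (R * R)%type} embed1
  (isMeasurableFun.Build _ _ _ _ _ measurable_embed1).
Let column_map := HB.pack_for {mfun R >-> (R * R)%type} embed2
  (isMeasurableFun.Build _ _ _ _ _ measurable_embed2).

Let row_measure : {measure set (R * R) -> \bar R} := distribution xi row_map.
Let column_measure : {measure set (R * R) -> \bar R} := distribution eta column_map.
Let atom r (r0 : 0 <= r) p : {measure set (R * R) -> \bar R} := mscale (NngNum r0) \d_p.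

(** The added terms of the planar measure; the subtracted ones form [corner_measure]. *)
Definition cross_measure : {measure set (R * R) -> \bar R} :=
  measure_add (measure_add row_measure column_measure) (atom c_ge0 (1, beta2)).

Lemma cross_measureE A : cross_measure A =
  (xi [set s | A (s, 0%R)] + eta [set t | A (0%R, t)] + c%:E * (\1_A (1%R, beta2))%:E)%E.
Proof.
rewrite [LHS]measure_addE [X in (X + _)%E]measure_addE.
by [].
Qed.

Lemma measurable_monomial k j : measurable_fun setT (fun p : R * R => p.1 ^+ k * p.2 ^+ j).
Proof.
apply: measurable_funM; apply: measurable_funX; [exact: measurable_fst|exact: measurable_snd].
Qed.

Lemma cross_measure_moments (M : R) k j :
  xi (~` `[0, M]%classic) = 0%E -> eta (~` `[0, M]%classic) = 0%E ->
  cross_measure.-integrable setT (fun p => (p.1 ^+ k * p.2 ^+ j)%:E) /\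
  (\int[cross_measure]_p (p.1 ^+ k * p.2 ^+ j)%:E =
   ((\int[xi]_(s in `[0, M]) s ^+ k) * 0 ^+ j + 0 ^+ k * (\int[eta]_(t in `[0, M]) t ^+ j)
     + c * beta2 ^+ j)%:E)%E.
Proof.
move=> xi0 eta0; pose f (p : R * R) := p.1 ^+ k * p.2 ^+ j.
have mf : measurable_fun setT f by exact: measurable_monomial.
have mEf : measurable_fun setT (EFin \o f) by exact/measurable_EFinP.
have [ir Er] := scaled_power_integral xi0 k (0 ^+ j).
have [ic Ec] := scaled_power_integral eta0 j (0 ^+ k).
have ir' : xi.-integrable setT ((EFin \o f) \o row_map) := ir.
have ic' : eta.-integrable setT ((EFin \o f) \o column_map).
  by apply: eq_integrable ic => // t _; rewrite /= mulrC.
have [ia Ea] := scaled_dirac_integral (NngNum c_ge0) ((1, beta2) : R * R) mf.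
have ir2 : row_measure.-integrable setT (EFin \o f).
  exact: (integrable_pushforward measurable_embed1 mEf).
have ic2 : column_measure.-integrable setT (EFin \o f).
  exact: (integrable_pushforward measurable_embed2 mEf).
have irc := integrable_measure_add ir2 ic2.
split; first exact: integrable_measure_add irc ia.
rewrite -[fun p => _]/(EFin \o f) integral_measure_add// integral_measure_add// Ea.
rewrite [X in (X + _ + _)%E](integral_distribution mEf ir').
rewrite [X in (_ + X + _)%E](integral_distribution mEf ic').
rewrite [X in (X + _ + _)%E]Er.
under [X in (_ + X + _)%E]eq_integral do rewrite /= /f /= mulrC.
by rewrite Ec -!EFinD /f /= expr1n mul1r [0 ^+ k * _]mulrC.
Qed.

Variable (z : R).
Hypothesis z_ge0 : 0 <= z.

Definition corner_measure : {measure set (R * R) -> \bar R} :=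
  measure_add (measure_add (atom z_ge0 (0, 0)) (atom c_ge0 (1, 0))) (atom c_ge0 (0, beta2)).

Lemma corner_measureE A : corner_measure A =
  (z%:E * (\1_A (0%R, 0%R))%:E + c%:E * (\1_A (1%R, 0%R))%:E + c%:E * (\1_A (0%R, beta2))%:E)%E.
Proof.
by rewrite [LHS]measure_addE [X in (X + _)%E]measure_addE.
Qed.

Lemma corner_measure_moments k j :
  (\int[corner_measure]_p (p.1 ^+ k * p.2 ^+ j)%:E =
   (z * (0 ^+ k * 0 ^+ j) + c * 0 ^+ j + c * (0 ^+ k * beta2 ^+ j))%:E)%E.
Proof.
have mf : measurable_fun setT _ := measurable_monomial k j.
have [i0 E0] := scaled_dirac_integral (NngNum z_ge0) ((0, 0) : R * R) mf.
have [i1 E1] := scaled_dirac_integral (NngNum c_ge0) ((1, 0) : R * R) mf.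
have [i2 E2] := scaled_dirac_integral (NngNum c_ge0) ((0, beta2) : R * R) mf.
have i01 := integrable_measure_add i0 i1.
rewrite integral_measure_add// integral_measure_add// E0 E1 E2.
by rewrite !EFinD /= expr1n mul1r.
Qed.

End planar_measures.

Section berger_measure.
Variable R : realType.
Variables (alpha beta : weights R (nat * nat)) (x y : weights R nat) (a b : R).
Variables (xi eta : probability R R).
Hypotheses (a_gt0 : 0 < a) (b_gt0 : 0 < b).
Hypothesis T_H0 : class_H0 (wshift1 alpha) (wshift2 beta).
Hypothesis alpha_x : forall k1, alpha (k1, 0%N) = x k1.
Hypothesis beta_y : forall k2, beta (0%N, k2) = y k2.
Hypothesis alpha_a : alpha (0%N, 1%N) = a.
Hypothesis alpha_1 : forall k1 k2, (1 <= k1)%N -> (1 <= k2)%N -> alpha (k1, k2) = 1.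
Hypothesis beta_b : forall k1 k2, (1 <= k1)%N -> (1 <= k2)%N -> beta (k1, k2) = b.
Hypothesis xi_berger : is_berger x xi.
Hypothesis eta_berger : is_berger y eta.

Local Notation T1 := (wshift1 alpha).
Local Notation T2 := (wshift2 beta).
Local Notation c := (a ^+ 2 * y 0%N ^+ 2 / b ^+ 2).
Local Notation w := (path_weight alpha y).
Local Notation square M := (`[0, M]%classic `*` `[0, M]%classic : set (R * R)).

Definition planar_berger (A : set (R * R)) : R :=
  fine (xi [set s | A (s, 0)]) + fine (eta [set t | A (0, t)]) + c * \1_A (1, b ^+ 2) -
  ((1 - c) * \1_A (0, 0) + c * \1_A (1, 0) + c * \1_A (0, b ^+ 2)).

Let c_ge0 : 0 <= c. Proof. by apply: ltW; exact: c_gt0. Qed.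

Let upper := cross_measure xi eta (b ^+ 2) c_ge0.

Let row_section (A : set (R * R)) : measurable A -> measurable [set s | A (s, 0)].
Proof.
by move=> mA; rewrite -[X in measurable X]setTI; exact: (measurable_pair2 (0 : R)).
Qed.

Let column_section (A : set (R * R)) : measurable A -> measurable [set t | A (0, t)].
Proof.
by move=> mA; rewrite -[X in measurable X]setTI; exact: (measurable_pair1 (0 : R)).
Qed.

Let measurable_square M : measurable (square M).
Proof. exact: measurableX. Qed.

Let upperE A : measurable A -> upper A =
  (fine (xi [set s | A (s, 0)]) + fine (eta [set t | A (0, t)]) + c * \1_A (1, b ^+ 2))%:E.
Proof.
move=> mA; rewrite [LHS]cross_measureE !EFinD !fineK ?fin_num_measure//.
- exact: column_section.
- exact: row_section.
Qed.

Lemma planar_decomposition : atom_conditions y a b xi eta ->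
  exists (z : R) (z0 : 0 <= z) (mu : probability (R * R)%type R), 1 - c = z /\
   forall A, measurable A -> mu A = (planar_berger A)%:E /\
     upper A = (mu A + corner_measure (b ^+ 2) c_ge0 z0 A)%E.
Proof.
move=> [C1 C2 C3].
have c1 : 0 <= 1 - c.
  rewrite subr_ge0; apply: le_trans C2 _.
  by rewrite -lee_fin fineK ?fin_num_measure// probability_le1.
exists (1 - c), c1; pose lower := corner_measure (b ^+ 2) c_ge0 c1.
have lowerE A : lower A =
    ((1 - c) * \1_A (0, 0) + c * \1_A (1, 0) + c * \1_A (0, b ^+ 2))%:E.
  by rewrite [LHS]corner_measureE !EFinD.
have upper_fin : (upper setT < +oo)%E by rewrite upperE// ltry.
have e01 : (0 : R) != 1 by rewrite eq_sym oner_eq0.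
have e0b : (0 : R) != b ^+ 2 by rewrite eq_sym gt_eqF// exprn_gt0.
have [|m mE] := measure_difference (q := lower) upper_fin.
  (* The row pays for the atom at [(1, 0)] and the column for the one at [(0, b^2)]. Both keep their
     atoms at the origin, which together cover [1 - c] by [C3]. *)
  move=> A mA; rewrite upperE// lowerE lee_fin.
  have rowle : fine (xi [set 0]) * \1_A (0, 0) + c * \1_A (1, 0) <=
      fine (xi [set s | A (s, 0)]).
    exact: (two_atoms_le e01 (lexx _) C2 (row_section mA)).
  have colle : fine (eta [set 0]) * \1_A (0, 0) + c * \1_A (0, b ^+ 2) <=
      fine (eta [set t | A (0, t)]).
    exact: (two_atoms_le e0b (lexx _) C1 (column_section mA)).
  have i0 (p : R * R) : 0 <= \1_A p :> R by rewrite indicE.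
  have := i0 (0, 0); have := mulr_ge0 c_ge0 (i0 (1, b ^+ 2)).
  nra.
have mP A : measurable A -> m A = (planar_berger A)%:E.
  move=> mA; have := mE A mA; rewrite upperE// [X in (_ + X)%E]lowerE.
  rewrite -(fineK (fin_num_measure m _ mA)) -EFinD => -[E].
  by rewrite /planar_berger E addrK.
have m1 : m setT = 1%E.
  rewrite mP// /planar_berger !indicT !mulr1; congr _%:E.
  rewrite (_ : [set s : R | _] = setT) 1?(_ : [set t : R | _] = setT) ?probability_setT//=; ring.
have [mu muE] := probability_of m1.
exists mu; split=> // A mA; rewrite muE.
by split; [exact: mP|exact: mE].
Qed.

(* The moments pin down the marginal bounds: [support_bound] turns the growth
   [w k 0 <= opnorm T1 ^ k] into a bound on the support. *)
Lemma planar_berger2 : atom_conditions y a b xi eta ->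
  exists mu : probability (R * R)%type R, is_berger2 T1 T2 mu /\
    forall A, measurable A -> mu A = (planar_berger A)%:E.
Proof.
move=> C; have [T12 sub1 sub2] := T_H0.
have [z [z0 [mu [zE muE]]]] := planar_decomposition C.
have [M [M1 bM [xi0 xiE] [eta0 etaE]]] :=
  common_support b alpha_x xi_berger eta_berger.
have M0 : 0 <= M by apply: le_trans M1.
have mD := measurable_square M.
have up0 : upper (~` square M) = 0%E.
  rewrite [LHS]cross_measureE.
  rewrite (_ : [set s | (~` square M) (s, 0)] = ~` `[0, M]%classic); last first.
    by apply/seteqP; split=> s; rewrite /setC /setX /mkset /= !in_itv/= lexx M0 => sM; [move=> ?; apply: sM|move=> []].
  rewrite (_ : [set t | (~` square M) (0, t)] = ~` `[0, M]%classic); last first.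
    by apply/seteqP; split=> s; rewrite /setC /setX /mkset /= !in_itv/= lexx M0 => sM; [move=> ?; apply: sM|move=> []].
  rewrite xi0 eta0 indicE memNset ?mule0 ?adde0//=.
  by apply; split; rewrite /= in_itv/= ?ler01// exprn_ge0// ltW.
have mu0 : mu (~` square M) = 0%E.
  have [_ E] := muE _ (measurableC mD).
  by apply/eqP; rewrite eq_le measure_ge0 andbT -up0 E leeDl.
have bd1 : bdm (square M) fst.
  split; first exact: measurable_funTS.
  by exists M => p [/= + _]; rewrite in_itv/= => /andP[p0 pM]; rewrite ger0_norm.
have bd2 : bdm (square M) snd.
  split; first exact: measurable_funTS.
  by exists M => p [/= _]; rewrite in_itv/= => /andP[p0 pM]; rewrite ger0_norm.
have mom k j : (\int[mu]_p (p.1 ^+ k * p.2 ^+ j)%:E = (w k j ^+ 2)%:E)%E.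
  have [iu Eu] := cross_measure_moments (b ^+ 2) c_ge0 k j xi0 eta0.
  have [im il E] := integral_measure_split (fun A mA => (muE A mA).2) iu.
  move: E; rewrite Eu corner_measure_moments xiE etaE -zE.
  rewrite -(fineK (integrable_fin_num measurableT im)) -EFinD => -[/esym E].
  congr _%:E; apply: (addIr ((1 - c) * (0 ^+ k * 0 ^+ j) + c * 0 ^+ j + c * (0 ^+ k * (b ^+ 2) ^+ j))).
  (* The powers of 0 are 1 for exponent 0, so the axes and the origin are separate cases. *)
  rewrite E; case: k {iu Eu im il E} => [|k]; case: j => [|j].
  - by rewrite /path_weight !big_ord0; ring.
  - by rewrite !expr0n /=; ring.
  - by rewrite !expr0n /=; ring.
  - by rewrite [w k.+1 j.+1 ^+ 2](path_weight_sqr b_gt0 T_H0 beta_y alpha_a alpha_1 beta_b)// exprM !expr0n /=; ring.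
have momD k j : \int[mu]_(p in square M) (p.1 ^+ k * p.2 ^+ j) = w k j ^+ 2.
  have bf : bdm (square M) (fun p => p.1 ^+ k * p.2 ^+ j) by apply: bdmM => //; exact: bdmX.
  have := mom k j; rewrite (concentrated_integral mD mu0 _ bf); last exact: measurable_monomial.
  by case.
(* Each weight is the norm of the image of a unit vector, hence at most the operator norm. *)
have unit_bound (T : {linear ell2Z R -> ell2Z R}) k (r : R) l : subnormal T -> 0 <= r ->
    T (ebasis R k) = r%:C%C *: ebasis R l -> r <= opnorm T.
  move=> /subnormal_bounded bT r0 Tk.
  have e1 i : hnorm (ebasis R i) = 1 by apply/eqP; rewrite -sqrp_eq1 ?hnorm_ge0// hnormE /ip hdot_ebasis eqxx.
  by have := opnorm_bound bT (e1 k); rewrite Tk hnormZ e1 mulr1 /= expr0n/= addr0 sqrtr_sqr ger0_norm.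
have sqr_le (u v : R) : 0 <= u -> u <= v -> u ^+ 2 <= v ^+ 2.
  by move=> u0 uv; rewrite lerXn2r// nnegrE (le_trans u0).
have row k : w k 0 <= opnorm T1 ^+ k.
  elim: k => [|k IH]; first by rewrite /path_weight !big_ord0 mulr1 expr0.
  rewrite path_weightS1 exprSr.
  apply: ler_pM IH _; [exact/ltW/path_weight_gt0|exact/ltW/weight_gt0|].
  exact: (unit_bound _ _ _ _ sub1 (ltW (weight_gt0 alpha _)) (wshift1E alpha k 0%N)).
have column k : w 0 k <= opnorm T2 ^+ k.
  elim: k => [|k IH]; first by rewrite /path_weight !big_ord0 mulr1 expr0.
  rewrite (path_weightS2 T_H0 beta_y) exprSr.
  apply: ler_pM IH _; [exact/ltW/path_weight_gt0|exact/ltW/weight_gt0|].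
  exact: (unit_bound _ _ _ _ sub2 (ltW (weight_gt0 beta _)) (wshift2E beta 0%N k)).
have s1 : mu (square M `&` [set p | opnorm T1 ^+ 2 < p.1]) = 0%E.
  apply: (support_bound (M := M)) => //.
  - exact: measurable_funTS.
  - by move=> p [/= + _]; rewrite in_itv.
  - exact: sqr_ge0.
  - move=> k; have := momD k 0; under eq_Rintegral do rewrite expr0 mulr1.
    move=> ->; rewrite -exprM mulnC exprM; apply: sqr_le; [exact/ltW/path_weight_gt0|exact: row].
have s2 : mu (square M `&` [set p | opnorm T2 ^+ 2 < p.2]) = 0%E.
  apply: (support_bound (M := M)) => //.
  - exact: measurable_funTS.
  - by move=> p [/= _]; rewrite in_itv.
  - exact: sqr_ge0.
  - move=> k; have := momD 0%N k; under eq_Rintegral do rewrite expr0 mul1r.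
    move=> ->; rewrite -exprM mulnC exprM; apply: sqr_le; [exact/ltW/path_weight_gt0|exact: column].
exists mu; split; last by move=> A /muE[].
split; last by move=> k j; rewrite mom /moment hnormE (ip_iter_shifts _ beta_y).
have mfst (r : R) : measurable (square M `&` [set p | r < p.1]).
  rewrite (_ : [set p | _] = fst @^-1` `]r, +oo[%classic).
    by apply: measurableI => //; rewrite -[X in measurable X]setTI; exact: measurable_fst.
  by apply/seteqP; split=> p /=; rewrite in_itv/= andbT.
have msnd (r : R) : measurable (square M `&` [set p | r < p.2]).
  rewrite (_ : [set p | _] = snd @^-1` `]r, +oo[%classic).
    by apply: measurableI => //; rewrite -[X in measurable X]setTI; exact: measurable_snd.
  by apply/seteqP; split=> p /=; rewrite in_itv/= andbT.
apply: (@subset_measure0 _ _ _ mu _ (~` square M `|` ((square M `&` [set p | opnorm T1 ^+ 2 < p.1]) `|`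
  (square M `&` [set p | opnorm T2 ^+ 2 < p.2])))).
- by apply: measurableC; exact: measurableX.
- by apply: measurableU; [exact: measurableC|exact: measurableU].
- move=> p pN; have [sp|] := pselect (square M p); last by left.
  right; have [r1|r1] := ltP (opnorm T1 ^+ 2) p.1; first by left.
  have [r2|r2] := ltP (opnorm T2 ^+ 2) p.2; first by right.
  by case: pN; move: sp => [/=]; rewrite !in_itv/= => /andP[-> _] /andP[-> _].
- have s12 : mu (square M `&` [set p | opnorm T1 ^+ 2 < p.1] `|` square M `&` [set p | opnorm T2 ^+ 2 < p.2]) = 0%E.
    by apply: etrans s1; apply: measureU0 s2.
  by apply: etrans mu0; apply: measureU0 s12; [exact: measurableC|exact: measurableU].
Qed.

End berger_measure.

Lemma berger2_unique (R : realType) (T1 T2 : {linear ell2Z R -> ell2Z R})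
    (mu nu : probability (R * R)%type R) :
  is_berger2 T1 T2 mu -> is_berger2 T1 T2 nu -> forall A, measurable A -> mu A = nu A.
Proof.
move=> [mu0 mumom] [nu0 numom].
set r1 := opnorm T1 ^+ 2 in mu0 nu0; set r2 := opnorm T2 ^+ 2 in mu0 nu0.
pose M := Num.max r1 r2; pose D := `[0, M]%classic `*` `[0, M]%classic : set (R * R).
have mD : measurable D by exact: measurableX.
have widen (m : probability (R * R)%type R) :
    m (~` (`[0, r1]%classic `*` `[0, r2]%classic)) = 0%E -> m (~` D) = 0%E.
  apply: subset_measure0; [exact: measurableC|by apply: measurableC; exact: measurableX|].
  apply: subsetC => -[u v] [/=]; rewrite !in_itv/= => /andP[p10 p1] /andP[p20 p2].
  by split; rewrite /= in_itv/= ?p10 ?p20 le_max ?p1 ?p2 ?orbT.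
have bd j k : bdm D (fun p => p.1 ^+ j * p.2 ^+ k).
  have ge0M (s : R) : s \in `[0, M] -> `|s| <= M.
    by rewrite in_itv/= => /andP[s0 sM]; rewrite ger0_norm.
  apply: bdmM => //; apply: bdmX => //.
  - by split; [exact: measurable_funTS|exists M => p [+ _]; exact: ge0M].
  - by split; [exact: measurable_funTS|exists M => p [_]; exact: ge0M].
apply: (moment_determinacy (M := M)); [exact: widen|exact: widen|move=> k j].
apply: EFin_inj; have mf := @measurable_monomial R k j.
rewrite -(concentrated_integral mD (widen _ mu0) mf (bd k j)).
by rewrite -(concentrated_integral mD (widen _ nu0) mf (bd k j)) mumom numom.
Qed.

Section berger_formula.
Variables (R : realType) (y : weights R nat) (a b : R) (xi eta eta1 : probability R R).
Hypotheses (a_gt0 : 0 < a) (b_gt0 : 0 < b).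
Hypothesis eta_berger : is_berger y eta.
Hypothesis eta1_berger : is_berger (fun n => y n.+1) eta1.
Hypothesis C : atom_conditions y a b xi eta.

Local Notation y0 := (y 0%N).
Local Notation c := (a ^+ 2 * y0 ^+ 2 / b ^+ 2).
Local Notation delta p := (charge_of_finite_measure (\d_(p : R)) : {charge set R -> \bar R}).
Local Notation xi_c := (charge_of_finite_measure xi : {charge set R -> \bar R}).
Local Notation psi := (psi_charge a b eta1).
Local Notation norm_psi := (norm_psi_val a b eta1).
Local Notation phi := (phi_charge y a b xi eta1).

Let c_ge0 : 0 <= c. Proof. by apply: ltW; exact: c_gt0. Qed.

Let e0b : (0 : R) != b ^+ 2. Proof. by rewrite eq_sym gt_eqF// exprn_gt0. Qed.

Variable A : set (R * R).
Hypothesis mA : measurable A.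

Let measurable_row r : measurable [set s | A (s, r)].
Proof. by rewrite -[X in measurable X]setTI; exact: (measurable_pair2 r). Qed.

Let row_indicator r :
  xi.-integrable setT (EFin \o (fun s => \1_A (s, r))) /\
  (\int[xi]_s (\1_A (s, r))%:E = (fine (xi [set s | A (s, r)]))%:E)%E.
Proof.
have E : (fun s => \1_A (s, r)) = \1_([set s | A (s, r)]) :> (R -> R) by [].
rewrite E; split; first by apply: integrable_indic; rewrite ?setTI// -ge0_fin_numE// fin_num_measure.
rewrite integral_indic//; last exact: measurable_row.
by rewrite fineK ?fin_num_measure//; congr (xi _); exact: setIT.
Qed.

(** This is [1 - eta {0} - c], and the atoms of [eta] at 0 and [b^2] have total mass at most 1. It
    allows [phi] to be handled by [cintegral_two_atoms]. *)
Lemma scaled_norm_ge0 : 0 <= y0 ^+ 2 * norm_psi.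
Proof.
rewrite (norm_psi_scaled a b_gt0 eta_berger eta1_berger).
have [C1 _ _] := C.
have etaT : fine (eta setT) = 1 by rewrite probability_setT.
have := two_atoms_le e0b (lexx (fine (eta [set 0]))) C1 measurableT.
by rewrite !in_setT !mulr1 etaT; lra.
Qed.

Lemma phi_term : cprod phi (csub (delta 0) (delta (b ^+ 2))) A =
  (fine (xi [set s | A (s, 0%R)]) - fine (xi [set s | A (s, b ^+ 2)]) -
   (y0 ^+ 2 * norm_psi * (\1_A (0, 0) - \1_A (0, b ^+ 2)) +
    c * (\1_A (1, 0) - \1_A (1, b ^+ 2))))%:E.
Proof.
pose g (s : R) : R := \1_A (s, 0) - \1_A (s, b ^+ 2).
have [i0 E0] := row_indicator 0; have [ib Eb] := row_indicator (b ^+ 2).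
have mg : measurable_fun setT g.
  by apply: measurable_funB; apply/measurable_EFinP; [exact: measurable_int i0|exact: measurable_int ib].
have ig : xi.-integrable setT (EFin \o g).
  have := integrableB measurableT i0 ib; apply: eq_integrable => // s _.
have gE : (fun s => csub (delta 0) (delta (b ^+ 2)) (xsection A s)) = EFin \o g.
  apply/funext => s; rewrite -[LHS]/((\1_(xsection A s) (0 : R))%:E + (-1)%:E * (\1_(xsection A s) (b ^+ 2))%:E)%E.
  by rewrite EFinN mulN1e -EFinB /g !indicE !mem_xsection.
rewrite /cprod gE.
rewrite (cintegral_two_atoms scaled_norm_ge0 c_ge0 mg (fun B _ => phi_chargeE y a b xi eta1 B) ig).
under eq_integral do rewrite EFinB.
by rewrite integralB// E0 Eb -!EFinB.
Qed.

Lemma row_term : cprod xi_c (delta (b ^+ 2)) A = (fine (xi [set s | A (s, b ^+ 2)]))%:E.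
Proof.
pose g (s : R) : R := \1_A (s, b ^+ 2).
have [ib Eb] := row_indicator (b ^+ 2).
have mg : measurable_fun setT g by apply/measurable_EFinP; exact: measurable_int ib.
have gE : (fun s => delta (b ^+ 2) (xsection A s)) = EFin \o g.
  apply/funext => s; rewrite -[LHS]/((\1_(xsection A s) (b ^+ 2))%:E).
  by rewrite /g /= !indicE !mem_xsection.
have xiE B : measurable B -> (xi_c B = xi B - (0%:E * \d_(0%R : R) B + 0%:E * \d_(0%R : R) B))%E.
  by move=> _; rewrite !mul0e adde0 sube0.
by rewrite /cprod gE (cintegral_two_atoms (lexx 0) (lexx 0) mg xiE ib) Eb !mul0r addr0 sube0.
Qed.

Let measurable_nonzero : measurable (~` [set (0 : R)]). Proof. exact: measurableC. Qed.

(* The case [psi = 0], where the [psi_tilde] term of the formula is read as 0. *)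
Lemma eta_single_atom (B : set R) : measurable B -> norm_psi = 0 ->
  fine (eta (B `&` ~` [set 0])) = c * \1_B (b ^+ 2).
Proof.
move=> mB n0; have [C1 _ _] := C.
have := norm_psi_scaled a b_gt0 eta_berger eta1_berger.
rewrite n0 mulr0 -eta_nonzero => eta_c.
have eb0 : b ^+ 2 != 0 by rewrite eq_sym.
have bound (E : set R) : measurable E ->
    c * \1_E (b ^+ 2) <= fine (eta (E `&` ~` [set 0])).
  move=> mE.
  have := two_atoms_le eb0 C1 (fine_ge0 (measure_ge0 eta [set 0])) (measurableI _ _ mE measurable_nonzero).
  rewrite mul0r addr0 indicE; congr (_ * _%:R <= _).
  by rewrite in_setI in_setC in_set1 eb0 andbT.
have split_eta : fine (eta (~` [set 0])) =
    fine (eta (B `&` ~` [set 0])) + fine (eta (~` B `&` ~` [set 0])).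
  rewrite -fineD ?fin_num_measure//; try exact: measurableI.
  - rewrite -measureU.
    + by rewrite -setIUl setUv setTI.
    + exact: measurableI.
    + by apply: measurableI => //; exact: measurableC.
    + by rewrite setIACA setICr set0I.
  - by apply: measurableI => //; exact: measurableC.
(* The lower bounds for [B] and its complement add up to [c], the whole mass off 0, so both are
   equalities. *)
have := bound _ mB; have := bound _ (measurableC mB).
have -> : \1_(~` B) (b ^+ 2) = 1 - \1_B (b ^+ 2) :> R.
  by rewrite !indicE in_setC; case: (_ \in B); rewrite ?subrr ?subr0.
lra.
Qed.

Lemma column_term :
  ((y0 ^+ 2 * norm_psi)%:E * cprod (delta 0%R)
    (fun B => cdensity psi (fun t => (t * norm_psi)^-1)%R B - delta (b ^+ 2)%R B) A =
  (fine (eta [set t | A (0%R, t)]) - fine (eta [set 0%R]) * \1_A (0%R, 0%R) -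
   c * \1_A (0%R, (b ^+ 2)%R) - y0 ^+ 2 * norm_psi * \1_A (0%R, (b ^+ 2)%R))%:E)%E.
Proof.
pose E (s : R) := fine (eta (xsection A s `&` ~` [set 0%R])).
pose I (s : R) : R := \1_A (s, b ^+ 2).
pose h (s : R) := (y0 ^- 2 * E s - a ^+ 2 / b ^+ 2 * I s) / norm_psi - I s.
have mx s : measurable (xsection A s) by exact: measurable_xsection.
have IE s : I s = \1_(xsection A s) (b ^+ 2) by rewrite /I !indicE mem_xsection.
have hE : (fun s => cdensity psi (fun t => (t * norm_psi)^-1)%R (xsection A s)
    - delta (b ^+ 2)%R (xsection A s))%E = EFin \o h.
  apply/funext => s; rewrite /cdensity (psi_integral a b eta_berger eta1_berger _ (mx s)).
  by rewrite -[X in (_ - X)%E]/((\1_(xsection A s) (b ^+ 2))%:E) -EFinB [RHS]/= /h IE.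
have mI : measurable_fun setT I.
  by have [ib _] := row_indicator (b ^+ 2); apply/measurable_EFinP; exact: measurable_int ib.
have mE : measurable_fun setT E.
  apply/measurable_EFinP.
  have -> : EFin \o E = (mrestr eta measurable_nonzero) \o xsection A.
    apply/funext => s; rewrite /E /= fineK// fin_num_measure//.
    exact: measurableI.
  exact: measurable_fun_xsection.
have mh : measurable_fun setT h.
  apply: measurable_funB => //; apply: measurable_funM => //.
  by apply: measurable_funB; apply: measurable_funM.
have [ih Eh] := scaled_dirac_integral (NngNum ler01) (0 : R) mh.
have nuE B : measurable B -> (delta 0%R B = mscale (NngNum ler01) (\d_(0%R : R)) B -
    (0%:E * \d_(0%R : R) B + 0%:E * \d_(0%R : R) B))%E.
  by move=> _; rewrite !mul0e adde0 sube0; apply/esym; exact: mul1e.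
rewrite /cprod hE (cintegral_two_atoms (lexx 0) (lexx 0) mh nuE ih) Eh.
rewrite !mul0r addr0 sube0 -EFinM mul1r; congr _%:E.
have eta0 : fine (eta [set t | A (0, t)]) = E 0 + fine (eta [set 0]) * \1_A (0%R, 0%R).
  have AE : [set t | A (0, t)] = xsection A 0.
    by apply/seteqP; split=> t; rewrite /xsection /= inE.
  have E0 : fine (eta (xsection A 0 `&` [set 0])) = fine (eta [set 0]) * \1_A (0%R, 0%R).
    rewrite indicE -mem_xsection; have [x0|x0] := boolP (0 \in xsection A 0).
      by rewrite mulr1 setIidr// => t ->; exact/set_mem.
    rewrite mulr0 (_ : _ `&` _ = set0) ?measure0//; apply/seteqP; split=> // t [/[swap] ->].
    by move=> /mem_set; rewrite (negPf x0).
  rewrite AE -E0 -fineD ?fin_num_measure//; try exact: measurableI.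
  rewrite -measureU; try exact: measurableI.
    by rewrite -setIUr setUC setUv setIT.
  by rewrite setIACA setICl setI0.
rewrite eta0 addrK /h -/(I 0).
(* Here the left side is 0 by its coefficient, and the right side vanishes because [eta] off 0 is
   [c] times the point mass at [b^2]. *)
have [n0|n0] := eqVneq norm_psi 0.
  by rewrite n0 mulr0 !mul0r subr0 IE -eta_single_atom// subrr.
by field; rewrite n0 !gt_eqF ?weight_gt0.
Qed.

Lemma berger_formula_planar :
  (cprod phi (csub (delta 0%R) (delta (b ^+ 2)%R)) A
   + (y0 ^+ 2 * norm_psi)%:E * cprod (delta 0%R)
      (fun B => cdensity psi (fun t => (t * norm_psi)^-1)%R B - delta (b ^+ 2)%R B) A
   + cprod xi_c (delta (b ^+ 2)%R) A = (planar_berger y a b xi eta A)%:E)%E.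
Proof.
rewrite phi_term column_term row_term -!EFinD; congr _%:E.
rewrite (norm_psi_scaled a b_gt0 eta_berger eta1_berger) /planar_berger.
ring.
Qed.

End berger_formula.

Theorem proposition3p1 (R : realType)
    (alpha beta : weights R (nat * nat)) (x y : weights R nat) (a b : R)
    (xi eta eta1 : probability R R)
    (a_gt0 : 0 < a) (b_gt0 : 0 < b)
    (T_H0 : class_H0 (wshift1 alpha) (wshift2 beta))
    (T_flat : flat alpha beta)
    (alpha_x : forall k1, alpha (k1, 0%N) = x k1)
    (beta_y : forall k2, beta (0%N, k2) = y k2)
    (alpha_a : alpha (0%N, 1%N) = a)
    (alpha_1 : forall k1 k2, (1 <= k1)%N -> (1 <= k2)%N -> alpha (k1, k2) = 1)
    (beta_b : forall k1 k2, (1 <= k1)%N -> (1 <= k2)%N -> beta (k1, k2) = b)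
    (xi_berger : is_berger x xi)
    (eta_berger : is_berger y eta)
    (eta1_berger : is_berger (fun n => y n.+1) eta1) :
  let T1 := wshift1 alpha in
  let T2 := wshift2 beta in
  let y0 := y 0%N in
  let m : R := fine (eta [set b ^+ 2]) in
  let delta (p : R) : {charge set R -> \bar R} :=
    charge_of_finite_measure (\d_p) in
  let xi_c : {charge set R -> \bar R} := charge_of_finite_measure xi in
  let psi : {charge set R -> \bar R} :=
    csub (charge_of_finite_measure eta1) (cscale (a ^+ 2) (delta (b ^+ 2)%R)) in
  let inv_t (t : R) : \bar R := (t^-1)%:E in
  let norm_psi : R := fine (cintegral psi inv_t) in
  let norm_eta1 : R := fine ('N[eta1]_1[inv_t])%E in
  let phi : {charge set R -> \bar R} :=
    csub (csub xi_c (cscale (y0 ^+ 2 * norm_psi) (delta 0%R)))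
         (cscale (a ^+ 2 * y0 ^+ 2 / b ^+ 2) (delta 1%R)) in
  let psi_tilde : set R -> \bar R := cdensity psi (fun t => (t * norm_psi)^-1) in
  let berger_formula (A : set (R * R)) : \bar R :=
    (cprod phi (csub (delta 0%R) (delta (b ^+ 2)%R)) A
     + (y0 ^+ 2 * norm_psi)%:E
       * cprod (delta 0%R) (fun B => psi_tilde B - delta (b ^+ 2)%R B) A
     + cprod xi_c (delta (b ^+ 2)%R) A)%E in
  let cond_i := subnormal_pair T1 T2 in
  let cond_ii := positive_charge psi /\ positive_charge phi in
  let cond_iii :=
    y0 <= b / a * Num.sqrt m /\
    charge_ge xi_c
      (cscale (y0 ^+ 2)
        (cadd (cscale (norm_eta1 - a ^+ 2 / b ^+ 2) (delta 0%R))
              (cscale (a ^+ 2 / b ^+ 2) (delta 1%R)))) in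
  [/\ cond_i <-> cond_ii,
      cond_ii <-> cond_iii &
      cond_i ->
        (exists mu : probability (R * R)%type R, is_berger2 T1 T2 mu) /\
        forall mu : probability (R * R)%type R, is_berger2 T1 T2 mu ->
          forall A, measurable A -> mu A = berger_formula A].
Proof.
move=> T1 T2 y0 m delta xi_c psi inv_t norm_psi norm_eta1 phi psi_tilde berger_formula
  cond_i cond_ii cond_iii.
have iC : cond_i <-> atom_conditions y a b xi eta.
  split; first exact: (subnormal_atoms a_gt0 b_gt0 T_H0 alpha_x beta_y alpha_a alpha_1 beta_b xi_berger eta_berger).
  exact: (atoms_subnormal a_gt0 b_gt0 T_H0 alpha_x beta_y alpha_a alpha_1 beta_b xi_berger eta_berger).
have iiC : cond_ii <-> atom_conditions y a b xi eta.
  exact: (positive_charges_atoms a xi b_gt0 eta_berger eta1_berger).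
have iiiC : cond_iii <-> atom_conditions y a b xi eta.
  exact: (comparison_atoms xi a_gt0 b_gt0 eta_berger eta1_berger).
split; [by rewrite iC iiC|by rewrite iiC iiiC|move=> /iC C].
have [mu [muB muE]] := planar_berger2 a_gt0 b_gt0 T_H0 alpha_x beta_y alpha_a alpha_1 beta_b
  xi_berger eta_berger C.
split; first by exists mu.
move=> nu nuB A mA; rewrite (berger2_unique nuB muB mA) muE//.
exact/esym/(berger_formula_planar a_gt0 b_gt0 eta_berger eta1_berger C mA).
Qed.
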